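(* Let $\alpha\in[1,2)$ and set $\kappa_\alpha:=\frac{2-\alpha}{2}$, $\nu_\alpha:=\frac{\alpha-1}{2-\alpha}$. Let $J_{\nu_\alpha}$ be the Bessel function of the first kind of order $\nu_\alpha$ and let $(j_{\nu_\alpha+1,n})_{n\ge1}$ be the increasing sequence of positive zeros of the Bessel function $J_{\nu_\alpha+1}$. Consider the eigenvalue problem of finding $\lambda\in\mathbb R$ and $\Phi\in H^2_\alpha(0,1)$, $\Phi\not\equiv0$, such that $$-(x^\alpha\Phi')'=\lambda\Phi \ \text{ in }(0,1),\qquad (x^\alpha\Phi')(0)=0,\qquad \Phi'(1)=0. \qquad ( * )$$ Then the set of solutions $(\lambda,\Phi)$ of $( * )$ is $$\{(\lambda_{\alpha,n},\rho\,\Phi_{\alpha,n}) : n\in\mathbb N=\{0,1,2,\dots\},\ \rho\in\mathbb R\setminus\{0\}\},$$ where $\lambda_{\alpha,0}=0$, $\Phi_{\alpha,0}(x)=1$, and for $n\ge1$ $$\lambda_{\alpha,n}=\kappa_\alpha^2\,j_{\nu_\alpha+1,n}^2,\qquad \Phi_{\alpha,n}(x)=K_{\alpha,n}\,x^{\frac{1-\alpha}{2}}\,J_{\nu_\alpha}\bigl(j_{\nu_\alpha+1,n}\,x^{\frac{2-\alpha}{2}}\bigr),$$ the positive constant $K_{\alpha,n}$ being chosen so that $\|\Phi_{\alpha,n}\|_{L^2(0,1)}=1$. Moreover, $(\Phi_{\alpha,n})_{n\ge0}$ is an orthonormal basis of $L^2(0,1)$. Additionally, the sequence $\bigl(\sqrt{\lambda_{\alpha,n+1}}-\sqrt{\lambda_{\alpha,n}}\bigr)_{n\ge1}$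 is decreasing and $$\sqrt{\lambda_{\alpha,n+1}}-\sqrt{\lambda_{\alpha,n}}\to\frac{2-\alpha}{2}\,\pi\quad\text{as }n\to\infty.$$
   Context: All function spaces consist of real-valued functions. For $\alpha\in[1,2)$, $H^1_\alpha(0,1)$ is the space of $u\in L^2(0,1)$ that are locally absolutely continuous in $(0,1]$ and satisfy $x^{\alpha/2}u_x\in L^2(0,1)$; $H^2_\alpha(0,1):=\{u\in H^1_\alpha(0,1): x^\alpha u_x\in H^1(0,1)\}$. For $u\in H^2_\alpha(0,1)$ the function $x^\alpha u_x$ extends continuously to $[0,1]$, so its values at $0$ and $1$ make sense. The Bessel function of order $\nu$ of the first kind is $J_\nu(y)=\sum_{m\ge0}\frac{(-1)^m}{m!\,\Gamma(m+\nu+1)}(y/2)^{2m+\nu}$, $y>0$. *)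

(* Defs.v *)
From HB Require Import structures.
From mathcomp Require Import all_boot all_order all_algebra.
From mathcomp Require Import all_classical all_reals all_analysis.

Set Implicit Arguments.
Unset Strict Implicit.
Unset Printing Implicit Defensive.

Import Order.TTheory GRing.Theory Num.Theory.
Import numFieldNormedType.Exports.

Local Open Scope classical_set_scope.
Local Open Scope ring_scope.

(* Functions on (0,1), (0,1] or [0,1] are represented by total functions
   R -> R; no definition below depends on values outside the interval.
   Elements of L^2(0,1) are represented by Borel functions. *)

Section FunctionSpaces.
Variable R : realType.
Implicit Types (f g u : R -> R) (a b alpha : R).

Definition restr01 f : R -> R := f \_ `]0, 1[.

Definition L2 f : Prop := restr01 f \in Lfun lebesgue_measure 2%:E.

Definition L2norm f : \bar R := 'N[lebesgue_measure]_2%:E [EFin \o restr01 f].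

Definition L2dot f g : R := \int[lebesgue_measure]_(x in `]0, 1[) (f x * g x).

Definition ae01 (P : R -> Prop) : Prop :=
  {ae lebesgue_measure, forall x : R, x \in `]0, 1[ -> P x}.

Definition abs_continuous a b f : Prop :=
  forall eps : R, 0 < eps -> exists2 delta : R, 0 < delta &
    forall (n : nat) (s t : 'I_n -> R),
      (forall i, a <= s i /\ s i <= t i /\ t i <= b) ->
      trivIset setT (fun i => `]s i, t i[%classic) ->
      \sum_(i < n) (t i - s i) < delta ->
      \sum_(i < n) `|f (t i) - f (s i)| < eps.

Definition loc_abs_continuous01 f : Prop :=
  forall a b, 0 < a -> a < b -> b <= 1 -> abs_continuous a b f.

(* In the next definitions the derivative of an absolutely continuous function
   is its pointwise derivative, which exists almost everywhere. *)

(* H^1(0,1) as a space of classes of functions modulo a.e. equality: g is the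
   representative that is absolutely continuous on [0,1]. *)
Definition H1 f : Prop :=
  exists g, [/\ abs_continuous 0 1 g, ae01 (fun x => f x = g x) & L2 (derive1 g)].

(* Elements of H^1_alpha are represented by their locally absolutely continuous
   representative on (0,1]. *)
Definition H1w alpha u : Prop :=
  [/\ L2 u, loc_abs_continuous01 u & L2 (fun x => x `^ (alpha / 2) * derive1 u x)].

Definition flux alpha u : R -> R := fun x => x `^ alpha * derive1 u x.

Definition H2w alpha u : Prop := H1w alpha u /\ H1 (flux alpha u).

(* (e n) is an orthonormal family and every f in L^2(0,1) is the sum, in
   L^2(0,1), of its expansion along e. *)
Definition orthonormal_basis (e : nat -> R -> R) : Prop :=
  [/\ forall n, L2 (e n),
      forall m n, L2dot (e m) (e n) = (m == n)%:R
    & forall f, L2 f ->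
        L2norm (fun x => f x - \sum_(k < N) L2dot f (e k) * e k x)
          @[N --> \oo] --> 0%E].

(* For Phi in H^2_alpha, x^alpha Phi' is continuous on (0,1) and extends
   continuously to [0,1]; the boundary values at 0 and 1 are those of the
   extension, that is, one-sided limits. *)
Definition eigen_solution alpha (lambda : R) (Phi : R -> R) : Prop :=
  [/\ H2w alpha Phi /\ (exists2 x, x \in `]0, 1[ & Phi x != 0),
      ae01 (fun x => - derive1 (flux alpha Phi) x = lambda * Phi x),
      flux alpha Phi x @[x --> 0^'+] --> 0
    & derive1 Phi x @[x --> 1^'-] --> 0].

End FunctionSpaces.

Section Bessel.
Variable R : realType.
Implicit Types nu x y : R.

Definition Gamma x : R :=
  \int[lebesgue_measure]_(t in `]0, +oo[) (t `^ (x - 1) * expR (- t)).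

(* Meant for y > 0. *)
Definition besselJ nu y : R :=
  limn (series (fun m : nat =>
    (-1) ^+ m / (m`!%:R * Gamma (m%:R + nu + 1)) * (y / 2) `^ (2 * m%:R + nu))).

(* For n >= 1, the n-th positive zero of J_nu: each zero is the least one beyond
   the previous one, starting from the convention bessel_zero nu 0 = 0. *)
Fixpoint bessel_zero nu (n : nat) : R :=
  if n is n'.+1
  then inf [set y | bessel_zero nu n' < y /\ besselJ nu y = 0]
  else 0.

End Bessel.

Section EigenPairs.
Variable R : realType.
Implicit Types alpha x : R.

Definition kappa alpha : R := (2 - alpha) / 2.

Definition nu alpha : R := (alpha - 1) / (2 - alpha).

Definition eigval alpha (n : nat) : R :=
  if n is 0%N then 0
  else kappa alpha ^+ 2 * bessel_zero (nu alpha + 1) n ^+ 2.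

Definition bessel_mode alpha (n : nat) : R -> R := fun x =>
  x `^ ((1 - alpha) / 2) *
  besselJ (nu alpha) (bessel_zero (nu alpha + 1) n * x `^ ((2 - alpha) / 2)).

(* The positive constant K_(alpha,n) normalizing bessel_mode in L^2(0,1). *)
Definition normalization alpha (n : nat) : R :=
  (fine (L2norm (bessel_mode alpha n)))^-1.

Definition eigfun alpha (n : nat) : R -> R := fun x =>
  if n is 0%N then 1 else normalization alpha n * bessel_mode alpha n x.

Definition sqrt_gap alpha (n : nat) : R :=
  Num.sqrt (eigval alpha n.+1) - Num.sqrt (eigval alpha n).

End EigenPairs.

(* Main.v *)
Require Import Defs.
From HB Require Import structures.
From mathcomp Require Import all_boot all_order all_algebra.
From mathcomp Require Import all_classical all_reals all_analysis.
From mathcomp Require Import measurable_realfun ring lra.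
Import Order.TTheory GRing.Theory Num.Theory.
Import numFieldNormedType.Exports.
Set Implicit Arguments.
Unset Strict Implicit.
Unset Printing Implicit Defensive.
Local Open Scope classical_set_scope.
Local Open Scope ring_scope.

(** The equation - (x^alpha u')' = lambda u is a singular Sturm-Liouville
    equation.  Writing v = x^alpha u' for the flux, it becomes the system
    u' = x^(-alpha) v, v' = - lambda u, which has one solution [sol lambda]
    that is regular at 0, with value 1 and flux 0 there.  Up to a constant it
    is x^((1 - alpha)/2) J_nu(sqrt lambda / kappa * x^kappa), but it is defined
    here for every real lambda through the entire function
    [hyp c z] = sum_m (-z)^m / (m! (c)_m), c = nu + 1, which leaves no power of
    x singular at 0.  Since hyp' is a multiple of hyp at c + 1, the flux of
    [sol lambda] at 1 is
    - lambda * hyp (c + 1) (lambda / (2 kappa)^2): it vanishes exactly at 0 and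
    at the values kappa^2 j^2 with j a positive zero of J_(nu + 1).

    Eigenpairs.  A solution in H^2_alpha is only known to satisfy the equation
    almost everywhere.  The fundamental theorem of calculus for absolutely
    continuous functions ([seqAC_FTC]: bounded variation, Radon-Nikodym and
    Lebesgue differentiation) shows that u and its flux are C^1 on (0,1).
    The Wronskian of u and [sol lambda] is then constant; if it were not 0,
    then u would be at least of order 1/x at 0, hence not in L^2.  So u is a
    multiple of [sol lambda] ([L2_solution_multiple]), and the condition at 1
    selects lambda.

    Gaps.  sqrt y * J_mu(y) solves w'' + (1 - (mu^2 - 1/4)/y^2) w = 0.  For
    mu = nu + 1 >= 1 the potential increases strictly to 1.  Sturm comparison
    with sin gives gaps larger than pi, comparison of w with its own translate
    shows that the gaps decrease, and comparison with sin (k y) for k < 1 close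
    to 1 gives the limit pi.

    Completeness.  If u belongs to the form domain and vanishes at the zeros of
    the n-th eigenfunction, Picone's identity gives
    int x^alpha u'^2 >= lambda_n int u^2 ([picone]).  The n-th eigenfunction
    has at most n zeros in (0,1), by Rolle's theorem between consecutive zeros
    of J_(nu + 1), and the first n eigenfunctions interpolate arbitrary values
    at these zeros ([interpolation]).  Hence the same inequality holds for every
    u orthogonal to the first n eigenfunctions ([minimax]), and the remainder
    of the expansion of u has squared norm at most
    (int x^alpha u'^2) / lambda_n, which tends to 0.  Functions of the form
    domain are dense in L^2 ([form_dense]), and orthonormal expansions are best
    approximations, so the expansion of every L^2 function converges. *)

(** * Absolutely continuous functions are integrals of their derivatives *)

Section AC.
Variable R : realType.
Implicit Types (a b x y eps eta : R) (f G : R -> R) (p q : R * R) (L : seq (R * R)).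

(** Comparing endpoints, rather than asking the open intervals to be disjoint,
    keeps degenerate intervals harmless. *)
Definition nonoverlap p q := (p.2 <= q.1) || (q.2 <= p.1).
Definition subintervals a b L :=
  all (fun p => (a <= p.1) && (p.1 <= p.2) && (p.2 <= b)) L && pairwise nonoverlap L.
(** Absolute continuity tested on sequences of intervals: families can then be
    concatenated, refined and reordered without reindexing. *)
Definition seqAC a b f := forall eps, 0 < eps -> 
  exists2 delta, 0 < delta & forall L, subintervals a b L ->
    \sum_(p <- L) (p.2 - p.1) < delta ->
    \sum_(p <- L) `|f p.2 - f p.1| < eps.

Lemma abs_continuous_seq a b f : abs_continuous a b f -> seqAC a b f.
Proof.
move=> acf eps /acf[d d0 fd]; exists d => // L /andP[/allP aL pL].
rewrite !(big_nth (0, 0)) !big_mkord; apply: fd.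
  move=> i; have /aL /andP[/andP[-> ->] ->//] : nth (0, 0) L i \in L.
  exact: mem_nth.
move=> i j _ _ [x [/= xi xj]]; apply/eqP; apply: contraPT xi => ij.
move: xj; rewrite /= !in_itv/=.
wlog : i j ij / (i < j)%N => [wl|lij].
  move=> /[dup] xj; move: (ij); rewrite neq_ltn => /orP[/wl|/wl]; first exact.
  by move=> + _ xi => /(_ _ xi xj); apply; rewrite eq_sym.
have /(pairwiseP (0, 0)) := pL.
move=> /(_ i j (ltn_ord i) (ltn_ord j) lij)/orP[] h /andP[a1 a2] /andP[a3 a4].
  by have := lt_trans a1 (lt_le_trans a4 h); rewrite ltxx.
by have := lt_trans a3 (lt_le_trans a2 h); rewrite ltxx.
Qed.

Lemma seqAC_sub a b c d f : a <= c -> d <= b -> seqAC a b f -> seqAC c d f.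
Proof.
move=> ac db acf eps /acf[e e0 fe]; exists e => // L /andP[/allP aL pL].
apply: fe; rewrite /subintervals pL andbT; apply/allP => p /aL.
by move=> /andP[/andP[/(le_trans ac)-> ->] /= /le_trans]; exact.
Qed.

Lemma seqACB a b f g : seqAC a b f -> seqAC a b g -> seqAC a b (fun x => f x - g x).
Proof.
move=> acf acg eps e0; have e2 : 0 < eps / 2 by rewrite divr_gt0.
have [d d0 fd] := acf _ e2; have [d' d'0 gd] := acg _ e2.
exists (Num.min d d') => [|L aL]; first by rewrite lt_min d0.
rewrite lt_min => /andP[/(fd _ aL) A /(gd _ aL) B].
rewrite [ltRHS]splitr; apply: le_lt_trans (ltrD A B).
rewrite -big_split/=; apply: ler_sum => p _.
rewrite (le_trans _ (ler_normB _ _))// le_eqVlt; apply/orP; left.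
by apply/eqP; congr `|_|; ring.
Qed.

Definition chain x (s : seq R) := zip (x :: s) s.

Lemma sum_chain (F : R * R -> R) x y s :
  \sum_(p <- chain x (y :: s)) F p = F (x, y) + \sum_(p <- chain y s) F p.
Proof. by rewrite /chain /= big_cons. Qed.

Lemma chain_length x s : \sum_(p <- chain x s) (p.2 - p.1) = last x s - x.
Proof.
elim: s x => [|y s ih] x; first by rewrite big_nil subrr.
by rewrite sum_chain ih/=; ring.
Qed.

Lemma chain_variation a b f s : itv_partition a b s ->
  variation a b f s = \sum_(p <- chain a s) `|f p.2 - f p.1|.
Proof.
move=> /variation_zip ->; elim: s a => [|y s ih] a; first by rewrite !big_nil.
by rewrite sum_chain /= big_cons ih.
Qed.

Lemma chain_subintervals a b s : itv_partition a b s -> subintervals a b (chain a s).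
Proof.
elim: s a => [|y s ih] a; first by [].
move=> /[dup] + /itv_partition_cons ysb => -[/=/andP[ay _] _].
have /andP[/allP h1 h2] := ih _ ysb.
apply/andP; split.
  rewrite /= lexx (ltW ay) (itv_partition_le ysb)/=; apply/allP => p /h1.
  by move=> /andP[/andP[yp -> ->]]; rewrite !andbT (le_trans (ltW ay) yp).
rewrite /= h2 andbT; apply/allP => p /h1 /andP[/andP[yp _] _].
by rewrite /nonoverlap/= yp.
Qed.

(** Every partition of a short interval is a family of short total length, so
    absolute continuity bounds the variation uniformly; this is what makes the
    total variation finite. *)
Lemma small_total_variation_le1 a b f : seqAC a b f -> exists2 d, 0 < d &
  forall x y, a <= x -> x <= y -> y <= b -> y - x < d -> (total_variation x y f <= 1)%E.
Proof.
move=> /(_ 1 ltr01)[d d0 fd]; exists d => // x y ax xy yb xyd.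
apply: ge_ereal_sup => _ [v [s xys <-] <-]; rewrite lee_fin.
rewrite chain_variation//; apply/ltW/fd.
  have /andP[/allP h1 h2] := chain_subintervals xys.
  rewrite /subintervals h2 andbT; apply/allP => p /h1.
  by move=> /andP[/andP[/(le_trans ax)-> ->] /= /le_trans]; exact.
by rewrite chain_length; case: xys => _ /eqP->.
Qed.

Lemma seqAC_bounded_variation a b f : a <= b -> seqAC a b f -> bounded_variation a b f.
Proof.
move=> ab acf; apply/bounded_variationP => //.
have [d d0 fd] := small_total_variation_le1 acf.
have [n nd] : exists n : nat, (b - a) / n.+1%:R < d.
  exists (Num.trunc ((b - a) / d)); rewrite ltr_pdivrMr ?ltr0n// mulrC -ltr_pdivrMr//.
  by rewrite truncnS_gt.
pose c k : R := a + k%:R * ((b - a) / n.+1%:R).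
have h0 : 0 <= (b - a) / n.+1%:R by rewrite divr_ge0 ?subr_ge0.
have ac k : a <= c k by rewrite lerDl mulr_ge0.
have cc k : c k <= c k.+1 by rewrite /c lerD2l ler_wpM2r// ler_nat.
have cn : c n.+1 = b by rewrite /c mulrC mulfVK ?pnatr_eq0//; ring.
have cb k : (k <= n.+1)%N -> c k <= b.
  by move=> kn; rewrite -cn /c lerD2l ler_wpM2r// ler_nat.
suff H k : (k <= n.+1)%N -> total_variation a (c k) f \is a fin_num.
  by have := H n.+1 (leqnn _); rewrite cn.
elim: k => [_|k ih kn]; first by rewrite /c mul0r addr0 total_variationxx.
rewrite (total_variationD _ (ac k))// fin_numD ih ?(ltnW kn)//=.
rewrite ge0_fin_numE ?total_variation_ge0//.
apply: (@le_lt_trans _ _ 1%E); last exact: ltry.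
apply: fd => //; first exact: cb.
suff -> : c k.+1 - c k = (b - a) / n.+1%:R by [].
by rewrite /c -natr1; ring.
Qed.

(** The finite-valued indefinite variation of f. *)
Definition tv a f x : R := fine (total_variation a x f).

Lemma tv_fin a b f x : bounded_variation a b f -> a <= x -> x <= b ->
  total_variation a x f \is a fin_num.
Proof. by move=> bv ax xb; apply/bounded_variationP => //; exact: (bounded_variationl ax xb bv). Qed.

Lemma tv_increment a b f x y : bounded_variation a b f -> a <= x -> x <= y -> y <= b ->
  (tv a f y - tv a f x)%:E = total_variation x y f.
Proof.
move=> bv ax xy yb; have ay := le_trans ax xy.
rewrite EFinB !fineK ?(tv_fin bv)// ?(le_trans xy)//.
rewrite (total_variationD f ax xy) [X in (X - _)%E]addeC addeK//.
by rewrite (tv_fin bv)// (le_trans xy).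
Qed.

(** Each interval of the family is replaced by a partition that nearly
    realizes the variation of f on it. The total length is unchanged, so the
    modulus of continuity of f transfers to its variation. *)
Lemma refine_subintervals a b f L eta : bounded_variation a b f ->
  0 < eta -> subintervals a b L ->
  exists L', [/\ subintervals a b L',
    \sum_(p <- L') (p.2 - p.1) = \sum_(p <- L) (p.2 - p.1),
    \sum_(p <- L) (tv a f p.2 - tv a f p.1) <=
      \sum_(p <- L') `|f p.2 - f p.1| + eta
  & forall q, all (nonoverlap q) L -> all (nonoverlap q) L'].
Proof.
move=> bv; elim: L eta => [|p L ih] eta eta0 pL.
  by exists [::]; split => //; rewrite !big_nil add0r ltW.
have /andP[/= /andP[/andP[/andP[ap pp] pb] aL] /andP[npL nL]] := pL.
have e2 : 0 < eta / 2 by rewrite divr_gt0.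
have [|L' [sL' lenL' varL' nonL']] := ih _ e2; first by rewrite /subintervals aL nL.
have := tv_increment bv ap pp pb.
have tvfin : total_variation p.1 p.2 f \is a fin_num.
  by rewrite -(tv_increment bv ap pp pb).
(* half of eta is spent on the first interval, the other half on the rest of
   the family *)
have [_ [v [s ps <-] <-]] := ub_ereal_sup_adherent e2 tvfin.
rewrite -/(total_variation _ _ _) => + tvE; rewrite -tvE -EFinB lte_fin => var.
have /andP[/allP sc1 sc2] := chain_subintervals ps.
exists (chain p.1 s ++ L'); split.
- rewrite /subintervals all_cat pairwise_cat sc2; case/andP: sL' => -> ->.
  rewrite !andbT; apply/andP; split.
    apply/allP => r /sc1 /andP[/andP[/(le_trans ap)-> ->]/=] /le_trans; exact.
  apply/allrelP => r r' rs r'L'.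
  have /allP/(_ _ r'L') := nonL' _ npL.
  have /andP[/andP[pr rr] rp] := sc1 _ rs.
  by move=> /orP[h|h]; apply/orP; [left; apply: le_trans h|right; apply: le_trans pr].
- by rewrite big_cat big_cons/= chain_length lenL'; case: ps => _ /eqP ->.
- rewrite big_cat big_cons/= -(chain_variation f ps).
  rewrite [X in _ <= _ + X]splitr addrACA; apply: lerD => //.
  by rewrite -lerBlDr ltW.
- move=> q /= /andP[qp /nonL' qL']; rewrite all_cat qL' andbT.
  apply/allP => r rs; have /andP[/andP[pr rr] rp] := sc1 _ rs.
  by case/orP: qp => h; apply/orP; [left; apply: le_trans pr|right; apply: le_trans h].
Qed.

Lemma seqAC_tv a b f : a <= b -> seqAC a b f -> seqAC a b (tv a f).
Proof.
move=> ab acf eps e0; have bv := seqAC_bounded_variation ab acf.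
have e2 : 0 < eps / 2 by rewrite divr_gt0.
have [d d0 fd] := acf _ e2; exists d => // L sL Ld.
have [L' [sL' lenL' varL' _]] := refine_subintervals bv e2 sL.
have -> : \sum_(p <- L) `|tv a f p.2 - tv a f p.1| =
          \sum_(p <- L) (tv a f p.2 - tv a f p.1).
  rewrite !big_seq; apply: eq_bigr => p.
  move: sL => /andP[/allP h _] /h /andP[/andP[ap pp] pb].
  by rewrite ger0_norm// -lee_fin (tv_increment bv)// total_variation_ge0.
rewrite (le_lt_trans varL')// [ltRHS]splitr ltrD2r fd//.
by rewrite lenL'.
Qed.

Lemma tv_nondecreasing a b f x y : bounded_variation a b f ->
  a <= x -> x <= y -> y <= b -> tv a f x <= tv a f y.
Proof.
move=> bv ax xy yb; rewrite -subr_ge0 -lee_fin (tv_increment bv)//.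
exact: total_variation_ge0.
Qed.

Lemma tvB_nondecreasing a b f x y : bounded_variation a b f ->
  a <= x -> x <= y -> y <= b -> tv a f x - f x <= tv a f y - f y.
Proof.
move=> bv ax xy yb; rewrite -subr_ge0.
rewrite (_ : _ - _ = (tv a f y - tv a f x) - (f y - f x)); last by ring.
rewrite subr_ge0 -lee_fin (tv_increment bv)//.
by apply: le_trans (total_variation_ge _ xy); rewrite lee_fin ler_norm.
Qed.

(** Composing with this retraction of the line onto [a, b] turns conditions on
    [a, b] into conditions on the line. *)
Definition clamp a b x := Num.max a (Num.min b x).

Lemma clamp_in a b x : a <= b -> a <= clamp a b x <= b.
Proof. by move=> ab; rewrite /clamp le_max lexx/= ge_max ab ge_min lexx. Qed.

Lemma clamp_id a b x : a <= x <= b -> clamp a b x = x.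
Proof. by move=> /andP[ax xb]; rewrite /clamp min_r// max_r. Qed.

Lemma clamp_nd a b : {homo clamp a b : x y / x <= y}.
Proof.
move=> x y xy; rewrite /clamp ge_max le_max lexx/= le_max; apply/orP.
by right; rewrite le_min !ge_min lexx xy orbT.
Qed.

Lemma clamp_1lip a b x y : x <= y -> clamp a b y - clamp a b x <= y - x.
Proof. by rewrite /clamp /Num.max /Num.min; do 4!case: ifPn; lra. Qed.

Lemma seqAC_clamp_continuous a b f : a <= b -> seqAC a b f ->
  continuous (f \o clamp a b).
Proof.
move=> ab acf x; apply/cvgrPdist_lt => e e0.
have [d d0 fd] := acf _ e0.
have key u v : u <= v -> v - u < d -> `|f (clamp a b v) - f (clamp a b u)| < e.
  move=> uv vud; have := fd [:: (clamp a b u, clamp a b v)].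
  rewrite !big_seq1/=; apply; last exact: le_lt_trans (clamp_1lip _ _ uv) _.
  rewrite /subintervals/= clamp_nd// !andbT.
  by have /andP[-> _] := clamp_in u ab; have /andP[_ ->] := clamp_in v ab.
near=> y; have : `|x - y| < d.
  near: y; exact: (@cvgr_dist_lt _ R^o _ _ _ id).
rewrite /= ltr_norml => /andP[h1 h2].
have [xy|/ltW yx] := leP x y.
  by rewrite distrC; apply: key => //; lra.
exact: key.
Unshelve. all: by end_near. Qed.
Notation mu := (@lebesgue_measure R).

Lemma le_measure_subset d (T : measurableType d) (m : {measure set T -> \bar R}) (A B : set T) :
  measurable A -> measurable B -> A `<=` B -> (m A <= m B)%E.
Proof. by move=> mA mB; apply: le_measure; exact: mem_set. Qed.

(** The connected components of an open set need not be given by endpoints;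
    infimum and supremum recover them up to the endpoints themselves. *)
Lemma interval_inf_sup (J : set R) a b : a < b -> J `<=` `]a, b] -> is_interval J -> J !=set0 ->
  [/\ a <= inf J, inf J <= sup J, sup J <= b & `]inf J, sup J[ `<=` J].
Proof.
move=> ab Jab iJ J0; have lJ : has_lbound J.
  by exists a => x /Jab/=; rewrite in_itv/= => /andP[/ltW].
have uJ : has_ubound J by exists b => x /Jab/=; rewrite in_itv/= => /andP[].
split.
- by apply: lb_le_inf => // x /Jab/=; rewrite in_itv/= => /andP[/ltW].
- case: J0 => x Jx; apply: (@le_trans _ _ x); first exact: ge_inf.
  exact: ub_le_sup.
- by apply: ge_sup => // x /Jab/=; rewrite in_itv/= => /andP[].
- move=> z /=; rewrite in_itv/= => /andP[/(inf_lt J0)[u Ju uz] /(sup_gt J0)[v Jv zv]].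
  by apply: (iJ u v) => //; rewrite !ltW.
Qed.

Lemma disjoint_interval_hulls (I J : set R) : is_interval I -> is_interval J ->
  I !=set0 -> J !=set0 -> I `&` J = set0 -> sup I <= inf J \/ sup J <= inf I.
Proof.
wlog : I J / exists x y, [/\ I x, J y & x <= y] => [wl iI iJ I0 J0 IJ|].
  have [[x Ix] [y Jy]] := (I0, J0); have [xy|/ltW yx] := leP x y.
    by apply: wl => //; exists x, y.
  suff [h|h] : sup J <= inf I \/ sup I <= inf J by [right|left].
  by apply: wl => //; [exists y, x|rewrite setIC].
move=> [x [y [Ix Jy xy]]] iI iJ I0 J0 IJ; left.
have no z : I z -> J z -> False by move=> Iz Jz; have : (I `&` J) z by []; rewrite IJ.
apply: lb_le_inf => // v Jv; apply: ge_sup => // u Iu.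
have xv : x < v.
  rewrite ltNge; apply/negP => vx; apply: (no x) => //.
  by apply: (iJ v y) => //; rewrite vx.
rewrite leNgt; apply/negP => vu; apply: (no v) => //.
by apply: (iI x u) => //; rewrite !ltW.
Qed.

Lemma LSM_itv (H : cumulative R R) a b : a <= b ->
  lebesgue_stieltjes_measure H `]a, b]%classic = (H b - H a)%:E.
Proof.
move=> ab; rewrite /lebesgue_stieltjes_measure/= /measure_extension/=.
rewrite measurable_mu_extE//; last exact: is_ocitv.
exact: wlength_itv_bnd.
Qed.

(** Absolute continuity of H gives absolute continuity of the
    Lebesgue-Stieltjes measure of H: a null set lies in an open set U of small
    measure, the components of U in ]a, b] are disjoint intervals of small
    total length, and the sum of the increments of H over them is therefore
    small. *)
Lemma LSM_null (H : cumulative R R) a b (N : set R) : a < b -> seqAC a b H ->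
  measurable N -> mu N = 0%E ->
  lebesgue_stieltjes_measure H (N `&` `]a, b]) = 0%E.
Proof.
move=> ab acH mN N0; apply/eqP; rewrite eq_le measure_ge0 andbT.
apply/lee_addgt0Pr => eps eps0; rewrite add0e.
have [d d0 Hd] := acH _ eps0.
have Noo : (mu N < +oo)%E by rewrite N0.
have [U [oU NU UNd]] := @lebesgue_regularity_outer _ N d mN Noo d0.
have {}UNd : (mu (U `\` N) < d%:E)%E by exact: UNd.
have mU : measurable U by exact: open_measurable.
have {}Ud : (mu U < d%:E)%E.
  have -> : U = (U `\` N) `|` N by rewrite setUC setDUK.
  have mUN : measurable (U `\` N) by exact: measurableD.
  rewrite measureU//; last by rewrite setIC setDIK.
  by rewrite [X in (_ + X)%E]N0 adde0.
pose I := open_disjoint_itv oU; pose J k := I k `&` `]a, b].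
have oI k : open (I k) by exact: open_disjoint_itv_open.
have iI k : is_interval (I k) by exact: open_disjoint_itv_is_interval.
have tI : trivIset setT I by exact: open_disjoint_itv_trivIset.
have UI : U = \bigcup_k I k by exact: open_disjoint_itv_bigcup.
have iJ k : is_interval (J k).
  move=> x y [Ix xab] [Iy yab] z xzy; split; first exact: (iI k x y).
  exact: (interval_is_interval xab yab).
have mI k : measurable (I k) by exact: open_measurable.
have mJ k : measurable (J k) by exact: measurableI.
pose P k := if J k == set0 then (a, a) else (inf (J k), sup (J k)).
have PJ k : J k !=set0 -> P k = (inf (J k), sup (J k)).
  by move=> /set0P/negbTE; rewrite /P => ->.
have P0 k : [/\ a <= (P k).1, (P k).1 <= (P k).2 & (P k).2 <= b].
  rewrite /P; case: ifPn => [_|/set0P Jk0]; first by split => //=; exact: ltW.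
  by have [] := interval_inf_sup ab (@subIsetr _ _ _) (@iJ k) Jk0.
have Pmu k : (((P k).2 - (P k).1)%:E <= mu (I k))%E.
  rewrite /P; case: ifPn => [_|/set0P Jk0]; first by rewrite subrr measure_ge0.
  have [_ h1 _ h2] := interval_inf_sup ab (@subIsetr _ _ _) (@iJ k) Jk0.
  have -> : (sup (J k) - inf (J k))%:E = mu `]inf (J k), sup (J k)[%classic.
    rewrite lebesgue_measure_itv/= lte_fin; case: ltP => // h3.
    by rewrite (@le_anti _ _ (inf (J k)) (sup (J k))) ?subrr// h1.
  apply: le_measure_subset; [exact: measurable_itv|exact: mI|].
  by move=> x /h2[].
have LJ k : (lebesgue_stieltjes_measure H (J k) <= (H (P k).2 - H (P k).1)%:E)%E.
  have [a1 a2 a3] := P0 k; rewrite -LSM_itv//.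
  apply: le_measure_subset; [exact: mJ|exact: measurable_itv|].
  move=> x Jx; have J0 : J k !=set0 by exists x.
  rewrite PJ//= in_itv/=; have lJ : has_lbound (J k).
    by exists a => y [_]/=; rewrite in_itv/= => /andP[/ltW].
  have uJ : has_ubound (J k) by exists b => y [_]/=; rewrite in_itv/= => /andP[].
  rewrite ub_le_sup// andbT lt_neqAle ge_inf// andbT; apply/eqP => infx.
  have [Ix /=] := Jx; rewrite in_itv/= => /andP[ax xb].
  have : \forall y \near x, I k y /\ a < y.
    near=> y; split; first by near: y; apply: open_nbhs_nbhs.
    by near: y; exact: lt_nbhsr.
  move=> [e /= e0 he].
  (* the infimum of J k is not in J k, since I k is open and x > a; so J k
     lies in the half-open interval between its infimum and supremum *)
  have [|Iy ay] := he (x - e / 2).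
    by rewrite /ball_/= opprB addrC subrK gtr0_norm ?divr_gt0// ltr_pdivrMr// ltr_pMr// ltr1n.
  have /(ge_inf lJ) : J k (x - e / 2).
    split=> //=; rewrite in_itv/= ay/= (le_trans _ xb)// gerBl.
    by rewrite divr_ge0// ltW.
  by rewrite infx leNgt ltrBlDr ltrDl divr_gt0.
apply: (@le_trans _ _ (\sum_(k <oo) lebesgue_stieltjes_measure H (J k))%E).
  apply: measure_sigma_subadditive => //; first exact: measurableI.
  by rewrite -setI_bigcupl -UI; exact: setSI.
apply: lime_le; first by apply: is_cvg_nneseries => k _ _; exact: measure_ge0.
near=> n.
apply: (@le_trans _ _ (\sum_(0 <= k < n) (H (P k).2 - H (P k).1)%:E)%E).
  by apply: lee_sum => k _; exact: LJ.
rewrite sumEFin lee_fin.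
have sP : subintervals a b [seq P k | k <- index_iota 0 n].
  apply/andP; split.
    by apply/allP => _ /mapP[k _ ->]; have [-> -> ->] := P0 k.
  rewrite pairwise_map; apply/(pairwiseP 0%N) => i j.
  rewrite !inE size_iota subn0 => ni nj ij; rewrite !nth_iota ?subn0// !add0n /nonoverlap.
  have [i0|/set0P Ji] := eqVneq (J i) set0.
    by apply/orP; left; rewrite {1}/P i0 eqxx/=; have [] := P0 j.
  have [j0|/set0P Jj] := eqVneq (J j) set0.
    by apply/orP; right; rewrite {1}/P j0 eqxx/=; have [] := P0 i.
  have IJ0 : I i `&` I j = set0.
    by move/trivIsetP : tI; apply => //; rewrite ltn_eqF.
  rewrite /= !PJ//=; apply/orP; apply: disjoint_interval_hulls => //.
  by rewrite -subset0 -IJ0 => x [[? _] [? _]].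
have := Hd _ sP; rewrite !big_map => /(_ _)/ltW h.
apply: (@le_trans _ _ (\sum_(i <- index_iota 0 n) `|H (P i).2 - H (P i).1|)).
  by apply: ler_sum => k _; exact: ler_norm.
apply: h; rewrite -lte_fin -sumEFin; apply: le_lt_trans Ud.
apply: (@le_trans _ _ (\sum_(0 <= k < n) mu (I k))%E).
  by apply: lee_sum => k _; exact: Pmu.
have -> : (\sum_(0 <= k < n) mu (I k) = mu (\big[setU/set0]_(k < n) I k))%E.
  by rewrite big_mkord; apply/esym; exact: (measure_bigsetU mu mI tI).
apply: le_measure_subset; [|exact: mU|].
  by apply: bigsetU_measurable => k _; exact: mI.
by rewrite UI; exact: bigsetU_bigcup.
Unshelve. all: by end_near.
Qed.

(** The density is the Radon-Nikodym derivative of the Lebesgue-Stieltjes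
    measure of the extension of G by constants outside [a, b]. *)
Lemma seqAC_monotone_density a b G : a < b -> seqAC a b G ->
  (forall x y, a <= x -> x <= y -> y <= b -> G x <= G y) ->
  exists g : R -> R, mu.-integrable setT (EFin \o g) /\
    forall x, a <= x -> x <= b -> (G x - G a)%:E = (\int[mu]_(t in `]a, x]) (g t)%:E)%E.
Proof.
move=> ab acG ndG; have ab' := ltW ab.
pose H := G \o clamp a b.
have ndH : nondecreasing H.
  move=> x y xy /=; have /andP[? ?] := clamp_in x ab'; have /andP[? ?] := clamp_in y ab'.
  by apply: ndG => //; exact: clamp_nd.
have rcH : right_continuous H.
  by apply: right_continuousW; exact: seqAC_clamp_continuous.
pose Hm := isCumulative.Build R _ R H ndH rcH.
pose HC : cumulative R R := HB.pack H Hm.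
have acH : seqAC a b HC.
  move=> eps /acG[d d0 Gd]; exists d => // L sL Ld.
  rewrite (eq_big_seq (fun p => `|G p.2 - G p.1|)); first exact: Gd.
  move=> p pL; case/andP: sL => /allP/(_ _ pL)/andP[/andP[ap pp] pb] _.
  by rewrite /= /H/= !clamp_id// ?ap ?pb ?(le_trans ap pp) ?(le_trans pp pb).
have Hoo : (lebesgue_stieltjes_measure HC `]a, b]%classic < +oo)%E.
  by rewrite LSM_itv// ltry.
have mab : measurable (`]a, b]%classic : set (measurableTypeR R)) by [].
pose nu : {finite_measure set (measurableTypeR R) -> \bar R} := mfrestr mab Hoo.
have [|g [_ gfin ig nuE]] := @radon_nikodym_sigma_finite _ _ _ mu nu.
  by apply/null_content_dominatesP => N mN N0; exact: LSM_null.
exists (fine \o g); split.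
  by apply: eq_integrable ig => // x _ /=; rewrite fineK.
move=> x ax xb; under eq_integral do rewrite /= fineK//.
rewrite -nuE// /nu/= /mfrestr/= /mrestr.
have -> : (`]a, x] `&` `]a, b] = `]a, x])%classic.
  apply/seteqP; split=> [y []//|y /=]; rewrite !in_itv/= => /andP[ay yx].
  by rewrite ay yx (le_trans yx).
by rewrite [RHS](LSM_itv HC ax)/= /H/= !clamp_id ?lexx ?ax ?ab'.
Qed.

(** Jordan decomposition: f is the difference of the monotone functions tv f
    and tv f - f, both absolutely continuous. *)
Lemma seqAC_density a b f : a < b -> seqAC a b f ->
  exists g : R -> R, mu.-integrable setT (EFin \o g) /\
    forall x, a <= x -> x <= b -> f x - f a = \int[mu]_(t in `]a, x]) g t.
Proof.
move=> ab acf; have bv := seqAC_bounded_variation (ltW ab) acf.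
have acT := seqAC_tv (ltW ab) acf.
have [g [ig gE]] := seqAC_monotone_density ab acT
  (fun x y ax xy yb => tv_nondecreasing bv ax xy yb).
have [h [ih hE]] := seqAC_monotone_density ab (seqACB acT acf)
  (fun x y ax xy yb => tvB_nondecreasing bv ax xy yb).
exists (g \- h); split; first exact: (integrableB measurableT ig ih).
move=> x ax xb; rewrite RintegralB//; last 2 first.
- by apply: integrableS ig.
- by apply: integrableS ih.
by rewrite /Rintegral -gE// -hE//=; ring.
Qed.

Lemma derive1_near_shift f (F : R -> R) (y c : R) :
  (\forall z \near y, f z = F z + c) -> derivable F y 1 -> derive1 F y = derive1 f y.
Proof.
move=> fF dF.
have dFy : is_derive y 1 (F + cst c) ('D_1 F y + 0).
  by apply: is_deriveD; apply: DeriveDef.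
have fFy : \forall z \near y, (F + cst c) z = f z by apply: filterS fF => z ->.
by have [_ e] := near_eq_is_derive fFy dFy; rewrite !derive1E e addr0.
Qed.

(** By the Lebesgue differentiation theorem the density of f is its derivative
    almost everywhere, so any h that agrees with this derivative almost
    everywhere may replace the density. *)
Lemma seqAC_FTC a b f h : a < b -> seqAC a b f ->
  measurable_fun `]a, b] h ->
  {ae mu, forall x, a < x < b -> derive1 f x = h x} ->
  forall x, a <= x -> x <= b -> f x - f a = \int[mu]_(t in `]a, x]) h t.
Proof.
move=> ab acf mh fh x ax xb.
have [g [ig gE]] := seqAC_density ab acf.
rewrite gE//; congr fine; apply: ae_eq_integral => //.
- by apply/measurable_EFinP; apply: measurable_funTS; apply/measurable_EFinP; exact: measurable_int ig.
- apply/measurable_EFinP; apply: measurable_funS mh => //.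
  by apply: subset_itvl; rewrite bnd_simp.
have lg : locally_integrable [set: R] g.
  by apply: open_integrable_locally => //; exact: openT.
have [|A [mA A0 AF]] := @FTC1 R g (BRight a) _ lg.
  by move=> y; exact: integrableS ig.
have [B [mB B0 Bh]] := fh.
(* b is removed because the derivative is only controlled at interior points
   *)
exists (A `|` B `|` [set b]); split.
- by apply: measurableU => //; exact: measurableU.
- rewrite measureU0//; last exact: lebesgue_measure_set1.
    by rewrite measureU0.
  exact: measurableU.
move=> y /= ny; apply: contrapT => nAB; apply: ny => yax.
have yb : y < b.
  move: yax; rewrite in_itv/= => /andP[_ yx]; rewrite lt_neqAle (le_trans yx)// andbT.
  by apply/eqP => yb; apply: nAB; right.
have ay : a < y by move: yax; rewrite in_itv/= => /andP[].
pose F z := \int[mu]_(t in `]a, z]) g t.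
have [dF F'g] : derivable F (y : R) 1 /\ derive1 F y = g y.
  apply: contrapT => nn; apply: nAB; left; left; apply: AF => H; apply: nn.
  exact: (H ay).
have fy : derive1 f y = h y.
  apply: contrapT => nn; apply: nAB; left; right; apply: Bh => H; apply: nn.
  by apply: (H _); rewrite /= ay.
congr EFin; rewrite -fy -F'g; apply: (derive1_near_shift (c := f a) _ dF).
near=> z; rewrite /F -gE ?subrK//.
  by apply: ltW; near: z; exact: lt_nbhsr.
by apply: ltW; near: z; exact: lt_nbhsl.
Unshelve. all: by end_near. Qed.
End AC.

(** * The entire function behind the Bessel functions *)

Section Hyp.
Variable R : realType.
Implicit Types c z x y : R.

Definition rising c (m : nat) : R := \prod_(k < m) (c + k%:R).
Definition hyp_coef c (m : nat) : R := (-1) ^+ m / (m`!%:R * rising c m).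
(** The confluent limit function 0F1(; c; -z): J_nu(y) is (y/2)^nu / Gamma (nu
    + 1) times its value at c = nu + 1 and z = y^2/4. *)
Definition hyp c z : R := limn (pseries (hyp_coef c) z).

Lemma rising_ge1 c m : 1 <= c -> 1 <= rising c m.
Proof.
move=> c1; rewrite /rising; elim/big_ind : _ => // [x y x1 y1|i _].
  by rewrite -[1]mulr1 ler_pM.
by rewrite -[1]addr0 lerD.
Qed.

Lemma risingSl c m : rising c m.+1 = c * rising (c + 1) m.
Proof.
rewrite /rising big_ord_recl addr0; congr (_ * _); apply: eq_bigr => i _.
by rewrite /= /bump/= add1n -natr1; ring.
Qed.

Lemma risingSr c m : rising c m.+1 = rising c m * (c + m%:R).
Proof. by rewrite /rising big_ord_recr. Qed.

Lemma rising_gt0 c m : 1 <= c -> 0 < rising c m.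
Proof. by move=> c1; apply: lt_le_trans (rising_ge1 m c1). Qed.

(** Comparison with the exponential series, as the rising factorials of c >= 1
    are at least 1. *)
Lemma cvg_hyp c z : 1 <= c -> cvgn (pseries (hyp_coef c) z).
Proof.
move=> c1; apply: normed_cvg.
apply: (@series_le_cvg _ _ (exp_coeff `|z|)) (is_cvg_series_exp_coeff `|z|) => //= n.
  by rewrite /exp_coeff/= divr_ge0// exprn_ge0.
rewrite /exp_coeff/= normrM normrX mulrC /hyp_coef normrM normfV !normrM !normrX.
rewrite normrN1 expr1n mul1r; apply: ler_wpM2l; first exact: exprn_ge0.
rewrite [`|_%:R|]ger0_norm// [`|rising _ _|]gtr0_norm ?rising_gt0//.
rewrite lef_pV2 ?posrE ?mulr_gt0 ?rising_gt0 ?ltr0n ?fact_gt0//.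
by rewrite ler_peMr// rising_ge1.
Qed.

Lemma hyp_coef_diffs c : 1 <= c ->
  pseries_diffs (hyp_coef c) = (fun m => - c^-1 * hyp_coef (c + 1) m).
Proof.
move=> c1; apply/funext => m; rewrite /pseries_diffs /hyp_coef risingSl factS natrM exprS.
have r0 : rising (c + 1) m != 0 by rewrite gt_eqF// rising_gt0//; lra.
have c0 : c != 0 by rewrite gt_eqF//; lra.
have : m`!%:R != 0 :> R by rewrite pnatr_eq0 -lt0n fact_gt0.
have : m.+1%:R != 0 :> R by rewrite pnatr_eq0.
by move: (_%:R) (_%:R) => n f n0 f0; field; rewrite c0 r0 n0 f0.
Qed.

Lemma cvg_pseriesZ (a : R) (f : nat -> R) z : cvgn (pseries f z) ->
  pseries (fun m => a * f m) z @ \oo --> a * limn (pseries f z).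
Proof.
move=> cf; have -> : pseries (fun m => a * f m) z = (fun n => a * pseries f z n).
  apply/funext => n; rewrite /pseries /series/= mulr_sumr.
  by apply: eq_bigr => i _; rewrite mulrA.
exact: cvgMr.
Qed.

(** Termwise differentiation multiplies the coefficients by -1/c and shifts c;
    in terms of Bessel functions this is (y^(-nu) J_nu)' = - y^(-nu) J_(nu +
    1). *)
Lemma is_derive_hyp c z : 1 <= c -> is_derive z 1 (hyp c) (- c^-1 * hyp (c + 1) z).
Proof.
move=> c1; have c11 : 1 <= c + 1 by lra.
have c12 : 1 <= c + 1 + 1 by lra.
have -> : - c^-1 * hyp (c + 1) z = limn (pseries (pseries_diffs (hyp_coef c)) z).
  rewrite hyp_coef_diffs//; apply/esym/cvg_lim => //; apply: cvg_pseriesZ.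
  exact: cvg_hyp.
apply: (@pseries_snd_diffs _ _ (`|z| + 1)).
- exact: cvg_hyp.
- rewrite hyp_coef_diffs//; apply/cvg_ex; eexists; apply: cvg_pseriesZ.
  exact: cvg_hyp.
- rewrite hyp_coef_diffs//.
  have -> : pseries_diffs (fun m => - c^-1 * hyp_coef (c + 1) m) =
      (fun m => - c^-1 * pseries_diffs (hyp_coef (c + 1)) m).
    by apply/funext => m; rewrite /pseries_diffs; ring.
  rewrite hyp_coef_diffs//; apply/cvg_ex; eexists; apply: cvg_pseriesZ.
  apply/cvg_ex; eexists; apply: cvg_pseriesZ.
  exact: cvg_hyp.
- rewrite [ltRHS]ger0_norm ?addr_ge0//; lra.
Qed.

Lemma continuous_hyp c : 1 <= c -> continuous (hyp c).
Proof.
move=> c1 z; apply: differentiable_continuous; apply/derivable1_diffP.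
by have [] := is_derive_hyp z c1.
Qed.

Lemma hyp0 c : hyp c 0 = 1.
Proof.
apply/cvg_lim => //; rewrite -cvg_shiftS; apply: cvg_near_cst.
near=> n; rewrite /pseries /series/= big_nat_recl//= big1 ?addr0.
  by rewrite expr0 mulr1 /hyp_coef /rising expr0 fact0 big_ord0 mulr1 divr1.
by move=> i _; rewrite expr0n/= mulr0.
Unshelve. all: by end_near. Qed.

(** With the derivative formula, this three-term relation is the Bessel
    equation. It holds between partial sums, with one more term on the
    right-hand side. *)
Lemma hyp_contiguous c z : 1 <= c ->
  z * hyp (c + 1 + 1) z = c * (c + 1) * (hyp (c + 1) z - hyp c z).
Proof.
move=> c1; have c0 : c != 0 by rewrite gt_eqF//; lra.
have c10 : c + 1 != 0 by rewrite gt_eqF//; lra.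
have L : (fun n => z * pseries (hyp_coef (c + 1 + 1)) z n) @ \oo --> z * hyp (c + 1 + 1) z.
  by apply: cvgMr; apply: cvg_hyp; lra.
have L' : (fun n => c * (c + 1) * (pseries (hyp_coef (c + 1)) z n.+1
     - pseries (hyp_coef c) z n.+1)) @ \oo --> c * (c + 1) * (hyp (c + 1) z - hyp c z).
  apply: cvgMr; apply: cvgB; rewrite (cvg_shiftS (pseries _ _)); apply: cvg_hyp; lra.
suff E : (fun n => z * pseries (hyp_coef (c + 1 + 1)) z n) =
   (fun n => c * (c + 1) * (pseries (hyp_coef (c + 1)) z n.+1
     - pseries (hyp_coef c) z n.+1)).
  by rewrite E in L; rewrite -(cvg_lim _ L)// -(cvg_lim _ L').
apply/funext => n; rewrite /pseries /series/=.
elim: n => [|n ih].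
  rewrite !big_nil !big_nat1 !expr0 /hyp_coef /rising !big_ord0; ring.
rewrite !(big_nat_recr n.+1)//= big_nat_recr//= mulrDr ih.
have -> : z * (hyp_coef (c + 1 + 1) n * z ^+ n) =
   c * (c + 1) * ((hyp_coef (c + 1) n.+1 - hyp_coef c n.+1) * z ^+ n.+1).
  have cn : c + 1 + n%:R != 0 by rewrite gt_eqF//; have := ler0n R n; lra.
  rewrite /hyp_coef risingSl.
  have -> : rising c n.+1 = c * (c + 1) * rising (c + 1 + 1) n / (c + 1 + n%:R).
    by apply: (mulIf cn); rewrite mulfVK// risingSl -[LHS]mulrA -risingSr risingSl mulrA.
  have r0 : rising (c + 1 + 1) n != 0 by rewrite gt_eqF// rising_gt0//; lra.
  rewrite factS natrM !exprS -natr1.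
  have n1 : n%:R + 1 != 0 :> R by rewrite natr1 pnatr_eq0.
  have : n`!%:R != 0 :> R by rewrite pnatr_eq0 -lt0n fact_gt0.
  by move: (n`!%:R) => f f0; field; rewrite c0 r0 f0 n1 c10 cn.
ring.
Qed.

End Hyp.

(** * The Gamma function and the Bessel functions *)

Section GammaTheory.
Variable R : realType.
Implicit Types s t x y nu : R.
Notation mu := (@lebesgue_measure R).

Definition gamma_fun s t : R := t `^ (s - 1) * expR (- t).

(** From u <= exp u with t = 2 s u one gets t <= (2 s + 1) exp (t / (2 s)),
    which is then raised to the power s. Half of the exponential decay of the
    Gamma integrand absorbs the power. *)
Lemma powR_le_expR s t : 0 <= s -> 0 <= t -> t `^ s <= (2 * s + 1) `^ s * expR (t / 2).
Proof.
move=> s0 t0; rewrite le_eqVlt in s0; case/predU1P: s0 => [<-|s0].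
  rewrite !powRr0 mul1r -expR0 ler_expR divr_ge0//.
pose u := t / (2 * s).
have tu : t = 2 * s * u by rewrite /u mulrC divfK// mulf_neq0 ?gt_eqF//.
have u0 : 0 <= u by rewrite divr_ge0// mulr_ge0// ltW.
have u1 : u <= expR u by apply: le_trans (expR_ge1Dx u); rewrite lerDr.
have tle : t <= (2 * s + 1) * expR u.
  rewrite tu; apply: ler_pM => //; first by rewrite mulr_ge0// ltW.
  by rewrite lerDl.
apply: (@le_trans _ _ (((2 * s + 1) * expR u) `^ s)).
  apply: ge0_ler_powR => //; first exact: ltW.
  by rewrite nnegrE (le_trans t0 tle).
rewrite powRM ?expR_ge0//; last by rewrite addr_ge0// mulr_ge0// ltW.
rewrite -expRM ler_wpM2l ?powR_ge0// ler_expR le_eqVlt; apply/orP; left; apply/eqP.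
by rewrite [in RHS]tu; field.
Qed.

Lemma gamma_fun_le s t : 1 <= s -> 0 <= t ->
  0 <= gamma_fun s t <= (2 * (s - 1) + 1) `^ (s - 1) * expR (- (t / 2)).
Proof.
move=> s1 t0; rewrite mulr_ge0 ?powR_ge0 ?expR_ge0//=.
rewrite (_ : - (t / 2) = t / 2 - t); last by lra.
by rewrite expRD mulrA ler_wpM2r ?expR_ge0// powR_le_expR// subr_ge0.
Qed.

Lemma cvg_expRNhalf : expR (- (t / 2)) @[t --> +oo%R] --> (0 : R).
Proof.
apply: (@cvg_comp _ _ _ (fun t : R => t / 2) (fun t => expR (- t)) _ (@pinfty_nbhs R)).
  by apply: gt0_cvgMly => //; rewrite invr_gt0.
exact: cvgr_expR.
Qed.

Lemma continuous_powR_gt0 s t : 0 < t -> {for t, continuous (fun t : R => t `^ s)}.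
Proof.
move=> t0; apply: differentiable_continuous; apply/derivable1_diffP.
by apply: derivable_powR; rewrite in_itv/= t0.
Qed.

Lemma within_continuous_powR s : 0 <= s -> {within `[0, +oo[, continuous (fun t : R => t `^ s)}.
Proof.
rewrite le_eqVlt => /predU1P[<-|s0].
  have -> : (fun t : R => t `^ 0) = cst 1 by apply/funext => t; rewrite powRr0.
  by apply: continuous_subspaceT => x; exact: cvg_cst.
apply/continuous_within_itvcyP; split.
  by move=> t; rewrite in_itv/= andbT => t0; exact: continuous_powR_gt0.
by rewrite powR0 ?gt_eqF//; exact: powR_cvg0.
Qed.

Lemma is_derive_expRN (k t : R) : is_derive t 1 (fun t => expR (- (k * t))) (- k * expR (- (k * t))).
Proof.
have h : is_derive t 1 (fun t : R => - (k * t)) (- k).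
  by apply: is_derive_eq; rewrite /GRing.scale/=; ring.
have := @is_derive1_comp _ expR _ t _ _ (is_derive_expR _) h.
by rewrite mulrC.
Qed.

Lemma integrable_expRNhalf : mu.-integrable `[0, +oo[ (EFin \o (fun t : R => expR (- (t / 2)))).
Proof.
have dF t : is_derive t 1 (fun t : R => - 2 * expR (- (t / 2))) (expR (- (t / 2))).
  have -> : (fun t : R => - 2 * expR (- (t / 2))) = (fun t => - 2 *: expR (- (2^-1 * t))).
    by apply/funext => u; rewrite [2^-1 * u]mulrC.
  have h := is_derive_expRN 2^-1 t.
  apply: is_derive_eq.
  by rewrite /GRing.scale/= [2^-1 * t]mulrC; field.
have mf : measurable_fun (`[0, +oo[%classic : set R) (fun t : R => expR (- (t / 2))).
  by apply: measurableT_comp => //; apply: measurableT_comp => //; apply: measurable_funM.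
apply/integrableP; split; first exact/measurable_EFinP.
under eq_integral do rewrite /= ger0_norm ?expR_ge0//.
rewrite (@ge0_continuous_FTC2y _ _ (fun t => - 2 * expR (- (t / 2))) _ 0).
- by rewrite ltry.
- by move=> x _; exact: expR_ge0.
- apply: continuous_subspaceT => x.
  apply: continuous_comp; last exact: continuous_expR.
  by apply: continuousN; apply: cvgMl; exact: cvg_id.
- by rewrite -[X in _ --> X](mulr0 (- 2)); apply: cvgMr; exact: cvg_expRNhalf.
- by move=> x _; have [] := dF x.
- have /derivable1_diffP/differentiable_continuous c0 : derivable (fun t : R => - 2 * expR (- (t / 2))) 0 1.
    by have [] := dF 0.
  exact: cvg_at_right_filter.
- by move=> x _; rewrite derive1E; have [_ ->] := dF x.
Qed.

Lemma integrable_gamma_fun s : 1 <= s -> mu.-integrable `[0, +oo[ (EFin \o gamma_fun s).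
Proof.
move=> s1; apply: (le_integrable _ _ _ (integrableZl _ ((2 * (s - 1) + 1) `^ (s - 1)) integrable_expRNhalf)) => //.
  apply/measurable_EFinP; apply: measurable_funM.
    by apply: measurable_funTS; exact: measurable_powR.
  by apply: measurableT_comp => //; exact: measurableT_comp.
move=> t /=; rewrite in_itv/= andbT => t0; rewrite lee_fin.
have /andP[g0 g1] := gamma_fun_le s1 t0.
by rewrite ger0_norm// (le_trans g1)// ler_norm.
Qed.

Lemma continuous_expRN : continuous (fun t : R => expR (- t)).
Proof. by move=> t; apply: continuous_comp; [exact: continuousN|exact: continuous_expR]. Qed.

Lemma cvg_gamma_fun s : 1 <= s -> gamma_fun s t @[t --> +oo%R] --> (0 : R).
Proof.
move=> s1; apply: (@squeeze_cvgr _ _ _ _ (cst 0) (fun t => (2 * (s - 1) + 1) `^ (s - 1) * expR (- (t / 2)))).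
- by near=> t; apply: gamma_fun_le => //; near: t; apply: nbhs_pinfty_ge; rewrite num_real.
- exact: cvg_cst.
- by rewrite -[X in _ --> X](mulr0 ((2 * (s - 1) + 1) `^ (s - 1))); apply: cvgMr; exact: cvg_expRNhalf.
Unshelve. all: by end_near. Qed.

(** Integration by parts: - t^s exp (- t) is a primitive of the difference of
    the two integrands and vanishes at 0 and at infinity. *)
Lemma GammaS s : 1 <= s -> Gamma (s + 1) = s * Gamma s.
Proof.
move=> s1; have s0 : 0 < s by lra.
have i1 : mu.-integrable `[0, +oo[ (EFin \o gamma_fun (s + 1)).
  by apply: integrable_gamma_fun; lra.
have i2 := integrable_gamma_fun s1.
have i2s : mu.-integrable `[0, +oo[ (EFin \o (fun t => s * gamma_fun s t)).
  exact: (integrableZl _ s i2).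
have -> : Gamma (s + 1) = \int[mu]_(t in `[0, +oo[) gamma_fun (s + 1) t.
  by rewrite -Rintegral_itv_obnd_cbnd//; apply: integrableS i1 => //; apply: subset_itvr; rewrite bnd_simp.
have -> : Gamma s = \int[mu]_(t in `[0, +oo[) gamma_fun s t.
  by rewrite -Rintegral_itv_obnd_cbnd//; apply: integrableS i2 => //; apply: subset_itvr; rewrite bnd_simp.
rewrite -RintegralZl//; apply/eqP; rewrite -subr_eq0 -RintegralB//; apply/eqP.
pose D t := gamma_fun (s + 1) t - s * gamma_fun s t.
pose F t : R := - (t `^ s * expR (- t)).
have iD : mu.-integrable `[0, +oo[ (EFin \o D).
  exact: (integrableB _ i1 i2s).
have cD : {within `[0, +oo[, continuous D}.
  have c1 := within_continuous_powR (ltW s0).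
  have c2 : {within `[0, +oo[, continuous (fun t : R => t `^ (s - 1))}.
    by apply: within_continuous_powR; lra.
  have c3 : {within `[0, +oo[, continuous (fun t : R => expR (- t))}.
    by apply: continuous_subspaceT => x; exact: continuous_expRN.
  move=> x; apply: cvgB; first by apply: cvgM; [rewrite addrK; exact: c1|exact: c3].
  by apply: cvgMr; apply: cvgM; [exact: c2|exact: c3].
have cF : {within `[0, +oo[, continuous F}.
  have c1 := within_continuous_powR (ltW s0).
  have c3 : {within `[0, +oo[, continuous (fun t : R => expR (- t))}.
    by apply: continuous_subspaceT => x; exact: continuous_expRN.
  by move=> x; apply: cvgN; apply: cvgM; [exact: c1|exact: c3].
have dF t : 0 < t -> is_derive t 1 F (D t).
  move=> t0; have h1 := is_derive1_powR s t0.
  have h2 := is_derive_expRN 1 t.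
  have -> : F = (fun t => - (t `^ s * expR (- (1 * t)))).
    by apply/funext => u; rewrite mul1r.
  apply: is_derive_eq.
  by rewrite /GRing.scale/= /D /gamma_fun addrK mul1r; ring.
(* the difference D changes sign at t = s, so the fundamental theorem on a
   half-line, which is for functions of constant sign, is applied beyond s
   only *)
have := @Rintegral_itvB _ D (BLeft 0) (BInfty R false) s iD.
rewrite !bnd_simp ltW// => /(_ isT isT).
have -> : \int[mu]_(t in `[0, s]) D t = F s.
  rewrite /Rintegral (@continuous_FTC2 _ D F)//=.
  - by rewrite [F 0]/F powR0 ?gt_eqF// mul0r oppr0 subr0.
  - by apply: continuous_subspaceW cD; apply: subset_itvl.
  - have : {within `[0, s], continuous F}.
      by apply: continuous_subspaceW cF; apply: subset_itvl.
    move=> /(continuous_within_itvP _ s0)[_ c1 c2]; split => //.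
    by move=> x; rewrite in_itv/= => /andP[x0 _]; have [] := dF x x0.
  - by move=> x; rewrite in_itv/= => /andP[x0 _]; rewrite derive1E; have [_ ->] := dF x x0.
rewrite Rintegral_itv_obnd_cbnd; last first.
  by apply: integrableS iD => //; apply: subset_itvr; rewrite bnd_simp ltW.
rewrite (@Rintegral_ge0_continuous_FTC2y _ D F s 0).
- by rewrite sub0r => /(canRL (subrK _)); rewrite addNr.
- move=> x sx; have x0 : 0 < x by lra.
  rewrite /D /gamma_fun addrK mulrA -mulrBl mulr_ge0 ?expR_ge0//.
  rewrite -(mulr_powRB1 (ltW x0) s0) -mulrBl mulr_ge0 ?powR_ge0//; lra.
- by apply: continuous_subspaceW cD; apply: subset_itvr; rewrite bnd_simp ltW.
- have -> : F = - gamma_fun (s + 1).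
    by apply/funext => t; rewrite /F /gamma_fun/= addrK.
  by rewrite -[X in _ --> X]oppr0; apply: cvgN; apply: cvg_gamma_fun; lra.
- by move=> x sx; have [] := dF x (lt_trans s0 sx).
- have /derivable1_diffP/differentiable_continuous c0 : derivable F s 1.
    by have [] := dF s s0.
  exact: cvg_at_right_filter.
- by move=> x; rewrite in_itv/= andbT => sx; rewrite derive1E; have [_ ->] := dF x (lt_trans s0 sx).
Qed.

(** On [1, 2] the integrand is at least exp (-2). *)
Lemma Gamma_gt0 s : 1 <= s -> 0 < Gamma s.
Proof.
move=> s1.
have i2 : mu.-integrable `]0, +oo[ (EFin \o gamma_fun s).
  by apply: integrableS (integrable_gamma_fun s1) => //; apply: subset_itvr; rewrite bnd_simp.
apply: (@lt_le_trans _ _ (expR (- 2))); first exact: expR_gt0.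
rewrite -lee_fin /Gamma /Rintegral fineK; last exact: integrable_fin_num.
have f0 (t : R) : 0 <= gamma_fun s t by rewrite mulr_ge0 ?powR_ge0 ?expR_ge0.
have s12 : `[1 : R, 2]%classic `<=` `]0, +oo[.
  by move=> t /=; rewrite !in_itv/= andbT => /andP[? _]; lra.
apply: (@le_trans _ _ (\int[mu]_(t in `[1%R, 2%R]) (gamma_fun s t)%:E)%E); last first.
  apply: ge0_subset_integral => //.
    by have /integrableP[] := i2.
  by move=> t _; rewrite lee_fin.
have -> : (expR (- 2))%:E = (\int[mu]_(t in `[1%R, 2%R]) (expR (- 2))%:E)%E.
  rewrite integral_cst//= lebesgue_measure_itv/= lte_fin ltr1n.
  by rewrite -EFinB -EFinM; congr EFin; ring.
apply: ge0_le_integral => //.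
- by have /integrableP[mf _] := i2; apply: measurable_funS mf.
- move=> t /=; rewrite in_itv/= => /andP[t1 t2]; rewrite lee_fin /gamma_fun.
  rewrite -[leLHS]mul1r ler_pM ?expR_ge0//; last by rewrite ler_expR lerN2.
  have s10 : 0 <= s - 1 by rewrite subr_ge0.
  by have := ler_powR t1 s10; rewrite powRr0.
Qed.

Lemma Gamma_shift s m : 1 <= s -> Gamma (m%:R + s) = Gamma s * rising s m.
Proof.
move=> s1; elim: m => [|m ih]; first by rewrite add0r /rising big_ord0 mulr1.
rewrite risingSr mulrA -ih -natr1 addrAC GammaS 1?mulrC 1?[s + _]addrC//.
by rewrite -[1]add0r lerD.
Qed.

Lemma besselJE nu y : 0 <= nu -> 0 < y ->
  besselJ nu y = (y / 2) `^ nu / Gamma (nu + 1) * hyp (nu + 1) (y ^+ 2 / 4).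
Proof.
move=> nu0 y0; have s1 : 1 <= nu + 1 by lra.
have y20 : 0 < y / 2 by rewrite divr_gt0.
have G0 : Gamma (nu + 1) != 0 by rewrite gt_eqF// Gamma_gt0.
apply/cvg_lim => //.
rewrite [X in X @ _ --> _](_ : _ = pseries (fun m => (y / 2) `^ nu / Gamma (nu + 1) * hyp_coef (nu + 1) m) (y ^+ 2 / 4)).
  by apply: cvg_pseriesZ; exact: cvg_hyp.
apply/funext => n; rewrite /pseries /series/=; apply: eq_bigr => m _.
rewrite powRD; last by apply/implyP => _; rewrite gt_eqF.
rewrite -natrM powR_mulrn ?ltW// exprM -addrA Gamma_shift//.
have -> : (y / 2) ^+ 2 = y ^+ 2 / 4 by field.
rewrite /hyp_coef.
have r0 : rising (nu + 1) m != 0 by rewrite gt_eqF// rising_gt0.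
have : m`!%:R != 0 :> R by rewrite pnatr_eq0 -lt0n fact_gt0.
by move: (_`!%:R) (_ ^+ m) ((_ / _) ^+ m) => f a b f0; field; rewrite f0 r0 G0.
Qed.

End GammaTheory.

(** * Sturm comparison and uniqueness for linear equations *)

Section Calculus.
Variable R : realType.
Implicit Types (a b x y l : R) (f df : R -> R).

Lemma is_derive_continuous f x l : is_derive x 1 f l -> {for x, continuous f}.
Proof. by move=> [df _]; apply: differentiable_continuous; apply/derivable1_diffP. Qed.

Lemma is_derive_within f df a b : (forall x, a <= x <= b -> is_derive x 1 f (df x)) ->
  {within `[a, b], continuous f}.
Proof.
move=> fdf; apply: continuous_in_subspaceT => x; rewrite inE/= in_itv/= => xab.
exact: is_derive_continuous (fdf x xab).
Qed.

Lemma mvt f df a b : a < b -> (forall x, a <= x <= b -> is_derive x 1 f (df x)) ->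
  exists2 c, a < c < b & f b - f a = df c * (b - a).
Proof.
move=> ab fdf; have [c] := MVT ab (fun x (xab : x \in `]a, b[) => fdf x (subset_itv_oo_cc xab)) (is_derive_within fdf).
by rewrite in_itv/=; exists c.
Qed.

Lemma rolle f df a b : a < b -> (forall x, a <= x <= b -> is_derive x 1 f (df x)) ->
  f a = f b -> exists2 c, a < c < b & df c = 0.
Proof.
move=> ab fdf fab; have [c cab] := mvt ab fdf; rewrite fab subrr => /esym/eqP.
by rewrite mulf_eq0 subr_eq0 [b == a]gt_eqF// orbF => /eqP dc; exists c.
Qed.

Lemma constant_sign f a b : {within `[a, b], continuous f} ->
  (forall x, a < x < b -> f x != 0) ->
  (forall x, a < x < b -> 0 < f x) \/ (forall x, a < x < b -> f x < 0).
Proof.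
move=> cf f0; have [[x xab fx]|/forall2NP nf] := pselect (exists2 x, a < x < b & f x < 0); last first.
  left=> x xab; rewrite lt_neqAle eq_sym f0//= leNgt; apply/negP => fx.
  by have [] := nf x.
right=> y yab; rewrite ltNge; apply/negP => fy.
have [xa xb] := andP xab; have [ya yb] := andP yab.
have sub u v : a < u -> v < b -> {within `[u, v], continuous f}.
  by move=> au vb; apply: continuous_subspaceW cf; apply: subset_itv; rewrite bnd_simp ltW.
have key c : a < c < b -> f c = 0 -> False by move=> /f0/eqP.
have [xy|yx] := leP x y.
  have [||c] := @IVT _ f x y 0 xy; first exact: sub.
    by rewrite ge_min le_max (ltW fx) fy orbT.
  rewrite in_itv/= => /andP[xc cy]; apply: key.
  by rewrite (lt_le_trans xa)// (le_lt_trans cy).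
have [||c] := @IVT _ f y x 0 (ltW yx); first exact: sub.
  by rewrite ge_min le_max (ltW fx) fy orbT.
rewrite in_itv/= => /andP[xc cy]; apply: key.
by rewrite (lt_le_trans ya)// (le_lt_trans cy).
Qed.

Lemma continuous_pos_near f b : {for b, continuous f} -> 0 < f b ->
  exists2 d, 0 < d & forall x, `|x - b| < d -> 0 < f x.
Proof.
move=> cf fb; have : \forall x \near b, 0 < f x by exact: (cvgr_gt _ cf).
by move=> [d /= d0 h]; exists d => // x xb; apply: h; rewrite /= distrC.
Qed.

Lemma right_end_ge0 f a b : a < b -> {for b, continuous f} ->
  (forall x, a < x < b -> 0 < f x) -> 0 <= f b.
Proof.
move=> ab cf fp; rewrite leNgt; apply/negP => fb.
have [|d d0 h] := @continuous_pos_near (- f) b (continuousN cf); first by rewrite oppr_gt0.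
pose x := Num.max ((a + b) / 2) (b - d / 2).
have xb : x < b by rewrite /x gt_max; apply/andP; split; lra.
have ax : a < x by rewrite /x lt_max; apply/orP; left; lra.
have dx : b - d / 2 <= x by rewrite /x le_max lexx orbT.
have : 0 < - f x by apply: h; rewrite ltr_norml; lra.
by rewrite oppr_gt0 ltNge ltW// fp// ax.
Qed.

Lemma left_end_ge0 f a b : a < b -> {for a, continuous f} ->
  (forall x, a < x < b -> 0 < f x) -> 0 <= f a.
Proof.
move=> ab cf fp; rewrite leNgt; apply/negP => fb.
have [|d d0 h] := @continuous_pos_near (- f) a (continuousN cf); first by rewrite oppr_gt0.
pose x := Num.min ((a + b) / 2) (a + d / 2).
have xb : x < b by rewrite /x gt_min; apply/orP; left; lra.
have ax : a < x by rewrite /x lt_min; apply/andP; split; lra.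
have dx : x <= a + d / 2 by rewrite /x ge_min lexx orbT.
have : 0 < - f x by apply: h; rewrite ltr_norml; lra.
by rewrite oppr_gt0 ltNge ltW// fp// ax.
Qed.

Lemma right_end_derive_le0 f df a b : a < b ->
  (forall x, a <= x <= b -> is_derive x 1 f (df x)) -> {for b, continuous df} ->
  (forall x, a < x < b -> 0 < f x) -> f b = 0 -> df b <= 0.
Proof.
move=> ab fdf cdf fp fb; rewrite leNgt; apply/negP => dfb.
have [d d0 h] := continuous_pos_near cdf dfb.
pose x := Num.max ((a + b) / 2) (b - d / 2).
have xb : x < b by rewrite /x gt_max; apply/andP; split; lra.
have ax : a < x by rewrite /x lt_max; apply/orP; left; lra.
have dx : b - d / 2 <= x by rewrite /x le_max lexx orbT.
have [|c /andP[xc cb]] := mvt xb (f := f) (df := df).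
  by move=> y /andP[xy yb]; apply: fdf; rewrite yb andbT; lra.
have fx : 0 < f x by apply: fp; rewrite ax.
have dc : 0 < df c by apply: h; rewrite ltr_norml; lra.
have : 0 < df c * (b - x) by rewrite mulr_gt0// subr_gt0.
by rewrite fb; lra.
Qed.

Lemma left_end_derive_ge0 f df a b : a < b ->
  (forall x, a <= x <= b -> is_derive x 1 f (df x)) -> {for a, continuous df} ->
  (forall x, a < x < b -> 0 < f x) -> f a = 0 -> 0 <= df a.
Proof.
move=> ab fdf cdf fp fb; rewrite leNgt; apply/negP => dfb.
have [|d d0 h] := @continuous_pos_near (- df) a (continuousN cdf); first by rewrite oppr_gt0.
pose x := Num.min ((a + b) / 2) (a + d / 2).
have xb : x < b by rewrite /x gt_min; apply/orP; left; lra.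
have ax : a < x by rewrite /x lt_min; apply/andP; split; lra.
have dx : x <= a + d / 2 by rewrite /x ge_min lexx orbT.
have [|c /andP[xc cb]] := mvt ax (f := f) (df := df).
  by move=> y /andP[xy yb]; apply: fdf; rewrite xy; lra.
have fx : 0 < f x by apply: fp; rewrite ax.
have : 0 < - df c by apply: h; rewrite ltr_norml; lra.
rewrite oppr_gt0 => dc.
have : df c * (x - a) < 0 by rewrite nmulr_rlt0// subr_gt0.
by rewrite fb; lra.
Qed.

Section Sturm.
Variables (q1 q2 : R -> R) (a b : R).
Hypotheses (ab : a < b) (q12 : forall x, a < x < b -> q1 x < q2 x).

Let sturm_pos u u' v v' :
  (forall x, a <= x <= b -> is_derive x 1 u (u' x)) ->
  (forall x, a <= x <= b -> is_derive x 1 u' (- q1 x * u x)) ->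
  (forall x, a <= x <= b -> is_derive x 1 v (v' x)) ->
  (forall x, a <= x <= b -> is_derive x 1 v' (- q2 x * v x)) ->
  u a = 0 -> u b = 0 -> (forall x, a < x < b -> 0 < u x) ->
  (forall x, a < x < b -> 0 < v x) -> False.
Proof.
move=> du du' dv dv' ua ub up vp.
have aa : a <= a <= b by rewrite lexx ltW.
have bb : a <= b <= b by rewrite lexx ltW.
pose W x := u' x * v x - u x * v' x.
have dW x : a <= x <= b -> is_derive x 1 W ((q2 x - q1 x) * u x * v x).
  move=> xab; have h1 := du x xab; have h2 := du' x xab; have h3 := dv x xab.
  have h4 := dv' x xab; apply: is_derive_eq; rewrite /GRing.scale/=; ring.
have [c cab] := mvt ab dW.
have cW : 0 < (q2 c - q1 c) * u c * v c.
  by rewrite !mulr_gt0 ?up ?vp// subr_gt0 q12.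
have : 0 < (q2 c - q1 c) * u c * v c * (b - a) by rewrite mulr_gt0// subr_gt0.
have u'b := right_end_derive_le0 ab du (is_derive_continuous (du' b bb)) up ub.
have u'a := left_end_derive_ge0 ab du (is_derive_continuous (du' a aa)) up ua.
have va := left_end_ge0 ab (is_derive_continuous (dv a aa)) vp.
have vb := right_end_ge0 ab (is_derive_continuous (dv b bb)) vp.
move=> Wp E; have : W b - W a <= 0.
  rewrite /W ua ub !mul0r !subr0 subr_le0.
  by apply: (@le_trans _ _ 0); [exact: mulr_le0_ge0|exact: mulr_ge0].
by rewrite E leNgt Wp.
Qed.

(** If the potential of v is larger, v oscillates faster: were v of constant
    sign between two consecutive zeros of u, the Wronskian u' v - u v' would
    be strictly increasing, whereas the signs of u' and v at the endpoints
    make it nonnegative at the left one and nonpositive at the right one. *)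
Lemma sturm_comparison u u' v v' :
  (forall x, a <= x <= b -> is_derive x 1 u (u' x)) ->
  (forall x, a <= x <= b -> is_derive x 1 u' (- q1 x * u x)) ->
  (forall x, a <= x <= b -> is_derive x 1 v (v' x)) ->
  (forall x, a <= x <= b -> is_derive x 1 v' (- q2 x * v x)) ->
  u a = 0 -> u b = 0 -> (forall x, a < x < b -> u x != 0) ->
  exists2 x, a < x < b & v x = 0.
Proof.
have opp (q f f' : R -> R) : (forall x, a <= x <= b -> is_derive x 1 f (f' x)) ->
    (forall x, a <= x <= b -> is_derive x 1 f' (- q x * f x)) ->
    (forall x, a <= x <= b -> is_derive x 1 (fun x => - f x) (- f' x)) /\
    (forall x, a <= x <= b -> is_derive x 1 (fun x => - f' x) (- q x * - f x)).
  move=> df df'; split=> x xab.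
    by have h := df x xab; apply: is_derive_eq.
  by have h := df' x xab; apply: is_derive_eq; rewrite mulrN.
move=> du du' dv dv' ua ub u0; apply: contrapT => /forall2NP nv.
have v0 x : a < x < b -> v x != 0.
  by move=> xab; apply/eqP => vx; have [] := nv x.
have [ndu ndu'] := opp _ _ _ du du'; have [ndv ndv'] := opp _ _ _ dv dv'.
have [su|su] := constant_sign (is_derive_within du) u0;
have [sv|sv] := constant_sign (is_derive_within dv) v0.
- exact: (sturm_pos du du' dv dv').
- by apply: (sturm_pos du du' ndv ndv') => // x /sv; rewrite oppr_gt0.
- apply: (sturm_pos ndu ndu' dv dv') => //; rewrite ?ua ?ub ?oppr0// => x /su.
  by rewrite oppr_gt0.
- apply: (sturm_pos ndu ndu' ndv ndv') => //; rewrite ?ua ?ub ?oppr0// => x.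
    by move=> /su; rewrite oppr_gt0.
  by move=> /sv; rewrite oppr_gt0.
Qed.
End Sturm.

(** Gronwall's argument for E = u^2 + v^2: since |E'| <= 2 K E, the function E
    exp (- 2 K x) is nonincreasing and E exp (2 K x) nondecreasing, and both
    vanish at x0. *)
Lemma linear_system_unique (A B u v : R -> R) (K a b x0 : R) : a <= x0 <= b -> 0 <= K ->
  (forall x, a <= x <= b -> is_derive x 1 u (A x * v x)) ->
  (forall x, a <= x <= b -> is_derive x 1 v (B x * u x)) ->
  (forall x, a <= x <= b -> `|A x| <= K) -> (forall x, a <= x <= b -> `|B x| <= K) ->
  u x0 = 0 -> v x0 = 0 -> forall x, a <= x <= b -> u x = 0 /\ v x = 0.
Proof.
move=> x0ab K0 du dv bA bB ux0 vx0.
pose E x := u x ^+ 2 + v x ^+ 2.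
have E0 x : E x <= 0 -> u x = 0 /\ v x = 0.
  move=> Ex; have : E x == 0 by rewrite eq_le Ex addr_ge0// sqr_ge0.
  by rewrite paddr_eq0 ?sqr_ge0// !sqrf_eq0 => /andP[/eqP ? /eqP ?].
have bound x : a <= x <= b -> `|2 * (A x + B x) * (u x * v x)| <= 2 * K * E x.
  move=> xab; rewrite normrM normrM ger0_norm//.
  have uv : `|u x * v x| * 2 <= E x.
    rewrite normrM /E -[u x ^+ 2]real_normK ?num_real// -[v x ^+ 2]real_normK ?num_real//.
    by have := sqr_ge0 (`|u x| - `|v x|); nra.
  have AB : `|A x + B x| <= 2 * K.
    by apply: le_trans (ler_normD _ _) _; have := bA x xab; have := bB x xab; lra.
  have := normr_ge0 (u x * v x); have := normr_ge0 (A x + B x).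
  nra.
pose G k x := E x * expR (- (k * x)).
have dG k x : a <= x <= b ->
    is_derive x 1 (G k) ((2 * (A x + B x) * (u x * v x) - k * E x) * expR (- (k * x))).
  move=> xab; have h1 := du x xab; have h2 := dv x xab; have h3 := is_derive_expRN k x.
  apply: is_derive_eq; rewrite /GRing.scale/= /E; ring.
have Gx0 k : G k x0 = 0 by rewrite /G /E ux0 vx0 !expr0n/= addr0 mul0r.
move=> x xab; apply: E0; have [xx0|x0x|->] := ltgtP x x0; last first.
- by rewrite /E ux0 vx0 expr0n addr0.
- have [|c cab] := mvt x0x (f := G (2 * K)) (df := fun x => (2 * (A x + B x) * (u x * v x) - (2 * K) * E x) * expR (- ((2 * K) * x))).
    by move=> y /andP[xy yx]; apply: dG; lra.
  rewrite Gx0 subr0 => Gx.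
  have cc : a <= c <= b by lra.
  have : G (2 * K) x <= 0.
    rewrite Gx; apply: mulr_le0_ge0; last by rewrite subr_ge0 ltW.
    apply: mulr_le0_ge0; rewrite ?expR_ge0// subr_le0.
    by apply: le_trans (bound c cc); exact: ler_norm.
  by rewrite /G pmulr_lle0// expR_gt0.
- have [|c cab] := mvt xx0 (f := G (- (2 * K))) (df := fun x => (2 * (A x + B x) * (u x * v x) - (- (2 * K)) * E x) * expR (- ((- (2 * K)) * x))).
    by move=> y /andP[xy yx]; apply: dG; lra.
  rewrite Gx0 sub0r => Gx.
  have cc : a <= c <= b by lra.
  have : G (- (2 * K)) x <= 0.
    rewrite -oppr_ge0 Gx; apply: mulr_ge0; last by rewrite subr_ge0 ltW.
    apply: mulr_ge0; rewrite ?expR_ge0//.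
    have := bound c cc; rewrite ler_norml => /andP[+ _]; lra.
  by rewrite /G pmulr_lle0// expR_gt0.
Qed.
End Calculus.

(** * Zeros of Bessel functions *)

Section BesselODE.
Variable R : realType.
Implicit Types (c x y : R).

(** The function Gamma c * (y/2)^(1 - c) * J_(c - 1)(y), entire in y, with
    value 1 at 0 and with the same positive zeros as J_(c - 1). *)
Definition bes c y : R := hyp c (y ^+ 2 / 4).

Lemma is_derive_bes c y : 1 <= c -> is_derive y 1 (bes c) (- (y / (2 * c)) * bes (c + 1) y).
Proof.
move=> c1.
have h1 : is_derive y 1 (fun y : R => y ^+ 2 / 4) (y / 2).
  by apply: is_derive_eq; rewrite /GRing.scale/=; field.
have h2 := is_derive_hyp (y ^+ 2 / 4) c1.
have := @is_derive1_comp _ (hyp c) (fun y : R => y ^+ 2 / 4) y _ _ h2 h1.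
have c0 : c != 0 by rewrite gt_eqF//; lra.
suff -> : - (y / (2 * c)) * bes (c + 1) y = - c^-1 * hyp (c + 1) (y ^+ 2 / 4) * (y / 2) by [].
by rewrite /bes; field.
Qed.

Lemma bes0 c : bes c 0 = 1.
Proof. by rewrite /bes expr0n mul0r hyp0. Qed.

Lemma bes_contiguous c y : 1 <= c ->
  y ^+ 2 * bes (c + 1 + 1) y = 4 * c * (c + 1) * (bes (c + 1) y - bes c y).
Proof.
move=> c1; have := hyp_contiguous (y ^+ 2 / 4) c1; rewrite /bes => h.
by move: (hyp _ _) (hyp _ _) (hyp _ _) h => u v w h; lra.
Qed.

Lemma continuous_bes c : 1 <= c -> continuous (bes c).
Proof. by move=> c1 y; apply: is_derive_continuous (is_derive_bes y c1). Qed.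

(** Liouville normal form: a multiple of sqrt y * J_(c - 1)(y), which
    satisfies w'' + potential * w = 0 without first-order term. *)
Definition normal c y : R := y `^ (c - 2^-1) * bes c y.
Definition dnormal c y : R := 
  (c - 2^-1) * y `^ (c - 2^-1 - 1) * bes c y - y `^ (c - 2^-1 + 1) / (2 * c) * bes (c + 1) y.
Definition potential c y : R := 1 - (c - 2^-1) * (c - 2^-1 - 1) / y ^+ 2.

Lemma powR_succ y s : 0 < y -> y `^ (s + 1) = y * y `^ s.
Proof.
move=> y0; rewrite powRD; last by apply/implyP => _; rewrite gt_eqF.
by rewrite powRr1 ?ltW// mulrC.
Qed.

Lemma powR_pred y s : 0 < y -> y `^ s = y * y `^ (s - 1).
Proof. by move=> y0; rewrite -powR_succ// subrK. Qed.

Lemma is_derive_normal c y : 1 <= c -> 0 < y -> is_derive y 1 (normal c) (dnormal c y).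
Proof.
move=> c1 y0; have h1 := is_derive1_powR (c - 2^-1) y0; have h2 := is_derive_bes y c1.
apply: is_derive_eq; rewrite /GRing.scale/= /dnormal powR_succ//.
have c0 : c != 0 by rewrite gt_eqF//; lra.
by field.
Qed.

Lemma is_derive_dnormal c y : 1 <= c -> 0 < y ->
  is_derive y 1 (dnormal c) (- potential c y * normal c y).
Proof.
move=> c1 y0; set s := c - 2^-1.
have c11 : 1 <= c + 1 by lra.
have h1 := is_derive1_powR (s - 1) y0; have h2 := is_derive1_powR (s + 1) y0.
have h3 := is_derive_bes y c1; have h4 := is_derive_bes y c11.
rewrite /dnormal -/s; apply: is_derive_eq; rewrite /GRing.scale/= /potential /normal -/s addrK.
have bE : bes (c + 1 + 1) y = 4 * c * (c + 1) * (bes (c + 1) y - bes c y) / y ^+ 2.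
  by rewrite -bes_contiguous// mulrC mulKf// sqrf_eq0 gt_eqF.
rewrite bE powR_succ// (powR_pred s y0) (powR_pred (s - 1) y0).
have c0 : c != 0 by rewrite gt_eqF//; lra.
have c10 : c + 1 != 0 by rewrite gt_eqF//; lra.
have yn0 : y != 0 by rewrite gt_eqF.
have -> : s = c - 2^-1 by [].
move: (y `^ _) (bes _ _) (bes _ _) => p u v.
by field; rewrite yn0 c0 c10.
Qed.

Lemma normal_eq0 c y : 0 < y -> (normal c y == 0) = (bes c y == 0).
Proof. by move=> y0; rewrite mulf_eq0 gt_eqF ?powR_gt0. Qed.

Lemma besselJ_eq0 nu y : 0 <= nu -> 0 < y -> (besselJ nu y == 0) = (bes (nu + 1) y == 0).
Proof.
move=> nu0 y0; rewrite besselJE//.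
rewrite mulf_eq0 gt_eqF// divr_gt0 ?powR_gt0 ?divr_gt0//.
by apply: Gamma_gt0; lra.
Qed.

(** A double zero would propagate down to 0 by uniqueness, whereas bes c 0 =
    1. *)
Lemma normal_simple_zero c y : 1 <= c -> 0 < y -> normal c y = 0 -> dnormal c y = 0 -> False.
Proof.
move=> c1 y0 ny dny.
have [d d0 bd] : exists2 d, 0 < d & forall x, `|x - 0| < d -> 0 < bes c x.
  by apply: continuous_pos_near; rewrite ?bes0//; exact: continuous_bes.
pose e := Num.min (d / 2) (y / 2).
have e0 : 0 < e by rewrite lt_min !divr_gt0.
have ey : e <= y by rewrite ge_min; apply/orP; right; lra.
have ed : e < d by rewrite gt_min; apply/orP; left; lra.
pose s := c - 2^-1.
have [|||||||] := @linear_system_unique _ (cst 1) (fun x => - potential c x) (normal c) (dnormal c) (1 + `|s * (s - 1)| / e ^+ 2) e y y _ _ _ _ _ _ ny dny e.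
- by rewrite ey lexx.
- by rewrite addr_ge0// divr_ge0// sqr_ge0.
- by move=> x /andP[ex _]; rewrite mul1r; apply: is_derive_normal => //; exact: lt_le_trans ex.
- by move=> x /andP[ex _]; apply: is_derive_dnormal => //; exact: lt_le_trans ex.
- by move=> x _; rewrite /cst normr1 lerDl divr_ge0// sqr_ge0.
- move=> x /andP[ex _]; rewrite normrN; apply: le_trans (ler_normB _ _) _.
  rewrite normr1 lerD2l normrM normfV -/s [`|x ^+ 2|]ger0_norm ?sqr_ge0//.
  have x0 : 0 < x by exact: lt_le_trans ex.
  rewrite ler_wpM2l// lef_pV2 ?posrE ?exprn_gt0//.
  by rewrite ler_pXn2r// nnegrE ltW.
- by rewrite lexx ey.
- move=> /eqP + _; rewrite normal_eq0//; apply/negP; rewrite gt_eqF// bd// subr0.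
  by rewrite gtr0_norm.
Qed.

Lemma potential_gt c k : 0 <= k -> k < 1 -> 
  exists2 Y, 0 < Y & forall y, Y <= y -> k ^+ 2 < potential c y.
Proof.
move=> k0 k1; pose p := `|(c - 2^-1) * (c - 2^-1 - 1)|.
have k2 : 0 < 1 - k ^+ 2 by nra.
have p0 : 0 <= p / (1 - k ^+ 2) by apply: divr_ge0; [exact: normr_ge0|exact: ltW].
exists (1 + p / (1 - k ^+ 2)); first by lra.
move=> y Yy; have y1 : 1 <= y by lra.
have py : p / y ^+ 2 < 1 - k ^+ 2.
  rewrite ltr_pdivrMr ?exprn_gt0//; last by lra.
  rewrite mulrC -ltr_pdivrMr//; nra.
rewrite /potential ltrBrDr addrC -ltrBrDr; apply: le_lt_trans py.
by rewrite ler_wpM2r ?invr_ge0 ?sqr_ge0// ler_norm.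
Qed.

Lemma sine_derivatives (k a x : R) :
  is_derive x 1 (fun y => sin (k * (y - a))) (k * cos (k * (x - a))) /\
  is_derive x 1 (fun y => k * cos (k * (y - a))) (- (k ^+ 2) * sin (k * (x - a))).
Proof.
have h1 : is_derive x 1 (fun y => k * (y - a)) k.
  by apply: is_derive_eq; rewrite /GRing.scale/=; ring.
have h2 := @is_derive1_comp _ sin (fun y : R => k * (y - a)) x _ _ (is_derive_sin _) h1.
have h3 := @is_derive1_comp _ cos (fun y : R => k * (y - a)) x _ _ (is_derive_cos _) h1.
rewrite /comp in h2 h3; split; apply: is_derive_eq; rewrite /GRing.scale/=; ring.
Qed.

(** Comparison with sin (k (y - Y)), whose consecutive zeros are pi/k apart.
    *)
Lemma bes_zero_within c k Y : 1 <= c -> 0 < k -> 0 < Y ->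
  (forall y, Y <= y -> k ^+ 2 < potential c y) ->
  exists2 x, Y < x < Y + pi / k & bes c x = 0.
Proof.
move=> c1 k0 Y0 pot.
have pk : 0 < pi / k :> R by rewrite divr_gt0// pi_gt0.
have [|||||||||x xY] := @sturm_comparison _ (fun=> k ^+ 2) (potential c) Y (Y + pi / k) _ _
  (fun y => sin (k * (y - Y))) (fun y => k * cos (k * (y - Y))) (normal c) (dnormal c).
- by rewrite ltrDl.
- by move=> x /andP[Yx _]; apply: pot; exact: ltW.
- by move=> x _; have [] := sine_derivatives k Y x.
- by move=> x _; have [] := sine_derivatives k Y x.
- by move=> x /andP[Yx _]; apply: is_derive_normal => //; exact: lt_le_trans Yx.
- by move=> x /andP[Yx _]; apply: is_derive_dnormal => //; exact: lt_le_trans Yx.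
- by rewrite subrr mulr0 sin0.
- by rewrite addrAC subrr add0r mulrC divfK ?gt_eqF// sinpi.
- move=> x /andP[Yx xY]; rewrite gt_eqF// sin_gt0_pi//.
  rewrite mulr_gt0 ?subr_gt0//=.
  by rewrite mulrC -ltr_pdivlMr// ltrBlDl.
- move=> /eqP; rewrite normal_eq0; last by case/andP: xY => Yx _; exact: lt_trans Yx.
  by move=> /eqP; exists x.
Qed.

(** Zeros are isolated on the right: at a positive zero the derivative of the
    normal form does not vanish, and at 0 the function is 1. This makes the
    infimum defining the next zero larger than the present one. *)
Lemma bes_isolated c j : 1 <= c -> 0 <= j -> j = 0 \/ bes c j = 0 ->
  exists2 d, 0 < d & forall y, j < y < j + d -> bes c y != 0.
Proof.
move=> c1; rewrite le_eqVlt => /predU1P[<- _|j0].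
  have [d d0 bd] : exists2 d, 0 < d & forall x, `|x - 0| < d -> 0 < bes c x.
    by apply: continuous_pos_near; rewrite ?bes0//; exact: continuous_bes.
  exists d => // y; rewrite add0r => /andP[y0 yd]; rewrite gt_eqF// bd//.
  by rewrite subr0 gtr0_norm.
case=> [j00|bj]; first by rewrite j00 ltxx in j0.
have nj : normal c j = 0 by apply/eqP; rewrite normal_eq0// bj.
have dn : dnormal c j != 0 by apply/eqP => dnj; exact: (normal_simple_zero c1 j0 nj dnj).
have [d d0 bd] : exists2 d, 0 < d & forall x, `|x - j| < d -> 0 < dnormal c x ^+ 2.
  apply: continuous_pos_near; last by rewrite lt_neqAle sqr_ge0 eq_sym sqrf_eq0 dn.
  have cd := is_derive_continuous (is_derive_dnormal c1 j0).
  exact: (@cvgM _ _ (nbhs j) _ _ _ _ _ cd cd).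
exists d => // y /andP[jy yd]; rewrite -normal_eq0 ?(lt_trans j0)//.
apply/eqP => ny; have [||z /andP[jz zy] dz] := @rolle _ (normal c) (dnormal c) j y jy.
- by move=> x /andP[jx _]; apply: is_derive_normal => //; exact: lt_le_trans jx.
- by rewrite nj ny.
- have := bd z; rewrite dz expr0n/= ltxx => /(_ _)/negP; apply => //.
  by rewrite ltr_norml; lra.
Qed.

Section Zeros.
Variable mu : R.
Hypothesis mu0 : 0 <= mu.
Notation c := (mu + 1).
Notation j := (bessel_zero mu).

Let c1 : 1 <= c. Proof. by rewrite lerDr. Qed.

Lemma exists_bes_zero Y : exists2 x, Y < x & bes c x = 0.
Proof.
have h0 : 0 <= 2^-1 :> R by lra.
have h1 : 2^-1 < 1 :> R by lra.
have [Z Z0 pot] := potential_gt c h0 h1.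
have [||y|x /andP[xY _] bx] := @bes_zero_within c 2^-1 (Num.max Z Y) c1.
- by lra.
- by rewrite lt_max Z0.
- by rewrite ge_max => /andP[/pot].
- by exists x => //; apply: le_lt_trans xY; rewrite le_max lexx orbT.
Qed.

(** The infimum is attained because zeros form a closed set, exceeds j n
    because zeros are isolated, and has no smaller competitor by definition.
    *)
Lemma bessel_zero_step n : 0 <= j n -> j n = 0 \/ bes c (j n) = 0 ->
  [/\ j n < j n.+1, bes c (j n.+1) = 0 & forall y, j n < y < j n.+1 -> bes c y != 0].
Proof.
move=> jn0 jn; pose S := [set y | j n < y /\ besselJ mu y = 0].
have SE y : S y <-> j n < y /\ bes c y = 0.
  have E : j n < y -> (besselJ mu y == 0) = (bes c y == 0).
    by move=> jy; apply: besselJ_eq0 => //; exact: le_lt_trans jy.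
  split=> -[jy /eqP h]; split=> //; apply/eqP.
    by rewrite -(E jy).
  by rewrite (E jy).
have -> : j n.+1 = inf S by [].
have S0 : S !=set0 by have [x jx bx] := exists_bes_zero (j n); exists x; exact/SE.
have lS : has_lbound S by exists (j n) => y [/ltW].
have [d d0 bd] := bes_isolated c1 jn0 jn.
have jd : j n + d <= inf S.
  apply: lb_le_inf => // y /SE[jy by0]; rewrite leNgt; apply/negP => yd.
  by have := bd y; rewrite jy yd by0 eqxx => /(_ isT).
have ji : j n < inf S by apply: lt_le_trans jd; rewrite ltrDl.
split=> //.
- apply/eqP; apply: contrapT => /negP bi.
  (* were the infimum not a zero, no zero would be near it *)
  have [e e0 be] : exists2 e, 0 < e & forall x, `|x - inf S| < e -> 0 < bes c x ^+ 2.
    apply: continuous_pos_near; last by rewrite lt_neqAle sqr_ge0 eq_sym sqrf_eq0 bi.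
    have cb := @continuous_bes c c1 (inf S).
    exact: (@cvgM _ _ (nbhs (inf S)) _ _ _ _ _ cb cb).
  have [|z Sz zi] := @inf_adherent _ S e e0; first by split.
  have iz : inf S <= z by exact: ge_inf.
  have /SE[_ bz] := Sz.
  have := be z; rewrite bz expr0n/= ltxx => /(_ _)/negP; apply => //.
  by rewrite ltr_norml; lra.
- move=> y /andP[jy yi]; apply/eqP => by0; have /(ge_inf lS) : S y by apply/SE.
  by rewrite leNgt yi.
Qed.

Lemma bessel_zero_inv n : 0 <= j n /\ (j n = 0 \/ bes c (j n) = 0).
Proof.
elim: n => [|n [jn0 jn]]; first by split => //; left.
have [jj bj _] := bessel_zero_step jn0 jn.
by split; [exact: ltW (le_lt_trans jn0 jj)|right].
Qed.

Lemma bessel_zero_lt n : j n < j n.+1.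
Proof. by have [h1 h2] := bessel_zero_inv n; have [] := bessel_zero_step h1 h2. Qed.

Lemma bes_bessel_zero n : bes c (j n.+1) = 0.
Proof. by have [h1 h2] := bessel_zero_inv n; have [] := bessel_zero_step h1 h2. Qed.

Lemma bessel_zero_consecutive n y : j n < y < j n.+1 -> bes c y != 0.
Proof.
by have [h1 h2] := bessel_zero_inv n; have [_ _] := bessel_zero_step h1 h2; exact.
Qed.

Lemma bessel_zero_gt0 n : 0 < j n.+1.
Proof. by have [h1 h2] := bessel_zero_inv n; exact: le_lt_trans h1 (bessel_zero_lt n). Qed.

Let normal0 n : normal c (j n.+1) = 0.
Proof. by apply/eqP; rewrite normal_eq0 ?bessel_zero_gt0// bes_bessel_zero. Qed.

Let normal_neq0 n y : j n.+1 < y < j n.+2 -> normal c y != 0.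
Proof.
move=> yj; rewrite normal_eq0; first exact: bessel_zero_consecutive yj.
by case/andP: yj => jy _; exact: lt_trans (bessel_zero_gt0 n) jy.
Qed.

Lemma bessel_zero_next n y : j n < y -> bes c y = 0 -> j n.+1 <= y.
Proof.
by move=> jy by0; rewrite leNgt; apply/negP => yj; have := @bessel_zero_consecutive n y; rewrite jy yj by0 eqxx => /(_ isT).
Qed.

Hypothesis mu1 : 1 <= mu.

Let potential_lt1 y : 0 < y -> potential c y < 1.
Proof.
move=> y0; rewrite /potential gtrBl; apply: divr_gt0; last exact: exprn_gt0.
by apply: mulr_gt0; move: mu1 => m1; lra.
Qed.

Let potential_incr x y : 0 < x -> x < y -> potential c x < potential c y.
Proof.
move=> x0 xy; rewrite /potential ltrD2l ltrN2 ltr_pM2l.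
  have y0 := lt_trans x0 xy.
  rewrite ltf_pV2 ?posrE; [|exact: exprn_gt0|exact: exprn_gt0].
  by nra.
by apply: mulr_gt0; move: mu1 => m1; lra.
Qed.

(** For mu >= 1 the potential is smaller than 1, so sin (y - j) has a zero
    strictly between two consecutive zeros. *)
Lemma bessel_gap_gt_pi n : pi < j n.+2 - j n.+1.
Proof.
have jn0 := bessel_zero_gt0 n; have jj := bessel_zero_lt n.+1.
have [|||||||||x xY] := @sturm_comparison _ (potential c) (fun=> 1 ^+ 2) (j n.+1) (j n.+2) _ _
  (normal c) (dnormal c) (fun y => sin (1 * (y - j n.+1))) (fun y => 1 * cos (1 * (y - j n.+1))).
- exact: jj.
- by move=> x /andP[jx _]; rewrite expr1n; apply: potential_lt1; exact: lt_trans jx.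
- by move=> x /andP[jx _]; apply: is_derive_normal; [exact: c1|exact: lt_le_trans jx].
- by move=> x /andP[jx _]; apply: is_derive_dnormal; [exact: c1|exact: lt_le_trans jx].
- by move=> x _; have [] := sine_derivatives 1 (j n.+1) x.
- by move=> x _; have [] := sine_derivatives 1 (j n.+1) x.
- exact: normal0.
- exact: normal0.
- exact: normal_neq0.
rewrite mul1r => sx; case/andP: xY => x1 x2.
apply: (@le_lt_trans _ _ (x - j n.+1)); last by rewrite ltrD2r.
rewrite leNgt; apply/negP => xpi; have : 0 < sin (x - j n.+1).
  by rewrite sin_gt0_pi// subr_gt0 x1.
by rewrite sx ltxx.
Qed.

(** The potential increases, so the translate of the solution by one gap has a
    larger potential, hence a zero before the end of the gap. *)
Lemma bessel_gap_decr n : j n.+3 - j n.+2 < j n.+2 - j n.+1.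
Proof.
have jn0 := bessel_zero_gt0 n; have jj := bessel_zero_lt n.+1.
have jj0 := lt_trans jn0 jj; set h := j n.+2 - j n.+1.
have h0 : 0 < h by rewrite subr_gt0.
have shift (f df : R -> R) : (forall x, 0 < x -> is_derive x 1 f (df x)) -> 
    forall x, j n.+1 <= x <= j n.+2 -> is_derive x 1 (fun y => f (y + h)) (df (x + h)).
  move=> fdf x /andP[jx _]; have xh : 0 < x + h by lra.
  have h1 : is_derive x 1 (fun y => y + h) 1 by apply: is_derive_eq; rewrite addr0.
  have := @is_derive1_comp _ f (fun y => y + h) x _ _ (fdf _ xh) h1.
  by rewrite mulr1.
have [|||||||||x xY] := @sturm_comparison _ (potential c) (fun y => potential c (y + h)) (j n.+1) (j n.+2) _ _
  (normal c) (dnormal c) (fun y => normal c (y + h)) (fun y => dnormal c (y + h)).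
- exact: jj.
- by move=> x /andP[jx _]; apply: potential_incr; lra.
- by move=> x /andP[jx _]; apply: is_derive_normal; [exact: c1|exact: lt_le_trans jx].
- by move=> x /andP[jx _]; apply: is_derive_dnormal; [exact: c1|exact: lt_le_trans jx].
- by apply: (shift (normal c) (dnormal c)) => x; exact: is_derive_normal.
- by apply: (shift (dnormal c) (fun y => - potential c y * normal c y)) => x; exact: is_derive_dnormal.
- exact: normal0.
- exact: normal0.
- exact: normal_neq0.
move=> /eqP; case/andP: xY => x1 x2; rewrite normal_eq0; last by lra.
move=> /eqP /(@bessel_zero_next n.+2) jx.
have : j n.+3 <= x + h by apply: jx; rewrite /h; lra.
by rewrite /h; lra.
Qed.

Lemma bessel_zero_ge n : n%:R * pi <= j n.+1.
Proof.
elim: n => [|n ih]; first by rewrite mul0r ltW// bessel_zero_gt0.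
by have := bessel_gap_gt_pi n; rewrite -natr1 mulrDl mul1r; lra.
Qed.

Lemma bessel_zero_pinfty : j n @[n --> \oo] --> +oo.
Proof.
rewrite -cvg_shiftS; apply/cvgryPge => A.
have pi0 : 0 < pi :> R := pi_gt0 R.
near=> n; apply: le_trans (bessel_zero_ge n).
rewrite -ler_pdivrMr//; near: n; exact: nbhs_infty_ger.
Unshelve. all: by end_near. Qed.

(** Far out the potential exceeds k^2 for any given k < 1, and the next zero
    comes within pi/k; with k = pi/(pi + e) the gap lies between pi and pi +
    e. *)
Lemma bessel_gap_cvg : j n.+1 - j n @[n --> \oo] --> (pi : R).
Proof.
apply/cvgrPdist_le => e e0; have pi0 : 0 < pi :> R := pi_gt0 R.
pose k : R := pi / (pi + e).
have pe : 0 < pi + e :> R by lra.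
have k0 : 0 < k by rewrite divr_gt0.
have k1 : k < 1 by rewrite /k ltr_pdivrMr//; lra.
have pk : pi / k = pi + e by rewrite /k invf_div mulrC divfK// gt_eqF.
have [Y Y0 pot] := potential_gt c (ltW k0) k1.
near=> n.
have Yj : Y <= j n by near: n; move/cvgryPge : bessel_zero_pinfty; exact.
have [||x /andP[jx xk] bx] := @bes_zero_within c k (j n) c1 k0.
- exact: lt_le_trans Yj.
- by move=> y /(le_trans Yj); exact: pot.
have nx := bessel_zero_next jx bx.
have n0 : (0 < n)%N by near: n; exact: nbhs_infty_gt.
have gap : pi < j n.+1 - j n.
  by rewrite -(prednK n0); exact: bessel_gap_gt_pi.
rewrite distrC ger0_norm; last by rewrite subr_ge0 ltW.
by rewrite pk in xk; lra.
Unshelve. all: by end_near. Qed.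
End Zeros.
End BesselODE.

(** * Square integrable and continuous functions on the unit interval *)

Section L2basics.
Variable R : realType.
Implicit Types (f g : R -> R).
Notation mu := (@lebesgue_measure R).
Notation I01 := (`]0, 1[%classic : set R).

Lemma restr01_sqr f x : (`|(restr01 f x)%:E| `^ 2 = ((fun x => (f x ^+ 2)%:E) \_ I01) x)%E.
Proof.
rewrite /restr01 !patchE; case: ifPn => _; last by rewrite abse0 poweR0r.
rewrite /= -[in RHS]real_normK ?num_real//.
by change ((`|f x|%:E `^ 2)%E = (`|f x| ^+ 2)%:E); rewrite poweR_EFin powR_mulrn.
Qed.

Lemma L2normE f : L2norm f = ((\int[mu]_(x in I01) (f x ^+ 2)%:E) `^ 2^-1)%E.
Proof.
rewrite /L2norm unlock; congr (_ `^ _)%E.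
by rewrite [RHS]integral_mkcond; apply: eq_integral => x _; exact: restr01_sqr.
Qed.

Lemma L2P f : L2 f <->
  measurable_fun I01 f /\ mu.-integrable I01 (EFin \o (fun x => f x ^+ 2)).
Proof.
have mI : measurable I01 by [].
split.
  rewrite /L2 inE/= => /andP[+ ]; rewrite !inE/= => mf.
  have mf' : measurable_fun I01 f by apply/(measurable_restrictT _ mI).
  rewrite /finite_norm -/(L2norm f) L2normE => fin; split => //.
  apply/integrableP; split.
    apply/measurable_EFinP; exact: measurable_funX.
  have := @lty_poweRy _ _ 2^-1 _ fin; rewrite invr_eq0 pnatr_eq0 => /(_ isT).
  by under eq_integral do rewrite /= -[X in X%:E]ger0_norm ?sqr_ge0//.
move=> [mf /integrableP[_ fin]]; rewrite /L2 inE/=; apply/andP; split.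
  by rewrite inE/=; apply/(measurable_restrictT _ mI).
rewrite inE/= /finite_norm -/(L2norm f) L2normE poweR_lty//.
by under eq_integral do rewrite -[X in X%:E]ger0_norm ?sqr_ge0//.
Qed.
End L2basics.

Section C01.
Variable R : realType.
Implicit Types (f g u v q F : R -> R).
Notation mu := (@lebesgue_measure R).
Notation J01 := (`[0, 1]%classic : set R).

Definition C01 f := {within J01, continuous f}.
Definition int01 f : R := \int[mu]_(x in J01) f x.

Lemma C01_cst (a : R) : C01 (cst a).
Proof. by apply: continuous_subspaceT => x; exact: cvg_cst. Qed.

Lemma C01D f g : C01 f -> C01 g -> C01 (fun x => f x + g x).
Proof. by move=> cf cg x; apply: cvgD; [exact: cf|exact: cg]. Qed.

Lemma C01B f g : C01 f -> C01 g -> C01 (fun x => f x - g x).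
Proof. by move=> cf cg x; apply: cvgB; [exact: cf|exact: cg]. Qed.

Lemma C01M f g : C01 f -> C01 g -> C01 (fun x => f x * g x).
Proof. by move=> cf cg x; apply: cvgM; [exact: cf|exact: cg]. Qed.

Lemma C01Z (a : R) f : C01 f -> C01 (fun x => a * f x).
Proof. by move=> cf; apply: C01M => //; exact: C01_cst. Qed.

Lemma C01_sum n (F : 'I_n -> R -> R) : (forall i, C01 (F i)) ->
  C01 (fun x => \sum_(i < n) F i x).
Proof.
elim: n F => [|n ih] F cF.
  have -> : (fun x => \sum_(i < 0) F i x) = cst 0 by apply/funext => x; rewrite big_ord0.
  exact: C01_cst.
have -> : (fun x => \sum_(i < n.+1) F i x) =
  (fun x => \sum_(i < n) F (widen_ord (leqnSn n) i) x + F ord_max x).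
  by apply/funext => x; rewrite big_ord_recr.
by apply: C01D => //; exact: ih.
Qed.

Lemma continuous_C01 f : continuous f -> C01 f.
Proof. exact: continuous_subspaceT. Qed.

Lemma C01_comp f F : continuous F -> C01 f -> C01 (fun x => F (f x)).
Proof. by move=> cF cf x; apply: (continuous_comp (cf x)); exact: cF. Qed.

Lemma C01_integrable f : C01 f -> mu.-integrable J01 (EFin \o f).
Proof. by move=> cf; apply: continuous_compact_integrable => //; exact: segment_compact. Qed.

Lemma C01_integrable_oo f : C01 f -> mu.-integrable `]0, 1[ (EFin \o f).
Proof.
move=> /C01_integrable; apply: integrableS => //.
exact: subset_itv_oo_cc.
Qed.

Lemma int01_oo f : C01 f -> \int[mu]_(x in `]0, 1[) f x = int01 f.
Proof.
move=> cf; rewrite /int01 -Rintegral_itv_obnd_cbnd ?Rintegral_itv_bndo_bndc//.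
  exact: C01_integrable_oo.
apply: integrableS (C01_integrable cf) => //.
by apply: subset_itvr; rewrite bnd_simp.
Qed.

Lemma int01D f g : C01 f -> C01 g -> int01 (fun x => f x + g x) = int01 f + int01 g.
Proof. by move=> cf cg; rewrite /int01 RintegralD//; exact: C01_integrable. Qed.

Lemma int01B f g : C01 f -> C01 g -> int01 (fun x => f x - g x) = int01 f - int01 g.
Proof. by move=> cf cg; rewrite /int01 RintegralB//; exact: C01_integrable. Qed.

Lemma int01Z (a : R) f : C01 f -> int01 (fun x => a * f x) = a * int01 f.
Proof. by move=> cf; rewrite /int01 RintegralZl//; exact: C01_integrable. Qed.

Lemma int01_cst (a : R) : int01 (cst a) = a.
Proof.
rewrite /int01 Rintegral_cst//= lebesgue_measure_itv/= lte_fin ltr01 -EFinB/=.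
by rewrite subr0 mulr1.
Qed.

Lemma int01_sum n (F : 'I_n -> R -> R) : (forall i, C01 (F i)) ->
  int01 (fun x => \sum_(i < n) F i x) = \sum_(i < n) int01 (F i).
Proof.
elim: n F => [|n ih] F cF.
  have -> : (fun x => \sum_(i < 0) F i x) = cst 0 by apply/funext => x; rewrite big_ord0.
  by rewrite big_ord0 int01_cst.
have -> : (fun x => \sum_(i < n.+1) F i x) =
  (fun x => \sum_(i < n) F (widen_ord (leqnSn n) i) x + F ord_max x).
  by apply/funext => x; rewrite big_ord_recr.
by rewrite int01D// ?ih ?big_ord_recr//; exact: C01_sum.
Qed.

Lemma eq_int01 f g : (forall x, 0 <= x <= 1 -> f x = g x) -> int01 f = int01 g.
Proof. by move=> fg; apply: eq_Rintegral => x; rewrite inE/= in_itv/=; exact: fg. Qed.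

Lemma int01_ge0 f : (forall x, 0 <= x <= 1 -> 0 <= f x) -> 0 <= int01 f.
Proof. by move=> f0; apply: Rintegral_ge0 => x/=; rewrite in_itv/=; exact: f0. Qed.

(** Continuity at 0 keeps f above f 0 / 2 on a small interval. *)
Lemma int01_gt0 f : C01 f -> (forall x, 0 <= x <= 1 -> 0 <= f x) ->
  0 < f 0 -> 0 < int01 f.
Proof.
move=> cf f0 f00.
have /(continuous_within_itvP _ ltr01)[_ c1 _] := cf.
have : \forall x \near 0^'+, f 0 / 2 < f x.
  by apply: (cvgr_gt _ c1); rewrite ltr_pdivrMr// ltr_pMr// ltr1n.
move=> [d /= d0 fd].
pose e := Num.min d 1.
have e0 : 0 < e by rewrite lt_min d0 ltr01.
have e1 : e <= 1 by rewrite ge_min lexx orbT.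
have sub : `]0, e[%classic `<=` J01.
  by move=> x /=; rewrite !in_itv/= => /andP[x0 xe]; lra.
apply: (@lt_le_trans _ _ (f 0 / 2 * e)); first by rewrite mulr_gt0// divr_gt0.
rewrite -lee_fin /int01 /Rintegral fineK; last first.
  by apply: integrable_fin_num => //; exact: C01_integrable.
have mf : measurable_fun J01 (EFin \o f) by have /integrableP[] := C01_integrable cf.
apply: (@le_trans _ _ (\int[mu]_(x in `]0%R, e[) (f x)%:E)%E); last first.
  apply: ge0_subset_integral => // x /=; rewrite in_itv/= lee_fin; exact: f0.
have -> : (f 0 / 2 * e)%:E = (\int[mu]_(x in `]0%R, e[) (f 0 / 2)%:E)%E.
  by rewrite integral_cst//= lebesgue_measure_itv/= lte_fin e0 -EFinB -EFinM subr0.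
apply: ge0_le_integral => //.
- by move=> x _; rewrite lee_fin divr_ge0// ltW.
- exact: measurable_funS mf.
- move=> x /=; rewrite in_itv/= => /andP[x0 xe]; rewrite lee_fin ltW//.
  apply: fd => //=; rewrite sub0r normrN gtr0_norm//.
  by apply: lt_le_trans xe _; rewrite ge_min lexx.
Qed.

Lemma int01_FTC F f : C01 F -> C01 f ->
  (forall x : R, 0 < x < 1 -> is_derive x 1 F (f x)) -> int01 f = F 1 - F 0.
Proof.
move=> cF cf dF; rewrite /int01 /Rintegral (@continuous_FTC2 _ f F)//.
  have /(continuous_within_itvP _ ltr01)[_ c1 c2] := cF; split => //.
  by move=> x; rewrite in_itv/= => x01; have [] := dF x x01.
by move=> x; rewrite in_itv/= => x01; rewrite derive1E; have [_ ->] := dF x x01.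
Qed.
End C01.

(** * The solution that is regular at the origin *)

Section RegularSolution.
Variables (R : realType) (alpha : R).
Hypotheses (alpha_ge1 : 1 <= alpha) (alpha_lt2 : alpha < 2).
Implicit Types (lambda x : R) (u v q : R -> R).
Notation k := (kappa alpha).
Notation c := (nu alpha + 1).

Lemma kappa_gt0 : 0 < k. Proof. by rewrite /kappa; move: alpha_lt2; lra. Qed.
Lemma nu_ge0 : 0 <= nu alpha.
Proof. by rewrite /nu divr_ge0// subr_ge0// ltW. Qed.
Let c1 : 1 <= c. Proof. by rewrite lerDr nu_ge0. Qed.
Let c11 : 1 <= c + 1. Proof. by move: c1; lra. Qed.
Let c0 : c != 0. Proof. by rewrite gt_eqF//; move: c1; lra. Qed.
Let k0 := kappa_gt0.
Let kn0 : k != 0. Proof. by rewrite gt_eqF. Qed.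
Lemma kappa_nu : 2 * k * c = 1.
Proof.
have : 2 - alpha != 0 by rewrite gt_eqF// subr_gt0.
by rewrite /kappa /nu => h; field.
Qed.

Lemma inv_2kappa : (2 * k)^-1 = c.
Proof.
have k20 : 2 * k != 0 by rewrite mulf_neq0.
by apply: (mulfI k20); rewrite mulfV// kappa_nu.
Qed.

Definition sol_arg lambda x : R := lambda / (4 * k ^+ 2) * x `^ (2 * k).
(** For lambda > 0 this is, up to a constant, x^((1 - alpha)/2) J_nu(sqrt
    lambda / kappa * x^kappa). The functions solq and solflux below are
    x^(alpha/2) and x^alpha times its derivative; all three are continuous up
    to 0. *)
Definition sol lambda x : R := hyp c (sol_arg lambda x).
Definition solq lambda x : R := - lambda * x `^ k * hyp (c + 1) (sol_arg lambda x).
Definition solflux lambda x : R := - lambda * x * hyp (c + 1) (sol_arg lambda x).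

Lemma is_derive_sol_arg lambda x : 0 < x ->
  is_derive x 1 (sol_arg lambda) (lambda / (2 * k) * x `^ (1 - alpha)).
Proof.
move=> x0; have h := is_derive1_powR (2 * k) x0.
apply: is_derive_eq; rewrite /GRing.scale/=.
have -> : 2 * k - 1 = 1 - alpha by rewrite /kappa; field.
by field.
Qed.

Lemma is_derive_sol_flux lambda x : 0 < x ->
  is_derive x 1 (sol lambda) (x `^ (- alpha) * solflux lambda x).
Proof.
move=> x0; have h1 := is_derive_sol_arg lambda x0.
have h2 := is_derive_hyp (sol_arg lambda x) c1.
have := @is_derive1_comp _ (hyp c) (sol_arg lambda) x _ _ h2 h1.
suff -> : x `^ (- alpha) * solflux lambda x = 
  - c^-1 * hyp (c + 1) (sol_arg lambda x) * (lambda / (2 * k) * x `^ (1 - alpha)) by [].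
rewrite [1 - alpha]addrC powR_succ// /solflux.
by rewrite inv_2kappa; field.
Qed.

Lemma powR_kappa x : 0 < x -> x `^ (- alpha) * x = x `^ (- (alpha / 2)) * x `^ k.
Proof.
move=> x0; rewrite mulrC -powR_succ// -powRD; last first.
  by apply/implyP => _; rewrite gt_eqF.
by congr (_ `^ _); rewrite /kappa; field.
Qed.

Lemma solqE lambda x : 0 < x -> x `^ (- alpha) * solflux lambda x = x `^ (- (alpha / 2)) * solq lambda x.
Proof.
move=> x0; have := powR_kappa x0; rewrite /solflux /solq.
move: (x `^ _) (x `^ _) (x `^ _) (hyp _ _) => p r s h E.
rewrite (_ : s * _ = s * x * (- lambda * h)); last by ring.
by rewrite E; ring.
Qed.

Lemma solfluxE lambda x : 0 < x -> x `^ (- (alpha / 2)) * solflux lambda x = solq lambda x.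
Proof.
move=> x0; rewrite /solflux /solq [_ * x]mulrC [RHS]mulrAC [_ * hyp _ _ in RHS]mulrC.
have -> : x `^ k = x `^ (- (alpha / 2)) * x.
  by rewrite mulrC -powR_succ//; congr (_ `^ _); rewrite /kappa; field.
by ring.
Qed.

Lemma is_derive_sol lambda x : 0 < x ->
  is_derive x 1 (sol lambda) (x `^ (- (alpha / 2)) * solq lambda x).
Proof. by move=> x0; rewrite -solqE//; exact: is_derive_sol_flux. Qed.

(** The contiguous relation of hyp, in the variable x: this is the equation
    (x^alpha u')' = - lambda u for u = sol lambda. *)
Lemma is_derive_solflux lambda x : 0 < x ->
  is_derive x 1 (solflux lambda) (- lambda * sol lambda x).
Proof.
move=> x0; have h1 := is_derive_sol_arg lambda x0.
have h2 := is_derive_hyp (sol_arg lambda x) c11.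
have h3 := @is_derive1_comp _ (hyp (c + 1)) (sol_arg lambda) x _ _ h2 h1.
rewrite /comp in h3; rewrite /solflux; apply: is_derive_eq; rewrite /GRing.scale/=.
have E := hyp_contiguous (sol_arg lambda x) c1.
have A : sol_arg lambda x = lambda / (4 * k ^+ 2) * (x * x `^ (1 - alpha)).
  by rewrite /sol_arg -powR_succ//; congr (_ * _ `^ _); rewrite /kappa; field.
have {}E : lambda / (2 * k) * x `^ (1 - alpha) * x * hyp (c + 1 + 1) (sol_arg lambda x) =
    (c + 1) * (hyp (c + 1) (sol_arg lambda x) - hyp c (sol_arg lambda x)).
  have -> : lambda / (2 * k) * x `^ (1 - alpha) * x = 2 * k * sol_arg lambda x.
    by rewrite A; field.
  by rewrite -(mulrA (2 * k)) E (mulrA (2 * k)) (mulrA (2 * k)) kappa_nu mul1r.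
rewrite /sol.
have c10 : c + 1 != 0 by rewrite gt_eqF//; move: c1; lra.
set h2' := hyp (c + 1 + 1) _ in E *; set h1' := hyp (c + 1) _ in E *; set h0 := hyp c _ in E *.
transitivity (- lambda * (h1' - (c + 1)^-1 * (lambda / (2 * k) * x `^ (1 - alpha) * x * h2'))).
  by ring.
by rewrite E mulKf//; ring.
Qed.

Lemma continuous_powR_C01 (s : R) : 0 <= s -> C01 (fun x => x `^ s).
Proof.
move=> s0; have := within_continuous_powR s0; apply: continuous_subspaceW.
by apply: subset_itvl.
Qed.

Lemma C01_sol_arg lambda : C01 (sol_arg lambda).
Proof. by apply: C01Z; apply: continuous_powR_C01; rewrite mulr_ge0// ltW. Qed.

Lemma C01_sol lambda : C01 (sol lambda).
Proof. exact (@C01_comp R (sol_arg lambda) (hyp c) (continuous_hyp c1) (@C01_sol_arg lambda)). Qed.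

Lemma C01_solq lambda : C01 (solq lambda).
Proof.
apply: C01M; first by apply: C01Z; apply: continuous_powR_C01; rewrite ltW.
exact (@C01_comp R (sol_arg lambda) (hyp (c + 1)) (continuous_hyp c11) (@C01_sol_arg lambda)).
Qed.

Lemma C01_solflux lambda : C01 (solflux lambda).
Proof.
apply: C01M; first by apply: C01Z; apply: continuous_C01 => x; exact: cvg_id.
exact (@C01_comp R (sol_arg lambda) (hyp (c + 1)) (continuous_hyp c11) (@C01_sol_arg lambda)).
Qed.

Lemma sol0 lambda : sol lambda 0 = 1.
Proof.
have E : sol_arg lambda 0 = 0.
  by rewrite /sol_arg powR0; [rewrite mulr0|rewrite mulf_neq0].
by rewrite /sol E hyp0.
Qed.

Lemma solflux0 lambda : solflux lambda 0 = 0.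
Proof. by rewrite /solflux mulr0 mul0r. Qed.

Lemma sol_lambda0 x : sol 0 x = 1.
Proof. by rewrite /sol /sol_arg !mul0r hyp0. Qed.

(** The pairs (u, x^(alpha/2) u') for u in a core of the domain of the
    quadratic form int x^alpha u'^2; carrying the second component as a
    continuous function on [0, 1] avoids the singularity at 0. *)
Definition in_form u q := [/\ C01 u, C01 q &
  forall x : R, 0 < x < 1 -> is_derive x 1 u (x `^ (- (alpha / 2)) * q x)].

Lemma in_form_sol lambda : in_form (sol lambda) (solq lambda).
Proof.
split; [exact: C01_sol|exact: C01_solq|] => x /andP[x0 _]; exact: is_derive_sol.
Qed.

Lemma in_formD u q v r : in_form u q -> in_form v r ->
  in_form (fun x => u x + v x) (fun x => q x + r x).
Proof.
move=> [cu cq du] [cv cr dv]; split; [exact: C01D|exact: C01D|] => x x01.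
have h1 := du x x01; have h2 := dv x x01; apply: is_derive_eq; ring.
Qed.

Lemma in_formZ (a : R) u q : in_form u q -> in_form (fun x => a * u x) (fun x => a * q x).
Proof.
move=> [cu cq du]; split; [exact: C01Z|exact: C01Z|] => x x01.
have h1 := du x x01; apply: is_derive_eq; rewrite /GRing.scale/=; ring.
Qed.

(** The boundary term at 0 vanishes because the flux of the regular solution
    does. *)
Lemma green u q lambda : in_form u q ->
  int01 (fun x => q x * solq lambda x) =
  lambda * int01 (fun x => u x * sol lambda x) + u 1 * solflux lambda 1.
Proof.
move=> [cu cq du].
have cs := @C01_sol lambda; have cf := @C01_solflux lambda; have csq := @C01_solq lambda.
have cus : C01 (fun x => u x * sol lambda x) by exact: C01M.
have dF x : 0 < x < 1 -> is_derive (x : R) 1 (fun x => u x * solflux lambda x)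
    (q x * solq lambda x - lambda * (u x * sol lambda x)).
  move=> x01; have h1 := du x x01; have /andP[x0 _] := x01.
  have h2 := is_derive_solflux lambda x0.
  apply: is_derive_eq; rewrite /GRing.scale/= -(solfluxE lambda x0); ring.
have := int01_FTC (C01M cu cf) (C01B (C01M cq csq) (C01Z (a := lambda) cus)) dF.
rewrite solflux0 mulr0 subr0 int01B ?int01Z//; last 2 first.
- exact: C01M.
- exact: C01Z.
by move=> /eqP; rewrite subr_eq addrC => /eqP.
Qed.
End RegularSolution.

(** * Eigenfunctions and a Poincare inequality *)

Section C01more.
Variable R : realType.
Implicit Types (f g u v y F : R -> R).
Notation mu := (@lebesgue_measure R).
Notation J01 := (`[0, 1]%classic : set R).

Lemma C01_bounded f : C01 f -> exists2 M, 0 < M & forall x, 0 <= x <= 1 -> `|f x| <= M.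
Proof.
move=> cf; have cn : C01 (fun x => `|f x|).
  exact: (@C01_comp R f (@Num.norm _ R) (@norm_continuous _ R) cf).
have [m _ hm] := EVT_max ler01 cn.
exists (1 + `|f m|) => [|x x01]; first by rewrite ltr_wpDr.
by apply: le_trans (hm x _) _; rewrite ?lerDr// in_itv.
Qed.

Lemma int01_dct (f_ : nat -> R -> R) f (M : R) : (forall n, C01 (f_ n)) -> C01 f ->
  (forall n x, 0 <= x <= 1 -> `|f_ n x| <= M) ->
  (forall x, 0 <= x <= 1 -> f_ n x @[n --> \oo] --> f x) ->
  int01 (f_ n) @[n --> \oo] --> int01 f.
Proof.
move=> cf_ cf bd cv.
have mJ : measurable J01 by [].
have mf_ n : measurable_fun J01 (EFin \o f_ n) by have /integrableP[] := C01_integrable (cf_ n).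
have mf : measurable_fun J01 (EFin \o f) by have /integrableP[] := C01_integrable cf.
have iM : mu.-integrable J01 (EFin \o cst M) by apply: C01_integrable; exact: C01_cst.
have [||_ _ h] := @dominated_convergence _ _ R mu J01 mJ (fun n => EFin \o f_ n) (EFin \o f) (EFin \o cst M) mf_ mf _ iM _.
- apply: aeW => x /=; rewrite in_itv/= => x01; apply: cvg_EFin; first by near=> n.
  exact: cv.
- by apply: aeW => x n /=; rewrite in_itv/= => x01; rewrite lee_fin bd.
have If n : (\int[mu]_(x in J01) (f_ n x)%:E)%E = (int01 (f_ n))%:E.
  by rewrite /int01 /Rintegral fineK//; apply: integrable_fin_num => //; exact: C01_integrable.
have If' : (\int[mu]_(x in J01) (f x)%:E)%E = (int01 f)%:E.
  by rewrite /int01 /Rintegral fineK//; apply: integrable_fin_num => //; exact: C01_integrable.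
move: h; rewrite /= If' => /fine_cvgP[_].
by under eq_fun do rewrite /= If /=.
Unshelve. all: by end_near. Qed.

(** Where v does not vanish this is a bound on a continuous function. At a
    zero of v, which is simple and also a zero of u, both functions are z - x
    times a continuous function that for v does not vanish. Compactness of [0,
    1] makes the bound uniform. *)
Lemma vanishing_ratio u v u' v' : C01 u -> C01 v ->
  (forall x : R, 0 < x < 1 -> is_derive x 1 u (u' x)) ->
  (forall x : R, 0 < x < 1 -> is_derive x 1 v (v' x)) ->
  v 0 != 0 -> v 1 != 0 ->
  (forall x, 0 < x < 1 -> v x = 0 -> v' x != 0 /\ u x = 0) ->
  exists2 C, 0 < C & forall x, 0 <= x <= 1 -> `|u x| <= C * `|v x|.
Proof.
move=> cu cv du dv v0 v1 vz.
have [M M0 uM] := C01_bounded cu.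
suff : \forall C \near +oo, J01 `<=` (fun x => `|u x| <= C * `|v x|).
  move=> [N [Nr hN]]; exists (Num.max N 0 + 1); first by rewrite ltr_wpDl// le_max lexx orbT.
  move=> x x01; apply: hN; last by rewrite /= in_itv.
  by rewrite ltr_pwDr// le_max lexx.
have : compact J01 by exact: segment_compact.
move=> /compact_near_coveringP /near_covering_withinP; apply.
move=> x; rewrite /= in_itv/= => x01.
have [vx|vx] := eqVneq (v x) 0; last first.
  have m0 : 0 < `|v x| / 2 by rewrite divr_gt0// normr_gt0.
  have /subspace_continuousP/(_ x) cvx := cv.
  have /cvg_norm cvn : v z @[z --> within J01 (nbhs x)] --> v x by apply: cvx; rewrite /= in_itv.
  have : \forall z \near within J01 (nbhs x), `|v x| / 2 < `|v z|.
    by apply: (cvgr_gt _ cvn); rewrite ltr_pdivrMr// ltr_pMr ?ltr1n// normr_gt0.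
  move=> nz; near=> z C => /= z01.
  have zm : `|v x| / 2 < `|v z| by move: (z01); near: z.
  have CM : M / (`|v x| / 2) <= C by near: C; apply: nbhs_pinfty_ge; exact: num_real.
  have C0 : 0 <= C by apply: le_trans CM; rewrite divr_ge0// ltW.
  apply: le_trans (uM z _) _; first by move: z01; rewrite in_itv.
  rewrite ler_pdivrMr// in CM; apply: le_trans CM _.
  by rewrite ler_wpM2l// ltW.
have x01' : 0 < x < 1.
  case/andP: x01 => x0 x1; rewrite !lt_neqAle x0 x1 !andbT; apply/andP; split.
    by apply: contraNneq v0 => E; rewrite [X in v X]E vx.
  by apply: contraNneq v1 => <-; rewrite vx.
have [v'x ux] := vz x x01' vx.
have /is_derive1_caratheodory[g [gE gc gx]] := du x x01'.
have /is_derive1_caratheodory[h [hE hc hx]] := dv x x01'.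
have m0 : 0 < `|h x| / 2 by rewrite divr_gt0// normr_gt0 hx.
have nh : \forall z \near x, `|h x| / 2 < `|h z|.
  by apply: (cvgr_gt _ (cvg_norm hc)); rewrite ltr_pdivrMr// ltr_pMr ?ltr1n// normr_gt0 hx.
have ng : \forall z \near x, `|g z| < `|g x| + 1.
  by apply: (cvgr_lt _ (cvg_norm gc)); rewrite ltrDl.
near=> z C => /= z01.
have hz : `|h x| / 2 < `|h z| by near: z.
have gz : `|g z| < `|g x| + 1 by near: z.
have CM : (`|g x| + 1) / (`|h x| / 2) <= C by near: C; apply: nbhs_pinfty_ge; exact: num_real.
have C0 : 0 <= C by apply: le_trans CM; rewrite divr_ge0// ?addr_ge0// ltW.
have -> : u z = g z * (z - x) by rewrite -gE ux subr0.
have -> : v z = h z * (z - x) by rewrite -hE vx subr0.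
rewrite !normrM mulrA ler_wpM2r//.
rewrite ler_pdivrMr// in CM; apply: le_trans (ltW gz) _; apply: le_trans CM _.
by rewrite ler_wpM2l// ltW.
Unshelve. all: by end_near. Qed.
End C01more.

Section Eigen.
Variables (R : realType) (alpha : R).
Hypotheses (alpha_ge1 : 1 <= alpha) (alpha_lt2 : alpha < 2).
Implicit Types (lambda x : R) (u v q : R -> R).
Notation k := (kappa alpha).
Notation c := (nu alpha + 1).
Notation j := (bessel_zero c).
Notation ev := (eigval alpha).
Notation mu := (@lebesgue_measure R).

Let c1 : 1 <= c. Proof. by rewrite lerDr nu_ge0. Qed.
Let c0 : 0 <= c. Proof. by move: c1; lra. Qed.
Let c11 : 1 <= c + 1. Proof. by move: c1; lra. Qed.
Let k0 := kappa_gt0 alpha_lt2.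
Let kn0 : k != 0. Proof. by rewrite gt_eqF. Qed.

Lemma eigvalE n : ev n = k ^+ 2 * j n ^+ 2.
Proof. by case: n => [|n] //=; rewrite expr0n mulr0. Qed.

Lemma bessel_zero_ge0 n : 0 <= j n.
Proof. by have [] := bessel_zero_inv c0 n. Qed.

Lemma bessel_zero_mono m n : (m < n)%N -> j m < j n.
Proof.
elim: n => // n ih; rewrite ltnS leq_eqVlt => /predU1P[->|/ih h].
  exact: bessel_zero_lt.
exact: lt_trans h (bessel_zero_lt c0 n).
Qed.

Lemma eigval_ge0 n : 0 <= ev n.
Proof. by rewrite eigvalE mulr_ge0// sqr_ge0. Qed.

Lemma eigval_lt m n : (m < n)%N -> ev m < ev n.
Proof.
move=> mn; rewrite !eigvalE ltr_pM2l ?exprn_gt0//.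
by rewrite ltrXn2r// ?nnegrE ?bessel_zero_ge0// bessel_zero_mono.
Qed.

Lemma sqrt_eigval n : Num.sqrt (ev n) = k * j n.
Proof. by rewrite eigvalE -exprMn sqrtr_sqr ger0_norm// mulr_ge0 ?bessel_zero_ge0// ltW. Qed.

Definition phi n : R -> R := sol alpha (ev n).
Definition phiq n : R -> R := solq alpha (ev n).

Lemma sol_argE n x : 0 <= x -> sol_arg alpha (ev n) x = (j n * x `^ k) ^+ 2 / 4.
Proof.
move=> x0; rewrite /sol_arg eigvalE mulrC [2 * k]mulrC powRrM powR_mulrn ?powR_ge0//.
by move: (x `^ k) (j n) kn0 => p b; move: (kappa alpha) => t t0; field.
Qed.

Lemma phiE n x : 0 <= x -> phi n x = bes c (j n * x `^ k).
Proof. by move=> x0; rewrite /phi /sol sol_argE. Qed.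

Lemma solflux_end n : solflux alpha (ev n) 1 = 0.
Proof.
rewrite /solflux sol_argE// powR1 mulr1; case: n => [|n].
  by rewrite /= oppr0 !mul0r.
by have := bes_bessel_zero c0 n; rewrite /bes => ->; rewrite mulr0.
Qed.

Lemma C01_phi n : C01 (phi n). Proof. exact: C01_sol. Qed.
Lemma C01_phiq n : C01 (phiq n). Proof. exact: C01_solq. Qed.

Lemma green_phi u q n : in_form alpha u q ->
  int01 (fun x => q x * phiq n x) = ev n * int01 (fun x => u x * phi n x).
Proof.
by move=> uq; rewrite (green alpha_ge1 alpha_lt2 (ev n) uq) solflux_end mulr0 addr0.
Qed.

Lemma in_form_phi n : in_form alpha (phi n) (phiq n).
Proof. exact: in_form_sol. Qed.

(** Green's formula applied both ways gives the same energy product, equal to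
    each eigenvalue times the scalar product. *)
Lemma phi_orthogonal m n : m != n -> int01 (fun x => phi m x * phi n x) = 0.
Proof.
move=> mn; have h1 := green_phi n (in_form_phi m); have h2 := green_phi m (in_form_phi n).
have e1 : int01 (fun x => phiq n x * phiq m x) = int01 (fun x => phiq m x * phiq n x).
  by apply: eq_int01 => x _; rewrite mulrC.
have e2 : int01 (fun x => phi n x * phi m x) = int01 (fun x => phi m x * phi n x).
  by apply: eq_int01 => x _; rewrite mulrC.
have : (ev n - ev m) * int01 (fun x => phi m x * phi n x) = 0.
  by rewrite mulrBl -h1 -[in X in _ - X]e2 -h2 e1 subrr.
move=> /eqP; rewrite mulf_eq0 subr_eq0 => /orP[/eqP E|/eqP//].
by move: mn; rewrite neq_ltn => /orP[/eigval_lt|/eigval_lt]; rewrite E ltxx.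
Qed.

Definition nphi n : R := int01 (fun x => phi n x * phi n x).

Lemma nphi_gt0 n : 0 < nphi n.
Proof.
apply: int01_gt0.
- by apply: C01M; exact: C01_phi.
- by move=> x _; rewrite -expr2 sqr_ge0.
- by rewrite /phi sol0// mulr1.
Qed.

Lemma phi0 x : phi 0 x = 1. Proof. exact: sol_lambda0. Qed.

Lemma nphi0 : nphi 0 = 1.
Proof. by rewrite -[RHS](int01_cst (1 : R)); apply: eq_int01 => x _; rewrite !phi0 mulr1. Qed.

Definition mode_const n : R := (j n / 2) `^ nu alpha / Gamma c.

Lemma mode_const_gt0 n : 0 < mode_const n.+1.
Proof. by rewrite divr_gt0 ?Gamma_gt0// powR_gt0// divr_gt0// bessel_zero_gt0. Qed.

(** The powers of x cancel, because kappa * nu = (alpha - 1)/2. *)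
Lemma bessel_modeE n x : 0 < x -> bessel_mode alpha n.+1 x = mode_const n.+1 * phi n.+1 x.
Proof.
move=> x0; have n0 := nu_ge0 alpha_ge1 alpha_lt2; rewrite /bessel_mode.
have j0 := bessel_zero_gt0 c0 n.
rewrite -/(kappa alpha) besselJE ?mulr_gt0 ?powR_gt0// phiE ?ltW// /bes /mode_const.
have -> : j n.+1 * x `^ k / 2 = j n.+1 / 2 * x `^ k by ring.
rewrite powRM ?powR_ge0 ?divr_ge0 ?ltW// -powRrM.
have -> : k * nu alpha = - ((1 - alpha) / 2).
  by rewrite /kappa /nu; field; rewrite subr_eq0 gt_eqF.
rewrite powRN; have : x `^ ((1 - alpha) / 2) != 0 by rewrite gt_eqF// powR_gt0.
have : Gamma c != 0 by rewrite gt_eqF// Gamma_gt0.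
by move: (Gamma _) (x `^ _) (_ `^ nu alpha) (hyp _ _) => g p r s g0 p0; field; rewrite g0 p0.
Qed.

(** Normalization removes the constant in front of the regular solution, so
    the Gamma factors of the Bessel function disappear. *)
Lemma eigfunE n x : 0 < x -> eigfun alpha n x = (Num.sqrt (nphi n))^-1 * phi n x.
Proof.
case: n => [|n] x0; first by rewrite nphi0 sqrtr1 invr1 mul1r phi0.
rewrite /eigfun bessel_modeE// mulrA; congr (_ * _).
have C0 := mode_const_gt0 n.
rewrite /normalization L2normE.
have -> : (\int[mu]_(x in `]0%R, 1%R[) (bessel_mode alpha n.+1 x ^+ 2)%:E =
   (mode_const n.+1 ^+ 2 * nphi n.+1)%:E)%E.
  transitivity (\int[mu]_(x in `]0%R, 1%R[) (mode_const n.+1 ^+ 2 * (phi n.+1 x * phi n.+1 x))%:E)%E.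
    apply: eq_integral => y; rewrite inE/= in_itv/= => /andP[y0 _].
    by rewrite bessel_modeE//; congr EFin; ring.
  have cp : C01 (fun x => phi n.+1 x * phi n.+1 x) by apply: C01M; exact: C01_phi.
  have cp2 := C01Z (a := mode_const n.+1 ^+ 2) cp.
  rewrite /nphi -int01Z// -int01_oo// /Rintegral fineK//.
  by apply: integrable_fin_num => //; exact: C01_integrable_oo.
rewrite poweR_EFin/= powR12_sqrt; last by rewrite mulr_ge0 ?sqr_ge0// ltW// nphi_gt0.
rewrite sqrtrM ?sqr_ge0// sqrtr_sqr gtr0_norm// invfM mulrAC mulVf ?gt_eqF//.
by rewrite mul1r.
Qed.

(** At a common zero of the solution and its flux, the normal form of the
    Bessel function would have a double zero. *)
Lemma phi_simple n x : 0 < x -> phi n x = 0 -> phiq n x != 0.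
Proof.
case: n => [|n] x0 px; first by move: px; rewrite phi0 => /eqP; rewrite oner_eq0.
apply/eqP => qx; have j0 := bessel_zero_gt0 c0 n.
pose t := j n.+1 * x `^ k.
have t0 : 0 < t by rewrite mulr_gt0// powR_gt0.
have bt : bes c t = 0 by rewrite -px phiE// ltW.
have bt1 : bes (c + 1) t = 0.
  move: qx; rewrite /phiq /solq sol_argE ?ltW// => /eqP.
  rewrite -/t mulf_eq0 mulf_eq0 oppr_eq0 eigvalE mulf_eq0 !sqrf_eq0.
  by rewrite (negbTE kn0) [_ == 0 :> R]gt_eqF// gt_eqF ?powR_gt0//= => /eqP.
apply: (normal_simple_zero c1 t0).
  by rewrite /normal bt mulr0.
by rewrite /dnormal bt bt1 !mulr0 subr0.
Qed.

Lemma phi_end_neq0 n : phi n 1 != 0.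
Proof.
apply/eqP => p1; have := phi_simple ltr01 p1.
rewrite /phiq -solfluxE// solflux_end mulr0 eqxx //.
Qed.

Lemma phi_ratio n u q : in_form alpha u q ->
  (forall x, 0 < x < 1 -> phi n x = 0 -> u x = 0) ->
  exists2 C, 0 < C & forall x, 0 <= x <= 1 -> `|u x| <= C * `|phi n x|.
Proof.
move=> [cu cq du] uz; have [cp cpq dp] := in_form_phi n.
apply: (vanishing_ratio cu cp du dp).
- by rewrite /phi sol0// oner_eq0.
- exact: phi_end_neq0.
move=> x x01 px; have /andP[x0 _] := x01; split; last exact: uz.
by rewrite mulf_neq0 ?phi_simple// gt_eqF// powR_gt0.
Qed.

(** Picone's identity for u^2 flux(phi) / phi, with 1/phi replaced by phi /
    (phi^2 + e) because phi vanishes in (0,1): the integrand is the derivative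
    of F, which vanishes at both ends because the flux of phi does. *)
Lemma picone_identity n u q (e : R) : 0 < e -> in_form alpha u q ->
  int01 (fun x => q x ^+ 2 - ev n * (u x ^+ 2 * phi n x ^+ 2 / (phi n x ^+ 2 + e))
    - ((q x - u x * phiq n x * phi n x / (phi n x ^+ 2 + e)) ^+ 2
       - e * (u x ^+ 2 * phiq n x ^+ 2 / (phi n x ^+ 2 + e) ^+ 2))) = 0.
Proof.
move=> e0 [cu cq du]; have [cp cr dp] := in_form_phi n.
have cf : C01 (solflux alpha (ev n)) by exact: C01_solflux.
pose y := phi n; pose r := phiq n; pose fl := solflux alpha (ev n).
pose D x := y x ^+ 2 + e.
have D0 x : D x != 0 by rewrite gt_eqF// ltr_wpDl// sqr_ge0.
have csq f : C01 f -> C01 (fun x => f x ^+ 2) by move=> h; exact: (C01M h h).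
have cD : C01 D by apply: C01D; [exact: csq|exact: C01_cst].
have cDi : C01 (fun x => (D x)^-1) by move=> x; apply: cvgV; [exact: D0|exact: cD].
have cD2i : C01 (fun x => (D x ^+ 2)^-1).
  by move=> x; apply: cvgV; [rewrite sqrf_eq0; exact: D0|exact: csq].
pose F x := u x ^+ 2 * fl x * y x * (D x)^-1.
have cF : C01 F by apply: C01M => //; apply: C01M => //; apply: C01M => //; exact: csq.
rewrite -[RHS](_ : F 1 - F 0 = 0); last first.
  by rewrite /F /fl solflux_end solflux0 !(mulr0, mul0r) subrr.
apply: int01_FTC => //.
  apply: C01B; first apply: C01B.
  - exact: csq.
  - by apply: C01Z; apply: C01M => //; apply: C01M; exact: csq.
  apply: C01B.
  - by apply: csq; apply: C01B => //; apply: C01M => //; apply: C01M => //; apply: C01M.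
  - by apply: C01Z; apply: C01M => //; apply: C01M; exact: csq.
move=> x x01; have /andP[x0 _] := x01.
have h1 := du x x01; have h2 := dp x x01; have h3 := is_derive_solflux alpha_ge1 alpha_lt2 (ev n) x0.
have h4 : is_derive x 1 D (2 * y x * (x `^ (- (alpha / 2)) * r x)).
  by apply: is_derive_eq; rewrite /GRing.scale/= /y /r; ring.
have h5 := is_deriveV (D0 x) h4.
rewrite /F; apply: is_derive_eq; rewrite /GRing.scale/=.
have flE : r x = x `^ (- (alpha / 2)) * fl x by rewrite /fl solfluxE.
have := D0 x; rewrite /D /y /r; rewrite -/(phi n) -/(phiq n) -/y -/r in flE *.
move: (y x) (r x) (u x) (q x) (fl x) (x `^ _) flE => a b s t f p -> Dn.
by field.
Qed.

(** The regularized identity gives the inequality up to an error e u^2 q^2 /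
    (phi^2 + e)^2, with q the second component of phi; as u is bounded by a
    multiple of phi, it is dominated, and it tends to 0 with e. *)
Lemma picone n u q : in_form alpha u q ->
  (forall x, 0 < x < 1 -> phi n x = 0 -> u x = 0) ->
  ev n * int01 (fun x => u x ^+ 2) <= int01 (fun x => q x ^+ 2).
Proof.
move=> uq uz; have [C C0 uC] := phi_ratio uq uz.
have [cu cq du] := uq; have [cp cr dp] := in_form_phi n.
have [Mu Mu0 uM] := C01_bounded cu; have [Mq Mq0 qM] := C01_bounded cq.
have [Mr Mr0 rM] := C01_bounded cr.
have csq f : C01 f -> C01 (fun x => f x ^+ 2) by move=> h; exact: (C01M h h).
pose e m : R := m.+1%:R^-1.
have e0 m : 0 < e m by rewrite invr_gt0 ltr0n.
pose D m x := phi n x ^+ 2 + e m.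
have D0 m x : 0 < D m x by rewrite ltr_wpDl// sqr_ge0.
have cD m : C01 (D m) by apply: C01D; [exact: csq|exact: C01_cst].
have cDi m : C01 (fun x => (D m x)^-1).
  by move=> x; apply: cvgV; [rewrite gt_eqF//; exact: D0|exact: cD].
have cD2i m : C01 (fun x => (D m x ^+ 2)^-1).
  move=> x; apply: cvgV; last exact: csq.
  by rewrite sqrf_eq0 gt_eqF//; exact: D0.
pose A m x := q x ^+ 2 - ev n * (u x ^+ 2 * phi n x ^+ 2 / D m x).
pose B m x := e m * (u x ^+ 2 * phiq n x ^+ 2 / D m x ^+ 2).
have cA m : C01 (A m).
  apply: C01B; first exact: csq.
  by apply: C01Z; apply: C01M => //; apply: C01M; exact: csq.
have cB m : C01 (B m) by apply: C01Z; apply: C01M => //; apply: C01M; exact: csq.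
pose S m x := (q x - u x * phiq n x * phi n x / D m x) ^+ 2.
have cS m : C01 (S m).
  by apply: csq; apply: C01B => //; apply: C01M => //; apply: C01M => //; apply: C01M.
have AB m : 0 <= int01 (fun x => A m x + B m x).
  have := picone_identity n (e0 m) uq.
  rewrite -[X in X = 0](_ : int01 (fun x => A m x - (S m x - B m x)) = _)//.
  rewrite int01B//; last exact: C01B.
  rewrite (int01B (cS m) (cB m)) (int01D (cA m) (cB m)).
  have := int01_ge0 (f := S m) (fun x _ => sqr_ge0 _); lra.
have lim : int01 (fun x => A m x + B m x) @[m --> \oo] --> 
   int01 (fun x => q x ^+ 2 - ev n * u x ^+ 2).
  (* bounds for the square of q, for the regularized square of u, and for the
     error *)
  apply: (@int01_dct _ _ _ (Mq ^+ 2 + ev n * Mu ^+ 2 + C ^+ 2 * Mr ^+ 2)).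
  - by move=> m; exact: C01D.
  - by apply: C01B; [exact: csq|apply: C01Z; exact: csq].
  - move=> m x x01; have qx := qM x x01; have ux := uM x x01; have rx := rM x x01.
    have ucx := uC x x01.
    have sqle (a M : R) : `|a| <= M -> 0 <= a ^+ 2 <= M ^+ 2.
      move=> aM; rewrite sqr_ge0 -[a ^+ 2]real_normK ?num_real//=.
      by rewrite ler_pXn2r// nnegrE (le_trans _ aM).
    have /andP[q0 q1] := sqle _ _ qx; have /andP[u0 u1] := sqle _ _ ux.
    have /andP[r0 r1] := sqle _ _ rx.
    have /andP[_ ] := sqle _ _ ucx; rewrite exprMn real_normK ?num_real// => uc1.
    have Dx := D0 m x; have em := e0 m.
    have y0 : 0 <= phi n x ^+ 2 := sqr_ge0 _.
    have b1 : 0 <= u x ^+ 2 * phi n x ^+ 2 / D m x <= Mu ^+ 2.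
      apply/andP; split; first by apply: divr_ge0; [exact: mulr_ge0|exact: ltW].
      rewrite ler_pdivrMr//; apply: ler_pM => //.
      by rewrite /D lerDl ltW.
    have b2 : 0 <= B m x <= C ^+ 2 * Mr ^+ 2.
      rewrite /B; apply/andP; split.
        apply: mulr_ge0; first exact: ltW.
        by apply: divr_ge0; [exact: mulr_ge0|exact: sqr_ge0].
      rewrite mulrA ler_pdivrMr ?exprn_gt0//.
      have ey : e m * phi n x ^+ 2 <= D m x ^+ 2 by rewrite /D; nra.
      apply: (@le_trans _ _ (e m * (C ^+ 2 * phi n x ^+ 2 * Mr ^+ 2))).
        by apply: ler_wpM2l; [exact: ltW|exact: ler_pM].
      rewrite (_ : e m * _ = C ^+ 2 * Mr ^+ 2 * (e m * phi n x ^+ 2)); last by ring.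
      by rewrite ler_wpM2l// mulr_ge0// sqr_ge0.
    case/andP: b1 => b1 b1'; case/andP: b2 => b2 b2'.
    have ev0 := eigval_ge0 n.
    have b3 : 0 <= ev n * (u x ^+ 2 * phi n x ^+ 2 / D m x) <= ev n * Mu ^+ 2.
      by rewrite mulr_ge0//= ler_wpM2l.
    case/andP: b3 => b3 b3'; rewrite /A ler_norml; lra.
  - move=> x x01.
    have ecv : e m @[m --> \oo] --> (0 : R) by exact: cvg_harmonic.
    have [y0|y0] := eqVneq (phi n x) 0.
      have ux : u x = 0.
        have := uC x x01; rewrite y0 normr0 mulr0 normr_le0 => /eqP //.
      have -> : (fun m => A m x + B m x) = (fun m => q x ^+ 2).
        by apply/funext => m; rewrite /A /B ux expr0n/= !(mul0r, mulr0, subr0, addr0).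
      by rewrite ux expr0n/= mulr0 subr0; exact: cvg_cst.
    have y20 : phi n x ^+ 2 + 0 != 0 by rewrite addr0 sqrf_eq0.
    have Dcv : D m x @[m --> \oo] --> phi n x ^+ 2 + 0 by apply: cvgD => //; exact: cvg_cst.
    have -> : q x ^+ 2 - ev n * u x ^+ 2 = 
       (q x ^+ 2 - ev n * (u x ^+ 2 * phi n x ^+ 2 / (phi n x ^+ 2 + 0))) +
       0 * (u x ^+ 2 * phiq n x ^+ 2 / (phi n x ^+ 2 + 0) ^+ 2).
      by rewrite addr0 mul0r addr0 mulfK// sqrf_eq0.
    apply: cvgD.
      apply: cvgB; first exact: cvg_cst.
      by apply: cvgMr; apply: cvgMr; exact: cvgV.
    apply: cvgM => //; apply: cvgMr; apply: cvgV; first by rewrite sqrf_eq0.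
    exact: (cvgM Dcv Dcv).
have : 0 <= int01 (fun x => q x ^+ 2 - ev n * u x ^+ 2).
  rewrite -(cvg_lim _ lim)//; apply: limr_ge; first by apply/cvg_ex; eexists; exact: lim.
  by near=> m; exact: AB.
have cu2 : C01 (fun x => u x ^+ 2) by exact: csq.
by rewrite int01B ?int01Z ?subr_ge0//; [exact: csq|exact: C01Z].
Unshelve. all: by end_near. Qed.

(** In the variable t = j_n x^kappa the derivative of phi n vanishes only at
    zeros of J_(nu + 1), so by Rolle's theorem phi n has at most one zero
    between consecutive ones; all t in (0, j_n) lie in one of n such
    intervals. *)
Lemma phi_nodes n : exists p : 'I_n -> R,
  forall x, 0 < x < 1 -> phi n x = 0 -> exists i, p i = x.
Proof.
case: n => [|n].
  by exists (fun=> 0) => x _; rewrite phi0 => /eqP; rewrite oner_eq0.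
have jn := bessel_zero_gt0 c0 n.
pose P (i : 'I_n.+1) x := [/\ 0 < x, j i < j n.+1 * x `^ k < j i.+1 & phi n.+1 x = 0].
have uniqP i x y : P i x -> P i y -> x = y.
  wlog xy : x y / x <= y => [wl Px Py|].
    by have [/wl|/ltW/wl] := leP x y; [exact|move=> /(_ Py Px)->].
  move=> [x0 /andP[ix xi] px] [y0 /andP[iy yi] py].
  move: xy; rewrite le_eqVlt => /predU1P[//|xy].
  have sxy : j n.+1 * x `^ k < j n.+1 * y `^ k.
    by rewrite ltr_pM2l// gt0_ltr_powR ?nnegrE// ltW.
  have bx : bes c (j n.+1 * x `^ k) = 0 by rewrite -px phiE// ltW.
  have by_ : bes c (j n.+1 * y `^ k) = 0 by rewrite -py phiE// ltW.
  have [|z /andP[xz zy] /eqP] := rolle sxy (fun z _ => is_derive_bes z c1).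
    by rewrite bx by_.
  have bz : bes (c + 1) z != 0.
    by apply: (@bessel_zero_consecutive _ c c0 i z); rewrite (lt_trans ix xz) (lt_trans zy yi).
  have z0 : 0 < z by apply: lt_trans xz; rewrite mulr_gt0// powR_gt0.
  have z2c : 0 < z / (2 * c) by apply: divr_gt0; [exact: z0|move: c1; lra].
  by rewrite mulf_eq0 (negbTE bz) orbF oppr_eq0 (gt_eqF z2c).
(* intervals without a zero receive the dummy node 0 *)
exists (fun i => if pselect (exists x, P i x) is left e then sval (cid e) else 0).
move=> x /andP[x0 x1] px.
pose t := j n.+1 * x `^ k.
have t0 : 0 < t by rewrite mulr_gt0// powR_gt0.
have tn : t < j n.+1.
  rewrite /t gtr_pMr//; have -> : 1 = 1 `^ k :> R by rewrite powR1.
  by apply: gt0_ltr_powR => //; rewrite nnegrE ltW.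
have bt : bes c t = 0 by rewrite -px phiE// ltW.
have tj m : t != j m.
  case: m => [|m]; first by rewrite /= gt_eqF.
  apply/eqP => tj; have := phi_simple x0 px.
  rewrite /phiq /solq sol_argE ?ltW// -/t.
  have -> : hyp (c + 1) (t ^+ 2 / 4) = 0 by rewrite tj; exact: (bes_bessel_zero c0 m).
  by rewrite mulr0 eqxx.
have find m : t < j m -> exists2 i, (i < m)%N & j i < t < j i.+1.
  elim: m => [|m ih tm]; first by rewrite /= ltNge ltW.
  have [/ih[i im it]|] := ltP t (j m); first by exists i => //; exact: ltnW.
  by rewrite le_eqVlt eq_sym (negbTE (tj m))/= => mt; exists m => //; rewrite mt tm.
have [i0 i0n Hi] := find _ tn.
pose i := Ordinal i0n.
exists i; case: pselect => [e|ne]; last first.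
  by exfalso; apply: ne; exists x.
by apply: (uniqP i); [exact: (svalP (cid e))|split].
Qed.

Definition comb n (a : 'I_n -> R) x := \sum_(i < n) a i * phi i x.
Definition combq n (a : 'I_n -> R) x := \sum_(i < n) a i * phiq i x.

Lemma in_form_comb n (a : 'I_n -> R) : in_form alpha (comb a) (combq a).
Proof.
elim: n a => [|n ih] a.
  have -> : comb a = (fun x => 0 * phi 0 x) by apply/funext => x; rewrite /comb big_ord0 mul0r.
  have -> : combq a = (fun x => 0 * phiq 0 x) by apply/funext => x; rewrite /combq big_ord0 mul0r.
  by apply: in_formZ; exact: in_form_phi.
pose b i := a (widen_ord (leqnSn n) i).
have -> : comb a = (fun x => comb b x + a ord_max * phi n x).
  by apply/funext => x; rewrite /comb big_ord_recr.
have -> : combq a = (fun x => combq b x + a ord_max * phiq n x).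
  by apply/funext => x; rewrite /combq big_ord_recr.
apply: in_formD => //.
by apply: in_formZ; exact: in_form_phi.
Qed.

Lemma int01_comb f n (a : 'I_n -> R) : C01 f ->
  int01 (fun x => f x * comb a x) = \sum_(i < n) a i * int01 (fun x => f x * phi i x).
Proof.
move=> cf; rewrite (@eq_int01 _ _ (fun x => \sum_(i < n) a i * (f x * phi i x))); last first.
  by move=> x _; rewrite /comb mulr_sumr; apply: eq_bigr => i _; rewrite mulrCA.
have cfp (i : 'I_n) : C01 (fun x => f x * phi i x) by apply: C01M => //; exact: C01_phi.
rewrite int01_sum; last by move=> i; exact: C01Z.
by apply: eq_bigr => i _; rewrite int01Z.
Qed.

Lemma int01_combq f n (a : 'I_n -> R) : C01 f ->
  int01 (fun x => f x * combq a x) = \sum_(i < n) a i * int01 (fun x => f x * phiq i x).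
Proof.
move=> cf; rewrite (@eq_int01 _ _ (fun x => \sum_(i < n) a i * (f x * phiq i x))); last first.
  by move=> x _; rewrite /combq mulr_sumr; apply: eq_bigr => i _; rewrite mulrCA.
have cfp (i : 'I_n) : C01 (fun x => f x * phiq i x) by apply: C01M => //; exact: C01_phiq.
rewrite int01_sum; last by move=> i; exact: C01Z.
by apply: eq_bigr => i _; rewrite int01Z.
Qed.

Lemma comb_phi n (a : 'I_n -> R) (i : 'I_n) :
  int01 (fun x => comb a x * phi i x) = a i * nphi i.
Proof.
rewrite (@eq_int01 _ _ (fun x => phi i x * comb a x)); last by move=> x _; rewrite mulrC.
rewrite int01_comb; last exact: C01_phi.
rewrite (bigD1 i)//= big1 ?addr0// => m mi.
by rewrite phi_orthogonal ?mulr0// eq_sym.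
Qed.

Lemma comb_norm n (a : 'I_n -> R) :
  int01 (fun x => comb a x ^+ 2) = \sum_(i < n) a i ^+ 2 * nphi i.
Proof.
have [cc cq _] := in_form_comb a.
rewrite (@eq_int01 _ _ (fun x => comb a x * comb a x)) => [|x _]; last by rewrite expr2.
by rewrite int01_comb//; apply: eq_bigr => i _; rewrite comb_phi mulrA.
Qed.

Lemma combq_form n (a : 'I_n -> R) u q : in_form alpha u q ->
  int01 (fun x => q x * combq a x) = \sum_(i < n) a i * (ev i * int01 (fun x => u x * phi i x)).
Proof.
move=> uq; have [_ cq _] := uq; rewrite int01_combq//.
by apply: eq_bigr => i _; rewrite (green_phi i uq).
Qed.

Lemma combq_norm n (a : 'I_n -> R) :
  int01 (fun x => combq a x ^+ 2) = \sum_(i < n) ev i * (a i ^+ 2 * nphi i).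
Proof.
rewrite (@eq_int01 _ _ (fun x => combq a x * combq a x)) => [|x _]; last by rewrite expr2.
rewrite (combq_form a (in_form_comb a)); apply: eq_bigr => i _.
by rewrite comb_phi; ring.
Qed.

(** The square matrix of values phi_k(p_i) is invertible: a combination of
    phi_0, ..., phi_(n-1) vanishing at all nodes has energy at least lambda_n
    times its squared norm, by Picone's inequality, but its energy involves
    the smaller eigenvalues only. *)
Lemma interpolation n (p : 'I_n -> R) :
  (forall x, 0 < x < 1 -> phi n x = 0 -> exists i, p i = x) ->
  forall b : 'I_n -> R, exists a : 'I_n -> R, forall i, comb a (p i) = b i.
Proof.
move=> np b; pose A : 'M[R]_n := \matrix_(i, k) phi i (p k).
have combA (a : 'rV[R]_n) i : (a *m A) 0 i = comb (fun k => a 0 k) (p i).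
  by rewrite mxE; apply: eq_bigr => m _; rewrite mxE.
have Au : A \in unitmx.
  rewrite -row_free_unit; apply/row_freeP.
  apply/row_freeP; rewrite -kermx_eq0; apply/eqP/row_matrixP => m; rewrite row0.
  set a := row m (kermx A).
  have aA : a *m A = 0 by apply/sub_kermxP; exact: row_sub.
  have zero : forall i, comb (fun k => a 0 k) (p i) = 0.
    by move=> i; rewrite -combA aA mxE.
  have := picone (n := n) (in_form_comb (fun k => a 0 k)).
  move=> /(_ _)/wrap[|].
    by move=> x x01 /(np x x01)[i <-].
  rewrite comb_norm combq_norm mulr_sumr -subr_ge0 -sumrB.
  have neg (i : 'I_n) : ev i * (a 0 i ^+ 2 * nphi i) - ev n * (a 0 i ^+ 2 * nphi i) <= 0.
    rewrite -mulrBl; apply: mulr_le0_ge0; first by rewrite subr_le0 ltW// eigval_lt.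
    by rewrite mulr_ge0 ?sqr_ge0// ltW// nphi_gt0.
  move=> sge.
  have : \sum_(i < n) - (ev i * (a 0 i ^+ 2 * nphi i) - ev n * (a 0 i ^+ 2 * nphi i)) = 0.
    apply/eqP; rewrite eq_le sumrN oppr_le0 sge/= oppr_ge0.
    by apply: sumr_le0 => i _.
  move=> /eqP; rewrite psumr_eq0; last by move=> i _; rewrite oppr_ge0.
  move=> /allP az; apply/rowP => i; rewrite [RHS]mxE.
  have := az i (mem_index_enum _) => /=; rewrite oppr_eq0 -mulrBl mulf_eq0 subr_eq0.
  rewrite [ev i == _]lt_eqF ?eigval_lt//= mulf_eq0 sqrf_eq0 => /orP[/eqP//|].
  by rewrite gt_eqF// nphi_gt0.
pose a := (\row_i b i) *m invmx A.
exists (fun k => a 0 k) => i; rewrite -combA /a mulmxKV//.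
by rewrite mxE.
Qed.

(** Subtract from v the combination that equals v at the zeros of phi n and
    apply Picone's inequality to the difference. Cross terms vanish by
    orthogonality, and the combination itself contributes less energy than
    lambda_n times its squared norm. *)
Lemma minimax n v r : in_form alpha v r ->
  (forall i : 'I_n, int01 (fun x => v x * phi i x) = 0) ->
  ev n * int01 (fun x => v x ^+ 2) <= int01 (fun x => r x ^+ 2).
Proof.
move=> vr vphi; have [p np] := phi_nodes n.
have [a pa] := interpolation np (fun i => v (p i)).
have [cv cr _] := vr; have [cw cwq _] := in_form_comb a.
have csq f : C01 f -> C01 (fun x => f x ^+ 2) by move=> h; exact: (C01M h h).
pose u x := v x + (-1) * comb a x; pose q x := r x + (-1) * combq a x.
have uq : in_form alpha u q.
  by apply: in_formD => //; apply: in_formZ; exact: in_form_comb.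
have := picone (n := n) uq.
move=> /(_ _)/wrap[|].
  by move=> x x01 /(np x x01)[i <-]; rewrite /u pa mulN1r subrr.
have expand (f g : R -> R) : C01 f -> C01 g ->
   int01 (fun x => (f x + (-1) * g x) ^+ 2) =
   int01 (fun x => f x ^+ 2) - 2 * int01 (fun x => f x * g x) + int01 (fun x => g x ^+ 2).
  move=> cf cg; have cf2 := csq _ cf; have cg2 := csq _ cg; have cfg := C01M cf cg.
  rewrite -int01Z// -int01B//; last exact: C01Z.
  rewrite -int01D//; last by apply: C01B => //; exact: C01Z.
  by apply: eq_int01 => x _; ring.
rewrite (expand _ _ cv cw) (expand _ _ cr cwq).
rewrite (int01_comb a cv) (combq_form a vr).
rewrite big1 => [|i _]; last by rewrite vphi mulr0.
rewrite big1 => [|i _]; last by rewrite vphi !mulr0.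
rewrite mulr0 !subr0 comb_norm combq_norm mulrDr.
have : \sum_(i < n) ev i * (a i ^+ 2 * nphi i) <= ev n * \sum_(i < n) a i ^+ 2 * nphi i.
  rewrite mulr_sumr; apply: ler_sum => i _; apply: ler_wpM2r; last by rewrite ltW// eigval_lt.
  by rewrite mulr_ge0 ?sqr_ge0// ltW// nphi_gt0.
lra.
Qed.

(** The remainder of the expansion of u is orthogonal to the first n
    eigenfunctions, and its energy is at most that of u. *)
Lemma residual_bound n u q : in_form alpha u q ->
  ev n * int01 (fun x => (u x - comb (fun i : 'I_n => int01 (fun x => u x * phi i x) / nphi i) x) ^+ 2)
    <= int01 (fun x => q x ^+ 2).
Proof.
move=> uq; set a := fun i : 'I_n => _.
have aE (i : 'I_n) : int01 (fun x => u x * phi i x) = a i * nphi i.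
  by rewrite /a divfK// gt_eqF// nphi_gt0.
have [cu cq _] := uq; have [cw cwq _] := in_form_comb a.
have csq f : C01 f -> C01 (fun x => f x ^+ 2) by move=> h; exact: (C01M h h).
pose v x := u x + (-1) * comb a x; pose r x := q x + (-1) * combq a x.
have vr : in_form alpha v r.
  by apply: in_formD => //; apply: in_formZ; exact: in_form_comb.
have -> : (fun x => (u x - comb a x) ^+ 2) = (fun x => v x ^+ 2).
  by apply/funext => x; rewrite /v mulN1r.
apply: le_trans (minimax (n := n) vr _) _.
  move=> i; have cp := @C01_phi i.
  rewrite (@eq_int01 _ _ (fun x => u x * phi i x + (-1) * (comb a x * phi i x))); last first.
    by move=> x _; rewrite /v; ring.
  have cwp := C01M cw cp; rewrite int01D//; [|exact: C01M|exact: C01Z].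
  by rewrite int01Z// comb_phi aE mulN1r subrr.
have cf2 := csq _ cq; have cg2 := csq _ cwq; have cfg := C01M cq cwq.
rewrite (@eq_int01 _ _ (fun x => q x ^+ 2 - 2 * (q x * combq a x) + combq a x ^+ 2)); last first.
  by move=> x _; rewrite /r; ring.
rewrite int01D//; last by apply: C01B => //; exact: C01Z.
rewrite int01B//; last exact: C01Z.
rewrite int01Z// (combq_form a uq) combq_norm.
have -> : \sum_(i < n) a i * (ev i * int01 (fun x => u x * phi i x)) =
   \sum_(i < n) ev i * (a i ^+ 2 * nphi i).
  by apply: eq_bigr => i _; rewrite aE; ring.
have : 0 <= \sum_(i < n) ev i * (a i ^+ 2 * nphi i).
  apply: sumr_ge0 => i _; rewrite mulr_ge0 ?eigval_ge0// mulr_ge0 ?sqr_ge0//.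
  by rewrite ltW// nphi_gt0.
lra.
Qed.

Lemma eigval_pinfty : ev n @[n --> \oo] --> +oo.
Proof.
apply/cvgryPge => A.
have jp := bessel_zero_pinfty c0 c1.
near=> n; rewrite eigvalE.
have jA : Num.max 1 (A / k ^+ 2) <= j n.
  by near: n; move/cvgryPge : jp; exact.
move: jA; rewrite ge_max => /andP[j1 jA].
rewrite mulrC -ler_pdivrMr ?exprn_gt0//; apply: le_trans jA _.
by rewrite expr2 ler_peMr// (le_trans ler01).
Unshelve. all: by end_near. Qed.

Lemma residual_cvg0 u q : in_form alpha u q ->
  int01 (fun x => (u x - comb (fun i : 'I_n => int01 (fun x => u x * phi i x) / nphi i) x) ^+ 2)
    @[n --> \oo] --> (0 : R).
Proof.
move=> uq; apply/cvgrPdist_le => e e0.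
near=> n; rewrite sub0r normrN ger0_norm; last by apply: int01_ge0 => x _; exact: sqr_ge0.
have evn : Num.max 1 (int01 (fun x => q x ^+ 2) / e) <= ev n.
  by near: n; move/cvgryPge : eigval_pinfty; exact.
move: evn; rewrite ge_max => /andP[ev1 eve].
have := residual_bound n uq; rewrite ler_pdivrMr// in eve.
move=> h; have {h} := le_trans h eve.
by rewrite ler_pM2l//; exact: lt_le_trans ev1.
Unshelve. all: by end_near. Qed.
End Eigen.

(** * Density of the form domain and best approximation *)

Section L2theory.
Variable R : realType.
Implicit Types (f g h : R -> R).
Notation mu := (@lebesgue_measure R).
Notation I01 := (`]0, 1[%classic : set R).

Let mI : measurable (`]0, 1[%classic : set (measurableTypeR R)). Proof. exact: measurable_itv. Qed.

Lemma L2_mul f g : L2 f -> L2 g -> mu.-integrable I01 (EFin \o (fun x => f x * g x)).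
Proof.
move=> /L2P[mf if2] /L2P[mg ig2].
apply: (@le_integrable _ _ _ mu I01 mI _ (EFin \o (fun x => f x ^+ 2 + g x ^+ 2))).
- by apply/measurable_EFinP; exact: measurable_funM.
- move=> x _ /=; rewrite lee_fin.
  rewrite [leRHS]ger0_norm ?addr_ge0 ?sqr_ge0//.
  rewrite ler_norml; have := sqr_ge0 (f x - g x); have := sqr_ge0 (f x + g x); nra.
- exact: (integrableD mI if2 ig2).
Qed.

Lemma L2Z (a : R) f : L2 f -> L2 (fun x => a * f x).
Proof.
move=> /L2P[mf if2]; apply/L2P; split.
  by apply: measurable_funM => //; exact: measurable_cst.
have := integrableZl mI (a ^+ 2) if2.
by apply: eq_integrable => // x _ /=; rewrite exprMn.
Qed.

Lemma L2D f g : L2 f -> L2 g -> L2 (fun x => f x + g x).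
Proof.
move=> Lf Lg; have /L2P[mf if2] := Lf; have /L2P[mg ig2] := Lg.
apply/L2P; split; first exact: measurable_funD.
have := integrableD mI (integrableD mI if2 ig2) (integrableZl mI 2 (L2_mul Lf Lg)).
by apply: eq_integrable => // x _ /=; rewrite -EFinM -!EFinD; congr EFin; ring.
Qed.

Lemma L2B f g : L2 f -> L2 g -> L2 (fun x => f x - g x).
Proof.
move=> Lf Lg; have := L2D Lf (L2Z (-1) Lg).
by under eq_fun do rewrite mulN1r.
Qed.

Lemma C01_L2 f : C01 f -> L2 f.
Proof.
move=> cf; apply/L2P; split.
  by have /integrableP[/measurable_EFinP] := C01_integrable_oo cf.
by apply: C01_integrable_oo; exact: (C01M cf cf).
Qed.

Lemma L2_sum n (F : 'I_n -> R -> R) : (forall i, L2 (F i)) ->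
  L2 (fun x => \sum_(i < n) F i x).
Proof.
elim: n F => [|n ih] F LF.
  have -> : (fun x => \sum_(i < 0) F i x) = cst 0 by apply/funext => x; rewrite big_ord0.
  by apply: C01_L2; exact: C01_cst.
have -> : (fun x => \sum_(i < n.+1) F i x) =
  (fun x => \sum_(i < n) F (widen_ord (leqnSn n) i) x + F ord_max x).
  by apply/funext => x; rewrite big_ord_recr.
by apply: L2D => //; exact: ih.
Qed.

Definition dist2 f g : R := \int[mu]_(x in I01) (f x - g x) ^+ 2.

Lemma sqr_integrable f : L2 f -> mu.-integrable I01 (EFin \o (fun x => f x ^+ 2)).
Proof. by move=> /L2P[]. Qed.

Lemma le_Rint f g : mu.-integrable I01 (EFin \o f) -> mu.-integrable I01 (EFin \o g) ->
  (forall x, 0 < x < 1 -> f x <= g x) ->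
  \int[mu]_(x in I01) f x <= \int[mu]_(x in I01) g x.
Proof.
move=> jf jg fg; apply: le_Rintegral => // x /=; rewrite in_itv/=; exact: fg.
Qed.

Lemma dist2_triangle f g h : L2 f -> L2 g -> L2 h ->
  dist2 f h <= 2 * dist2 f g + 2 * dist2 g h.
Proof.
move=> Lf Lg Lh.
have i1 := sqr_integrable (L2B Lf Lg); have i2 := sqr_integrable (L2B Lg Lh).
have i3 := sqr_integrable (L2B Lf Lh).
have z1 := integrableZl mI 2 i1; have z2 := integrableZl mI 2 i2.
rewrite /dist2 -!RintegralZl// -RintegralD//; apply: le_Rint => //.
  exact: (integrableD mI z1 z2).
move=> x _; have := sqr_ge0 (f x - 2 * g x + h x); nra.
Qed.

Lemma dist2_int01 f g : C01 f -> C01 g -> dist2 f g = int01 (fun x => (f x - g x) ^+ 2).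
Proof.
move=> cf cg; rewrite /dist2 int01_oo//.
by have h := C01B cf cg; exact: (C01M h h).
Qed.

Lemma dist2_dct (f_ : nat -> R -> R) f (g : R -> R) : (forall n, L2 (f_ n)) -> L2 f -> L2 g ->
  (forall n x, 0 < x < 1 -> `|f_ n x - f x| <= g x) ->
  (forall x, 0 < x < 1 -> f_ n x @[n --> \oo] --> f x) ->
  dist2 f (f_ n) @[n --> \oo] --> (0 : R).
Proof.
move=> Lf_ Lf Lg bd cv.
have mf_ n : measurable_fun I01 (EFin \o (fun x => (f x - f_ n x) ^+ 2)).
  by have /integrableP[] := sqr_integrable (L2B Lf (Lf_ n)).
have m0 : measurable_fun I01 (EFin \o cst (0 : R)).
  by have /integrableP[] := C01_integrable_oo (@C01_cst R 0).
have [||_ _ hh] := @dominated_convergence _ _ R mu I01 mI (fun n => EFin \o (fun x => (f x - f_ n x) ^+ 2)) (EFin \o cst 0) _ mf_ m0 _ (sqr_integrable Lg) _.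
- apply: aeW => x /=; rewrite in_itv/= => x01; apply: cvg_EFin; first by near=> n.
  have h1 : f x - f_ n x @[n --> \oo] --> f x - f x.
    by apply: cvgB; [exact: cvg_cst|exact: cv].
  have := cvgM h1 h1; rewrite subrr mulr0; exact.
- apply: aeW => x n /=; rewrite in_itv/= => x01; rewrite lee_fin.
  rewrite ger0_norm ?sqr_ge0// -real_normK ?num_real// distrC.
  have b := bd n x x01; have b0 := normr_ge0 (f_ n x - f x).
  by rewrite ler_pXn2r// nnegrE (le_trans b0).
have If n : (\int[mu]_(x in I01) ((f x - f_ n x) ^+ 2)%:E)%E = (dist2 f (f_ n))%:E.
  rewrite /dist2 /Rintegral fineK//; apply: integrable_fin_num => //.
  exact: (sqr_integrable (L2B Lf (Lf_ n))).
move: hh; rewrite /= integral0 => /fine_cvgP[_].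
by under eq_fun do rewrite /= If /=.
Unshelve. all: by end_near. Qed.

Lemma L2_bounded f (M : R) : measurable_fun I01 f -> (forall x, 0 < x < 1 -> `|f x| <= M) -> L2 f.
Proof.
move=> mf fM; apply/L2P; split => //.
apply: (@le_integrable _ _ _ mu I01 mI _ (EFin \o cst (M ^+ 2))).
- by apply/measurable_EFinP; exact: measurable_funX.
- move=> x /=; rewrite in_itv/= => x01; rewrite lee_fin [leLHS]ger0_norm ?sqr_ge0//.
  have fx := fM x x01; have f0 := normr_ge0 (f x).
  have M0 := sqr_ge0 M; have := sqr_ge0 (f x).
  rewrite (ger0_norm M0) -[f x ^+ 2]real_normK ?num_real// => _; nra.
- by apply: C01_integrable_oo; exact: C01_cst.
Qed.

Lemma clamp_dist (M y : R) : 0 < M -> `|clamp (- M) M y - y| <= `|y|.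
Proof.
move=> M0; rewrite /clamp /Num.max /Num.min.
case: (ltP M y) => h1; case: ltP => h2; case: (ger0P y) => h3; case: ger0P => h4; lra.
Qed.

Lemma clamp_dist_le (M x y : R) : `|x| <= M -> `|x - clamp (- M) M y| <= `|x - y|.
Proof.
rewrite ler_norml => /andP[g1 g2]; rewrite /clamp /Num.max /Num.min.
have m := ler_norm (x - y); have m' := ler_norm (- (x - y)); rewrite normrN in m'.
rewrite ler_norml.
by case: (ltP M y) => h1; case: ltP => h2; lra.
Qed.

Lemma L2_truncation f (e : R) : L2 f -> 0 < e ->
  exists g M, [/\ measurable_fun I01 g, 0 < M, forall x, `|g x| <= M & dist2 f g < e].
Proof.
move=> Lf e0; have /L2P[mf _] := Lf.
pose f_ (n : nat) x := clamp (- n.+1%:R) n.+1%:R (f x).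
have n0 (n : nat) : - n.+1%:R <= n.+1%:R :> R by rewrite (@le_trans _ _ 0)// oppr_le0.
have fM n x : `|f_ n x| <= n.+1%:R by rewrite ler_norml clamp_in.
have mf_ n : measurable_fun I01 (f_ n).
  apply: measurable_maxr; first exact: measurable_cst.
  by apply: measurable_minr => //; exact: measurable_cst.
have Lf_ n : L2 (f_ n) by apply: (L2_bounded (M := n.+1%:R)).
have bd n x : `|f_ n x - f x| <= `|f x|.
  exact: clamp_dist.
have Lnf : L2 (fun x => `|f x|).
  have /L2P[_ if2] := Lf; apply/L2P; split; first exact: measurableT_comp.
  by apply: eq_integrable if2 => // x _ /=; rewrite real_normK ?num_real.
have cv x : f_ n x @[n --> \oo] --> f x.
  apply: cvg_near_cst; near=> n; apply: clamp_id.
  rewrite -ler_norml; apply: le_trans (_ : n%:R <= _); last by rewrite ler_nat.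
  near: n; exact: nbhs_infty_ger.
have := dist2_dct Lf_ Lf Lnf (fun n x _ => bd n x) (fun x _ => cv x).
move=> /cvgr_dist_lt /(_ _ e0) [N _ /(_ N (leqnn N))].
rewrite sub0r normrN => h; exists (f_ N), N.+1%:R; split => //.
by apply: le_lt_trans h; exact: ler_norm.
Unshelve. all: by end_near. Qed.

(** Continuous functions approximate in L^1; clamping the approximation to the
    bound M of g brings it closer to g and turns L^1 closeness into L^2
    closeness. *)
Lemma bounded_continuous_approx g (M e : R) : measurable_fun I01 g -> 0 < M ->
  (forall x, `|g x| <= M) -> 0 < e ->
  exists h, [/\ continuous h, forall x, `|h x| <= M & dist2 g h < e].
Proof.
move=> mg M0 gM e0.
have Lg : L2 g by exact: (L2_bounded (M := M)).
have ig : mu.-integrable I01 (EFin \o g).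
  apply: (@le_integrable _ _ _ mu I01 mI _ (EFin \o cst M)).
  - exact/measurable_EFinP.
  - by move=> x _ /=; rewrite lee_fin [leRHS]ger0_norm ?gM// ltW.
  - by apply: C01_integrable_oo; exact: C01_cst.
have Ifin : (mu I01 < +oo)%E by rewrite /= lebesgue_measure_itv/= lte_fin ltr01 -EFinB ltry.
have [h_ [ch ih cv]] := approximation_continuous_integrable mI Ifin ig.
have e2M : 0 < e / (2 * M) by rewrite divr_gt0// mulr_gt0.
have i1 n : mu.-integrable I01 (EFin \o (fun x => `|g x - h_ n x|)).
  exact: (integrable_abse (integrableB mI ig (ih n))).
have If n : (\int[mu]_(x in I01) `|(g x - h_ n x)%:E|)%E = (\int[mu]_(x in I01) `|g x - h_ n x|)%:E.
  by rewrite /Rintegral fineK//; have := integrable_fin_num mI (i1 n).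
have [n hn] : exists n, \int[mu]_(x in I01) `|g x - h_ n x| < e / (2 * M).
  move: cv => /fine_cvgP[_ /cvgr_dist_lt /(_ _ e2M) [N _ /(_ N (leqnn N))]].
  rewrite sub0r normrN /= If/= => hN; exists N.
  by apply: le_lt_trans hN; exact: ler_norm.
have MM : - M <= M by rewrite (@le_trans _ _ 0) ?oppr_le0 ?ltW.
pose h x := clamp (- M) M (h_ n x).
have ch' : continuous h.
  move=> x; apply: (@continuous_max R R (cst (- M)) (cst M \min h_ n) x); first exact: cvg_cst.
  by apply: (@continuous_min R R (cst M) (h_ n) x); [exact: cvg_cst|exact: ch].
have hM x : `|h x| <= M by rewrite ler_norml clamp_in.
exists h; split => //.
apply: le_lt_trans (_ : 2 * M * \int[mu]_(x in I01) `|g x - h_ n x| < e); last first.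
  by rewrite mulrC -ltr_pdivlMr// mulr_gt0.
have Lh : L2 h by apply: C01_L2; exact: continuous_C01.
rewrite -RintegralZl//; apply: le_Rint.
- exact: sqr_integrable (L2B Lg Lh).
- exact: (integrableZl mI _ (i1 n)).
move=> x _; rewrite -real_normK ?num_real// expr2.
have d1 : `|g x - h x| <= `|g x - h_ n x|.
  exact: clamp_dist_le.
have d2 : `|g x - h x| <= 2 * M.
  by apply: le_trans (ler_normB _ _) _; have := gM x; have := hM x; lra.
exact: ler_pM.
Qed.

Lemma continuous_primitive h (M : R) : continuous h -> (forall x, `|h x| <= M) ->
  exists F : R -> R, forall x : R, -1 < x < 3 -> is_derive x 1 F (h x).
Proof.
move=> ch hM; exists (fun x => \int[mu]_(t in `[-1, x]) h t) => x /andP[x0 x1].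
have ih : mu.-integrable `[-1, 3] (EFin \o h).
  by apply: continuous_compact_integrable; [exact: segment_compact|exact: continuous_subspaceT].
have [d1 d2] := continuous_FTC1_closed x1 ih x0 (ch x).
by rewrite derive1E in d2; exact: (DeriveDef d1 d2).
Qed.

(** The averages n (F (x + 1/n) - F x), with F a primitive of h, are C^1,
    bounded by M, and converge pointwise to h. *)
Lemma continuous_form_approx (alpha : R) h (M e : R) : 1 <= alpha -> continuous h -> 0 < M ->
  (forall x, `|h x| <= M) -> 0 < e ->
  exists u q, in_form alpha u q /\ dist2 h u < e.
Proof.
move=> alpha_ge1 ch M0 hM e0; have [F dF] := continuous_primitive ch hM.
pose d (n : nat) : R := n.+1%:R^-1.
have d0 n : 0 < d n by rewrite invr_gt0.
have d1 n : d n <= 1 by rewrite invf_le1// ler1n.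
have dS n (x : R) : 0 <= x <= 1 -> is_derive x 1 (fun x : R => F (x + d n) : R) (h (x + d n)).
  move=> /andP[x0 x1]; have d0n := d0 n; have d1n := d1 n.
  have dF' : is_derive (x + d n) 1 F (h (x + d n)) by apply: dF; lra.
  have di : is_derive x 1 (fun x : R => x + d n) (1 : R).
    by apply: is_derive_eq; rewrite addr0.
  have := @is_derive1_comp R F (fun x : R => x + d n) x _ _ dF' di.
  by rewrite mulr1.
pose u n x := n.+1%:R * (F (x + d n) - F x).
have du n (x : R) : 0 <= x <= 1 -> is_derive x 1 (u n) (n.+1%:R * (h (x + d n) - h x)).
  move=> x01; have h1 := dS n x x01.
  have h2 : is_derive x 1 F (h x) by apply: dF; move: x01; lra.
  by apply: is_derive_eq; rewrite /GRing.scale/=; ring.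
have cu n : C01 (u n) by exact: is_derive_within (du n).
have uE n x : 0 <= x <= 1 -> exists2 y, x < y < x + d n & u n x = h y.
  move=> x01; have d0n := d0 n; have d1n := d1 n.
  have [|y|y yx] := @mvt R F h x (x + d n); first by lra.
    by move=> yx; apply: dF; move: x01 yx; lra.
  move=> E; exists y => //; rewrite /u E -[x + d n - x]addrAC subrr add0r mulrCA mulfV ?mulr1//.
pose q n x := x `^ (alpha / 2) * (n.+1%:R * (h (x + d n) - h x)).
have form n : in_form alpha (u n) (q n).
  split => //.
    apply: C01M; first by apply: continuous_powR_C01; rewrite divr_ge0// (le_trans _ alpha_ge1).
    apply: C01Z; apply: C01B; last exact: continuous_C01.
    apply: continuous_C01 => x; apply: (@continuous_comp _ _ _ (fun x => x + d n)); last exact: ch.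
    by apply: cvgD; [exact: cvg_id|exact: cvg_cst].
  move=> x /andP[x0 x1]; have := du n x; rewrite !ltW// => /(_ isT).
  rewrite /q mulrA -powRD; last by apply/implyP => _; rewrite gt_eqF.
  by rewrite addNr powRr0 mul1r.
have uM n x : 0 < x < 1 -> `|u n x - h x| <= 2 * M.
  move=> /andP[x0 x1]; have [|y _ ->] := uE n x; first by rewrite !ltW.
  by apply: le_trans (ler_normB _ _) _; have := hM y; have := hM x; lra.
have cvu x : 0 < x < 1 -> u n x @[n --> \oo] --> h x.
  move=> /andP[x0 x1]; apply/cvgrPdist_lt => r r0.
  have /cvgrPdist_lt/(_ r r0)[t /= t0 ht] := ch x.
  near=> n; have [|y /andP[xy yd] ->] := uE n x; first by rewrite !ltW.
  apply: ht; rewrite /= ltr_norml; suff : d n < t by lra.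
  rewrite /d invf_plt ?posrE//; apply: le_lt_trans (_ : n%:R < _); last by rewrite ltr_nat.
  by near: n; exact: nbhs_infty_ger.
have Lh : L2 h by apply: C01_L2; exact: continuous_C01.
have := dist2_dct (fun n => C01_L2 (cu n)) Lh (C01_L2 (@C01_cst R (2 * M))) uM cvu.
move=> /cvgr_dist_lt /(_ _ e0) [N _ /(_ N (leqnn N))].
rewrite sub0r normrN => hN; exists (u N), (q N); split => //.
by apply: le_lt_trans hN; exact: ler_norm.
Unshelve. all: by end_near. Qed.

Lemma form_dense (alpha : R) f (e : R) : 1 <= alpha -> L2 f -> 0 < e ->
  exists u q, in_form alpha u q /\ dist2 f u < e.
Proof.
move=> alpha_ge1 Lf e0; have e8 : 0 < e / 16 by rewrite divr_gt0.
have [g [M [mg M0 gM fg]]] := L2_truncation Lf e8.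
have [h [ch hM gh]] := bounded_continuous_approx mg M0 gM e8.
have [u [q [uq hu]]] := continuous_form_approx alpha_ge1 ch M0 hM e8.
exists u, q; split => //; have [cu _ _] := uq.
have Lg : L2 g by exact: (L2_bounded (M := M)).
have Lh : L2 h by apply: C01_L2; exact: continuous_C01.
have := dist2_triangle Lf Lg (C01_L2 cu); have := dist2_triangle Lg Lh (C01_L2 cu).
lra.
Qed.

Lemma L2dotC f g : L2dot f g = L2dot g f.
Proof. by rewrite /L2dot; under eq_Rintegral do rewrite mulrC. Qed.

Lemma L2dot_sum f n (F : nat -> R -> R) (b : 'I_n -> R) : L2 f -> (forall i, L2 (F i)) ->
  L2dot f (fun x => \sum_(i < n) b i * F i x) = \sum_(i < n) b i * L2dot f (F i).
Proof.
move=> Lf LF; elim: n b => [|n ih] b.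
  rewrite big_ord0 /L2dot; under eq_Rintegral do rewrite big_ord0 mulr0.
  by rewrite (int01_oo (@C01_cst R 0)) int01_cst.
rewrite big_ord_recr/= -ih.
have Ls : L2 (fun x => \sum_(i < n) b (widen_ord (leqnSn n) i) * F i x).
  by apply: L2_sum => i; exact: L2Z.
rewrite /L2dot -RintegralZl//; last exact: L2_mul.
rewrite -RintegralD//; last 2 first.
- exact: L2_mul.
- exact: (integrableZl mI _ (L2_mul Lf (LF n))).
by apply: eq_Rintegral => x _; rewrite big_ord_recr/=; ring.
Qed.

Lemma dist2E f g : L2 f -> L2 g ->
  dist2 f g = L2dot f f - 2 * L2dot f g + L2dot g g.
Proof.
move=> Lf Lg; have i1 := L2_mul Lf Lf; have i2 := L2_mul Lf Lg; have i3 := L2_mul Lg Lg.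
have z2 := integrableZl mI 2 i2.
rewrite /L2dot -RintegralZl// -RintegralB// -RintegralD//; last exact: (integrableB mI i1 z2).
by apply: eq_Rintegral => x _; ring.
Qed.

(** Expanding the square, the distance to a combination exceeds the distance
    to the orthonormal expansion by the sum of the squared differences of the
    coefficients. *)
Lemma best_approx f (e : nat -> R -> R) n (b : 'I_n -> R) :
  (forall i, L2 (e i)) -> (forall i k, L2dot (e i) (e k) = (i == k)%:R) -> L2 f ->
  dist2 f (fun x => \sum_(i < n) L2dot f (e i) * e i x) <=
  dist2 f (fun x => \sum_(i < n) b i * e i x).
Proof.
move=> Le oe Lf.
have Ls (a : 'I_n -> R) : L2 (fun x => \sum_(i < n) a i * e i x).
  by apply: L2_sum => i; exact: L2Z.
have key (a : 'I_n -> R) : dist2 f (fun x => \sum_(i < n) a i * e i x) =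
    L2dot f f + \sum_(i < n) (a i ^+ 2 - 2 * (a i * L2dot f (e i))).
  rewrite dist2E// L2dot_sum// L2dot_sum// big_split/= sumrN mulr_sumr.
  rewrite -!addrA; congr (_ + _); rewrite addrC; congr (_ - _).
  apply: eq_bigr => i _; rewrite L2dotC L2dot_sum// (bigD1 i)//= oe eqxx mulr1 big1 ?addr0 ?expr2//.
  by move=> k ki; rewrite oe eq_sym (negPf (ki : (k : nat) != i)) mulr0.
rewrite !key lerD2l; apply: ler_sum => i _.
have := sqr_ge0 (b i - L2dot f (e i)); nra.
Qed.

Lemma L2norm_dist2 f g : L2 f -> L2 g ->
  L2norm (fun x => f x - g x) = (Num.sqrt (dist2 f g))%:E.
Proof.
move=> Lf Lg; rewrite L2normE.
have -> : (\int[mu]_(x in `]0%R, 1%R[) ((f x - g x) ^+ 2)%:E)%E = (dist2 f g)%:E.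
  by rewrite /dist2 /Rintegral fineK//; have := integrable_fin_num mI (sqr_integrable (L2B Lf Lg)).
rewrite poweR_EFin powR12_sqrt//; apply: Rintegral_ge0 => x _; exact: sqr_ge0.
Qed.
End L2theory.

(** * The eigenfunctions form an orthonormal basis *)

Section Basis.
Variables (R : realType) (alpha : R).
Hypotheses (alpha_ge1 : 1 <= alpha) (alpha_lt2 : alpha < 2).
Implicit Types (f u : R -> R).
Notation phi := (phi alpha).
Notation nphi := (nphi alpha).
Notation e := (eigfun alpha).

Lemma eigfun_dist2 f n (a : 'I_n -> R) :
  dist2 f (fun x => \sum_(i < n) a i * Num.sqrt (nphi i) * e i x) = dist2 f (comb alpha a).
Proof.
apply: eq_Rintegral => x; rewrite inE/= in_itv/= => /andP[x0 _].
congr ((_ - _) ^+ 2); apply: eq_bigr => i _; rewrite eigfunE// mulrA mulfK//.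
by rewrite sqrtr_eq0 -ltNge nphi_gt0.
Qed.

Lemma L2_eigfun n : L2 (e n).
Proof.
have cp : C01 (phi n) by exact: C01_phi.
have /L2P[mp ip] := L2Z (Num.sqrt (nphi n))^-1 (C01_L2 cp).
apply/L2P; split.
  by apply: eq_measurable_fun mp => x; rewrite inE/= in_itv/= => /andP[x0 _]; rewrite eigfunE.
apply: eq_integrable ip => // x; rewrite inE/= in_itv/= => /andP[x0 _].
by rewrite /= eigfunE.
Qed.

Lemma eigfun_orthonormal m n : L2dot (e m) (e n) = (m == n)%:R.
Proof.
have cp k : C01 (phi k) by exact: C01_phi.
have -> : L2dot (e m) (e n) =
    (Num.sqrt (nphi m))^-1 * (Num.sqrt (nphi n))^-1 * int01 (fun x => phi m x * phi n x).
  rewrite -int01Z; last exact: (C01M (cp m) (cp n)).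
  rewrite -int01_oo; last by apply: C01Z; exact: (C01M (cp m) (cp n)).
  apply: eq_Rintegral => x; rewrite inE/= in_itv/= => /andP[x0 _].
  by rewrite !eigfunE// mulrACA.
have [<-|mn] := eqVneq m n; last by rewrite phi_orthogonal// mulr0.
rewrite -invfM -expr2 sqr_sqrtr ?mulVf//; first by rewrite gt_eqF// nphi_gt0.
by rewrite ltW// nphi_gt0.
Qed.

Theorem eigfun_basis : orthonormal_basis e.
Proof.
split; [exact: L2_eigfun|exact: eigfun_orthonormal|move=> f Lf].
have Ls n : L2 (fun x => \sum_(k < n) L2dot f (e k) * e k x).
  by apply: L2_sum => i; apply: L2Z; exact: L2_eigfun.
under eq_fun do rewrite L2norm_dist2//.
apply: cvg_EFin; first by near=> n.
rewrite -[X in _ --> X]sqrtr0.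
pose D n := dist2 f (fun x => \sum_(k < n) L2dot f (e k) * e k x).
suff D0 : D n @[n --> \oo] --> (0 : R).
  exact: (@cvg_comp _ _ _ D (@Num.sqrt R) _ _ _ D0 (@sqrt_continuous R 0)).
rewrite {}/D; apply/cvgrPdist_lt => r r0.
have r4 : 0 < r / 4 by rewrite divr_gt0.
have [u [q [uq fu]]] := form_dense alpha_ge1 Lf r4; have [cu _ _] := uq.
have /cvgrPdist_lt/(_ _ r4) := residual_cvg0 alpha_ge1 alpha_lt2 uq.
apply: filterS => n; rewrite sub0r normrN => hn; rewrite sub0r normrN ger0_norm; last first.
  by apply: Rintegral_ge0 => x _; exact: sqr_ge0.
move: hn; set a := (fun i : 'I_n => _) => hn.
apply: le_lt_trans (best_approx (fun i => a i * Num.sqrt (nphi i)) L2_eigfun eigfun_orthonormal Lf) _.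
rewrite eigfun_dist2.
have [cc _ _] := in_form_comb alpha_ge1 alpha_lt2 a.
have := dist2_triangle Lf (C01_L2 cu) (C01_L2 cc).
rewrite (dist2_int01 cu cc); have := ler_norm (int01 (fun x => (u x - comb alpha a x) ^+ 2)).
move: hn fu; lra.
Unshelve. all: by end_near. Qed.
End Basis.

(** * Regularity of weak solutions *)

Section Regularity.
Variable R : realType.
Implicit Types (a b d s x K : R) (f g h u : R -> R).
Notation mu := (@lebesgue_measure R).
Notation I01 := (`]0, 1[%classic : set R).

Lemma near_in_itv a b (x : R) : a < x -> x < b -> \forall y \near x, a < y < b.
Proof.
move=> ax xb; near=> y; apply/andP; split; near: y.
  exact: lt_nbhsr.
exact: lt_nbhsl.
Unshelve. all: by end_near. Qed.

Lemma ae_mono (P Q : R -> Prop) : (forall x, P x -> Q x) ->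
  {ae mu, forall x, P x} -> {ae mu, forall x, Q x}.
Proof. by move=> PQ; apply: negligibleS => x nQ Px; apply: nQ; exact: PQ. Qed.

Lemma powRNM s x : 0 < x -> x `^ (- s) * x `^ s = 1.
Proof. by move=> x0; rewrite powRN mulVf// gt_eqF// powR_gt0. Qed.

(** An absolutely continuous function whose derivative agrees almost
    everywhere with a continuous function is an integral of the latter, so it
    is differentiable everywhere. *)
Lemma AC_is_derive a b f h : a < b -> seqAC a b f -> continuous h ->
  {ae mu, forall x, a < x < b -> derive1 f x = h x} ->
  forall x : R, a < x < b -> is_derive x 1 f (h x).
Proof.
move=> ab acf ch fh x /andP[ax xb].
have mh : measurable_fun (`]a, b]%classic : set (measurableTypeR R)) h.
  by apply: measurable_funTS; exact: continuous_measurable_fun.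
have FTC := seqAC_FTC ab acf mh fh.
have ih : mu.-integrable `]a, b] (EFin \o h).
  apply: (@integrableS _ _ _ mu `[a, b]); [exact: measurable_itv|exact: measurable_itv| |].
    by apply: subset_itvr; rewrite bnd_simp.
  by apply: continuous_compact_integrable; [exact: segment_compact|exact: continuous_subspaceT].
have axb : (BRight a < BRight x)%O by rewrite bnd_simp.
have [d1 d2] := @continuous_FTC1 R h (BRight a) x b xb ih axb (ch x).
rewrite derive1E in d2; have dF := DeriveDef d1 d2.
have dFa : is_derive x 1 ((fun x => \int[mu]_(t in `]a, x]) h t) + cst (f a)) (h x + 0).
  by apply: is_deriveD.
rewrite addr0 in dFa; apply: near_eq_is_derive dFa.
apply: filterS (near_in_itv ax xb) => y /andP[ay yb] /=.
by rewrite /GRing.add/= -FTC ?ltW// subrK.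
Qed.

(** A lower bound K/x near 0 forces the integral of u^2 over ]e, 2 e[ to be at
    least K^2/(4 e), which is unbounded as e tends to 0. *)
Lemma L2_not_inverse u K d : L2 u -> 0 < K -> 0 < d ->
  ~ (forall x, 0 < x < d -> K <= x * `|u x|).
Proof.
move=> Lu K0 d0 uK; have iu := sqr_integrable Lu.
pose I := \int[mu]_(x in I01) (u x ^+ 2).
have I0 : 0 <= I by apply: Rintegral_ge0 => x _; exact: sqr_ge0.
(* small enough for ]e, 2 e[ to lie in (0, d) and in (0,1), and for K^2/(4 e)
   to exceed I *)
pose e := Num.min (Num.min (d / 4) 4^-1) (K ^+ 2 / (4 * (I + 1))).
have I1 : 0 < 4 * (I + 1) by rewrite mulr_gt0// ltr_wpDl.
have e0 : 0 < e by rewrite !lt_min invr_gt0 ltr0n divr_gt0 ?divr_gt0 ?exprn_gt0.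
have ed : e <= d / 4 by rewrite !ge_min lexx.
have e1 : e <= 4^-1 by rewrite !ge_min lexx orbT.
have eK : e * (4 * (I + 1)) <= K ^+ 2 by rewrite -ler_pdivlMr// !ge_min lexx !orbT.
have sub : `]e, 2 * e[%classic `<=` I01.
  by apply: subset_itv; rewrite bnd_simp; [rewrite ltW|lra].
have mI : measurable (`]0, 1[%classic : set (measurableTypeR R)) by exact: measurable_itv.
have me : measurable (`]e, 2 * e[%classic : set (measurableTypeR R)) by exact: measurable_itv.
have i2 : mu.-integrable `]e, 2 * e[ (EFin \o (fun x => u x ^+ 2)).
  exact: integrableS iu.
pose m := (K / (2 * e)) ^+ 2.
have e20 : 0 < 2 * e by rewrite mulr_gt0.
have : \int[mu]_(x in `]e, 2 * e[) m <= \int[mu]_(x in `]e, 2 * e[) (u x ^+ 2).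
  apply: le_Rintegral => //.
    by apply: integrableS (C01_integrable_oo (@C01_cst R m)).
  move=> x; rewrite /= in_itv/= => /andP[ex xe].
  have := uK x; have -> : 0 < x < d by lra.
  move=> /(_ isT) Kx; rewrite /m -[leRHS]real_normK ?num_real//.
  have K2 : 0 <= K / (2 * e) by rewrite ltW// divr_gt0.
  rewrite ler_pXn2r// ler_pdivrMr//; apply: le_trans Kx _; rewrite mulrC ler_wpM2l// ltW//.
have -> : \int[mu]_(x in `]e, 2 * e[) m = m * e.
  rewrite Rintegral_cst//= lebesgue_measure_itv/= lte_fin.
  have -> : e < 2 * e by lra.
  by rewrite -EFinB/=; congr (_ * _); ring.
have : \int[mu]_(x in `]e, 2 * e[) (u x ^+ 2) <= I.
  rewrite /I /Rintegral fine_le//.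
  - by have := integrable_fin_num me i2.
  - by have := integrable_fin_num mI iu.
  - apply: ge0_subset_integral => //; first by have /integrableP[] := iu.
    by move=> x _; rewrite lee_fin sqr_ge0.
have -> : m * e = K ^+ 2 / (4 * e) by rewrite /m; field; rewrite gt_eqF.
move=> h1 h2; have := le_trans h2 h1; rewrite ler_pdivrMr ?mulr_gt0//.
have := eK; have := mulr_ge0 (ltW e0) I0; nra.
Qed.

Lemma lipschitz_abs_continuous a b f K : 0 < K ->
  (forall x y, a <= x -> x < y -> y <= b -> `|f y - f x| <= K * (y - x)) ->
  abs_continuous a b f.
Proof.
move=> K0 fK e e0; exists (e / K); first by rewrite divr_gt0.
move=> n s t st _; rewrite ltr_pdivlMr// => sd.
apply: le_lt_trans sd; rewrite mulr_suml; apply: ler_sum => i _.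
have [as_ [+ tb]] := st i; rewrite le_eqVlt => /predU1P[->|lt].
  by rewrite !subrr normr0 mul0r.
by rewrite mulrC; exact: fK.
Qed.

Lemma eq_L2 f g : (forall x, 0 < x < 1 -> f x = g x) -> L2 f -> L2 g.
Proof.
move=> fg /L2P[mf jf]; apply/L2P; split.
  by apply: eq_measurable_fun mf => x; rewrite inE/= in_itv/=; exact: fg.
by apply: eq_integrable jf => // x; rewrite inE/= in_itv/= => x01; rewrite /= fg.
Qed.
End Regularity.

(** * The eigenvalue problem *)

Section EigenProblem.
Variables (R : realType) (alpha : R).
Hypotheses (alpha_ge1 : 1 <= alpha) (alpha_lt2 : alpha < 2).
Implicit Types (lambda m x y : R) (u v w z : R -> R).
Notation c := (nu alpha + 1).
Notation k := (kappa alpha).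
Notation sol := (sol alpha).
Notation solq := (solq alpha).
Notation solflux := (solflux alpha).
Notation ev := (eigval alpha).

Let nu0 : 0 <= nu alpha. Proof. exact: nu_ge0. Qed.
Let c1 : 1 <= c. Proof. by rewrite lerDr. Qed.
Let c0 : 0 <= c. Proof. by rewrite addr_ge0. Qed.
Let k0 : 0 < k. Proof. exact: kappa_gt0. Qed.

Lemma bessel_zero_complete m y : 1 <= m -> 0 < y -> bes (m + 1) y = 0 ->
  exists n, y = bessel_zero m n.
Proof.
move=> m1 y0 by0; have m0 : 0 <= m by apply: le_trans m1.
have [N yN] : exists N, y < bessel_zero m N.
  have /cvgryPgt/(_ y)[N _ /(_ N (leqnn N)) yN] := bessel_zero_pinfty m0 m1.
  by exists N.
elim: N yN => [|n ih] yn.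
  by have := lt_trans yn y0; rewrite ltxx.
case: (ltgtP y (bessel_zero m n)) => [|ny|E]; [exact: ih| |by exists n].
have := @bessel_zero_consecutive _ m m0 n y.
by rewrite ny yn => /(_ isT); rewrite by0 eqxx.
Qed.

(** Green's formula for sol lambda against itself: its energy is lambda times
    its squared norm. *)
Lemma sol_energy lambda : solflux lambda 1 = 0 -> 0 <= lambda.
Proof.
move=> s1; have := green alpha_ge1 alpha_lt2 lambda (in_form_sol alpha_ge1 alpha_lt2 lambda).
rewrite s1 mulr0 addr0 => E.
have cs : C01 (sol lambda) by exact: C01_sol.
have S0 : 0 < int01 (fun x => sol lambda x * sol lambda x).
  apply: int01_gt0; first exact: (C01M cs cs).
    by move=> x _; rewrite -expr2 sqr_ge0.
  by rewrite sol0// mulr1 ltr01.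
have : 0 <= int01 (fun x => solq lambda x * solq lambda x).
  by apply: int01_ge0 => x _; rewrite -expr2 sqr_ge0.
by rewrite E pmulr_lge0.
Qed.

(** A negative lambda is excluded by the energy; for lambda > 0 the flux at 1
    is a nonzero multiple of the Bessel function of order nu + 1 at sqrt
    lambda / kappa. *)
Lemma eigval_complete lambda : solflux lambda 1 = 0 -> exists n, lambda = ev n.
Proof.
move=> s1; have := sol_energy s1; rewrite le_eqVlt => /predU1P[<-|l0]; first by exists 0.
pose y := Num.sqrt lambda / k.
have y0 : 0 < y by rewrite divr_gt0// sqrtr_gt0.
have ly : lambda = k ^+ 2 * y ^+ 2.
  have kn0 : k != 0 by rewrite gt_eqF.
  by rewrite -exprMn [k * y]mulrC /y divfK// sqr_sqrtr// ltW.
have by0 : bes (c + 1) y = 0.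
  move: s1; rewrite /solflux mulr1 => /eqP; rewrite mulf_eq0 oppr_eq0 (gt_eqF l0)/= => /eqP.
  suff -> : sol_arg alpha lambda 1 = y ^+ 2 / 4 by [].
  rewrite /sol_arg powR1 mulr1 ly; move: (kappa alpha) k0 => t t0; field.
  by rewrite gt_eqF.
have [n yn] := bessel_zero_complete c1 y0 by0.
by exists n; rewrite ly yn eigvalE.
Qed.

Lemma sol_pos_near0 lambda : exists2 d, 0 < d < 1 & forall x, 0 < x < d -> 0 < sol lambda x.
Proof.
have /(continuous_within_itvP _ ltr01)[_ s0 _] : C01 (sol lambda) by exact: C01_sol.
have : \forall x \near 0^'+, 0 < sol lambda x.
  by apply: (cvgr_gt _ s0); rewrite sol0// ltr01.
move=> [d /= d0 h]; exists (Num.min d 2^-1).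
  by rewrite lt_min d0 invr_gt0 ltr0n/= gt_min; apply/orP; right; lra.
move=> x /andP[x0]; rewrite lt_min => /andP[xd _]; apply: h => //=.
by rewrite sub0r normrN gtr0_norm.
Qed.

(** The second-order equation as a first-order system for u and its flux v,
    which needs no second derivative. *)
Definition solves lambda u v := forall x, 0 < x < 1 ->
  is_derive x 1 u (x `^ (- alpha) * v x) /\ is_derive x 1 v (- lambda * u x).

Lemma solves_sol lambda : solves lambda (sol lambda) (solflux lambda).
Proof.
move=> x /andP[x0 _]; split; [exact: is_derive_sol_flux|exact: is_derive_solflux].
Qed.

Lemma solves_comb lambda (a : R) u v w z : solves lambda u v -> solves lambda w z ->
  solves lambda (fun x => u x - a * w x) (fun x => v x - a * z x).
Proof.
move=> uv wz x x01; have [du dv] := uv x x01; have [dw dz] := wz x x01.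
by split; apply: is_derive_eq; rewrite /GRing.scale/=; ring.
Qed.

Lemma solves_unique lambda u v x0 : 0 < x0 < 1 -> solves lambda u v ->
  u x0 = 0 -> v x0 = 0 -> forall x, 0 < x < 1 -> u x = 0 /\ v x = 0.
Proof.
move=> x01 uv ux0 vx0 x xx.
pose a := Num.min x x0; pose b := Num.max x x0.
have a0 : 0 < a by rewrite lt_min; move: x01 xx => /andP[-> _] /andP[->].
have b1 : b < 1 by rewrite gt_max; move: x01 xx => /andP[_ ->] /andP[_ ->].
have inab t : a <= t <= b -> 0 < t < 1.
  by move=> /andP[az zb]; rewrite (lt_le_trans a0 az) (le_lt_trans zb b1).
apply: (@linear_system_unique R (fun x => x `^ (- alpha)) (fun=> - lambda) u v
  (a `^ (- alpha) + `|lambda|) a b x0 _ _ _ _ _ _ ux0 vx0 x).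
- by rewrite /a /b ge_min le_max !lexx !orbT.
- by rewrite addr_ge0// powR_ge0.
- by move=> t /inab /uv[].
- by move=> t /inab /uv[].
- move=> t /andP[az zb]; rewrite ger0_norm ?powR_ge0// ler_wpDr//.
  rewrite !powRN lef_pV2 ?posrE ?powR_gt0 ?(lt_le_trans a0 az)//.
  apply: ge0_ler_powR => //; first exact: le_trans alpha_ge1.
    by rewrite nnegrE ltW.
  by rewrite nnegrE (le_trans (ltW a0)).
- by move=> z _; rewrite normrN ler_wpDl// powR_ge0.
- by rewrite /a /b ge_min le_max !lexx.
Qed.

Lemma wronskian_constant lambda u v w z : solves lambda u v -> solves lambda w z ->
  exists W, forall x, 0 < x < 1 -> u x * z x - v x * w x = W.
Proof.
move=> uv wz; pose F x := u x * z x - v x * w x.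
have dF x : 0 < x < 1 -> is_derive x 1 F 0.
  move=> x01; have [du dv] := uv x x01; have [dw dz] := wz x x01.
  by apply: is_derive_eq; rewrite /GRing.scale/=; ring.
have key x y : 0 < x -> x < y -> y < 1 -> F x = F y.
  move=> x0 xy y1; have [|t _] := @mvt R F (fun=> 0) x y xy.
    by move=> t /andP[xt ty]; apply: dF; rewrite (lt_le_trans x0 xt) (le_lt_trans ty y1).
  by rewrite mul0r => /eqP; rewrite subr_eq0 => /eqP.
exists (F 2^-1) => x /andP[x0 x1].
have [xh|xh|->//] := ltgtP x 2^-1; first by apply: key => //; lra.
by apply/esym; apply: key => //; lra.
Qed.

(** The Wronskian with the regular solution is constant. Near 0 the flux of
    the regular solution is O(x) and v tends to 0, so a nonzero Wronskian
    would make u at least of order 1/x, against square integrability. A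
    vanishing Wronskian makes u and v proportional to the regular solution and
    its flux at one point, hence everywhere by uniqueness. *)
Lemma L2_solution_multiple lambda u v : solves lambda u v -> L2 u ->
  v x @[x --> 0^'+] --> 0 ->
  exists a, forall x, 0 < x < 1 -> u x = a * sol lambda x /\ v x = a * solflux lambda x.
Proof.
move=> uv Lu v0; have ss := solves_sol lambda.
have [W WE] := wronskian_constant uv ss.
have cs : C01 (sol lambda) by exact: C01_sol.
have W0 : W = 0.
  apply/eqP/negPn/negP => Wn0; have {}Wn0 : 0 < `|W| by rewrite normr_gt0.
  have [Ms Ms0 sM] := C01_bounded cs.
  have [Mh Mh0 hM] : exists2 M, 0 < M & forall x, 0 <= x <= 1 -> `|solflux lambda x| <= M * x.
    have ch : C01 (fun x => - lambda * hyp (c + 1) (sol_arg alpha lambda x)).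
      apply: C01Z.
      have c11 : 1 <= c + 1 by rewrite (le_trans c1)// lerDl.
      exact (@C01_comp R (sol_arg alpha lambda) (hyp (c + 1)) (continuous_hyp c11)
        (@C01_sol_arg R alpha alpha_lt2 lambda)).
    have [M M0 hM] := C01_bounded ch; exists M => // x /[dup] x01 /andP[x0 _].
    by rewrite /solflux mulrAC normrM (ger0_norm x0) ler_wpM2r// hM.
  (* where |v| is below this bound, the term v * sol takes at most half of |W|
     *)
  have e0 : 0 < `|W| / (2 * Ms) by rewrite divr_gt0// mulr_gt0.
  have /cvgrPdist_lt/(_ _ e0)[d /= d0 hd] := v0.
  have d'0 : 0 < Num.min d 1 by rewrite lt_min d0 ltr01.
  have K0 : 0 < `|W| / (2 * Mh) by rewrite divr_gt0// mulr_gt0.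
  apply: (L2_not_inverse Lu K0 d'0) => x /andP[x0]; rewrite lt_min => /andP[xd x1].
  have := hd x; rewrite /= !sub0r !normrN gtr0_norm// => /(_ xd x0).
  rewrite ltr_pdivlMr ?mulr_gt0// => hv.
  have x01 : 0 <= x <= 1 by rewrite !ltW.
  have := WE x; rewrite x0 x1 => /(_ isT) E.
  have h1 := sM x x01; have h2 := hM x x01.
  have : `|W| <= `|u x| * `|solflux lambda x| + `|v x| * `|sol lambda x|.
    by rewrite -E -!normrM ler_normB.
  have := ler_wpM2l (normr_ge0 (u x)) h2; have := ler_wpM2l (normr_ge0 (v x)) h1.
  rewrite ler_pdivrMr ?mulr_gt0//; nra.
have [d /andP[d0 d1] sd] := sol_pos_near0 lambda.
pose x0 := d / 2; have x00 : 0 < x0 by rewrite divr_gt0.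
have x0d : x0 < d by rewrite /x0; lra.
have x01 : 0 < x0 < 1 by rewrite x00 (lt_trans x0d d1).
have sx0 : sol lambda x0 != 0 by rewrite gt_eqF// sd// x00 x0d.
exists (u x0 / sol lambda x0) => x xx.
have := solves_unique x01 (solves_comb (u x0 / sol lambda x0) uv ss).
rewrite divfK// subrr => /(_ erefl) h.
have := WE x0 x01; rewrite W0 => /eqP; rewrite subr_eq0 => /eqP E.
have [|h1 h2] := h _ x xx.
  by apply/eqP; rewrite subr_eq0; apply/eqP; rewrite mulrAC E mulfK.
by split; apply/eqP; rewrite -subr_eq0; apply/eqP.
Qed.

(** The flux agrees almost everywhere with an absolutely continuous function
    v. Then the derivative of u agrees almost everywhere with x^(-alpha) v, so
    u is C^1 and its flux is v everywhere in (0,1); the equation now makes v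
    continuously differentiable in the same way. *)
Lemma eigen_solution_regular lambda u : eigen_solution alpha lambda u ->
  exists v, [/\ solves lambda u v, v x @[x --> 0^'+] --> 0 & u x @[x --> 1^'-] --> u 1].
Proof.
move=> [[[[Lu acu _] [v [acv uv _]]] _] eqn u0 _].
have sv := abs_continuous_seq acv.
have su a : 0 < a -> a < 1 -> seqAC a 1 u.
  by move=> a0 a1; apply: abs_continuous_seq; exact: acu.
have du x : 0 < x < 1 -> is_derive x 1 u (x `^ (- alpha) * v x).
  move=> /andP[x0 x1]; pose a := x / 2.
  have a0 : 0 < a by rewrite divr_gt0.
  have ax : a < x by rewrite /a; lra.
  (* a continuous function on the line that equals the derivative of u on (a,
     1) *)
  pose h y := Num.max a y `^ (- alpha) * v (clamp 0 1 y).
  have ch : continuous h.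
    move=> y; apply: cvgM; last exact: (seqAC_clamp_continuous ler01 sv).
    apply: (@continuous_comp _ _ _ (fun y => Num.max a y) (fun t => t `^ (- alpha)) y).
      by apply: (@continuous_max R R (cst a) id y); [exact: cvg_cst|exact: cvg_id].
    by apply: continuous_powR_gt0; rewrite lt_max a0.
  have hE y : a < y < 1 -> h y = y `^ (- alpha) * v y.
    move=> /andP[ay y1]; rewrite /h clamp_id ?max_r ?ltW// ?(lt_trans a0)//.
  have := AC_is_derive (lt_trans ax x1) (su a a0 (lt_trans ax x1)) ch _.
  move=> /(_ _ x); rewrite hE ax x1//; apply => //.
  apply: ae_mono uv => y; rewrite in_itv/= => yv /[dup] ay1 /andP[ay y1].
  by have y0 := lt_trans a0 ay; rewrite hE// -yv ?y0// /flux mulrA powRNM// mul1r.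
have fluxE x : 0 < x < 1 -> flux alpha u x = v x.
  move=> x01; rewrite /flux derive1E; have [_ ->] := du x x01.
  by have /andP[x0 _] := x01; rewrite mulrA [X in X * _]mulrC powRNM// mul1r.
have dflux x : 0 < x < 1 -> derive1 (flux alpha u) x = derive1 v x.
  move=> /andP[x0 x1]; rewrite !derive1E; apply: near_eq_derive.
  by apply: filterS (near_in_itv x0 x1) => y; exact: fluxE.
exists v; split.
- move=> x x01; split; first exact: du.
  have /andP[x0 x1] := x01; pose a := x / 2.
  have a0 : 0 < a by rewrite divr_gt0.
  have ax : a < x by rewrite /a; lra.
  have a1 := lt_trans ax x1.
  pose h y := - lambda * u (clamp a 1 y).
  have ch : continuous h.
    move=> y; apply: cvgM; first exact: cvg_cst.
    exact: (seqAC_clamp_continuous (ltW a1) (su a a0 a1)).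
  have hE y : a < y < 1 -> h y = - lambda * u y.
    by move=> /andP[ay y1]; rewrite /h clamp_id ?ltW.
  have := AC_is_derive a1 (seqAC_sub (ltW a0) (lexx 1) sv) ch _.
  move=> /(_ _ x); rewrite hE ax x1//; apply => //.
  apply: ae_mono eqn => y; rewrite in_itv/= => yv /[dup] ay1 /andP[ay y1].
  have y0 := lt_trans a0 ay; rewrite hE// -dflux ?y0//.
  by rewrite mulNr -yv ?y0// opprK.
- apply: cvg_trans u0; apply: near_eq_cvg; near=> x; apply: fluxE.
  by apply/andP; split; near: x; [exact: nbhs_right_gt|exact: nbhs_right_lt].
- have h0 : 0 < 2^-1 :> R by rewrite invr_gt0.
  have h1 : 2^-1 < 1 :> R by lra.
  have := cvg_at_left_filter (seqAC_clamp_continuous (ltW h1) (su _ h0 h1) (x := 1)).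
  rewrite /= clamp_id ?lexx ?ltW//; apply: cvg_trans; apply: near_eq_cvg; near=> x.
  rewrite clamp_id//; apply/andP; split; apply: ltW.
    by near: x; exact: nbhs_left_gt.
  by near: x; exact: nbhs_left_lt.
Unshelve. all: by end_near. Qed.

Lemma solflux_cvg_end lambda (a : R) :
  x `^ (- alpha) * (a * solflux lambda x) @[x --> 1^'-] --> a * solflux lambda 1.
Proof.
apply: cvg_at_left_filter.
have -> : a * solflux lambda 1 = 1 `^ (- alpha) * (a * solflux lambda 1).
  by rewrite powR1 mul1r.
apply: cvgM; first exact: continuous_powR_gt0.
apply: cvgM; first exact: cvg_cst.
exact: (is_derive_continuous (is_derive_solflux alpha_ge1 alpha_lt2 lambda ltr01)).
Qed.

Lemma eigen_solution_eigfun lambda u : eigen_solution alpha lambda u ->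
  exists n rho, [/\ rho != 0, lambda = ev n
    & forall x, x \in `]0, 1] -> u x = rho * eigfun alpha n x].
Proof.
move=> /[dup] /eigen_solution_regular[v [uv v0 u1]] [[[[Lu _ _] _] [y + uy]] _ _ du1].
rewrite in_itv/= => y01.
have [a aE] := L2_solution_multiple uv Lu v0.
have an0 : a != 0.
  by apply: contraNneq uy => a0; have [-> _] := aE y y01; rewrite a0 mul0r.
have in01 : \forall x \near (1 : R)^'-, 0 < x < 1.
  by near=> x; apply/andP; split; near: x; [exact: nbhs_left_gt|exact: nbhs_left_lt].
have s1 : solflux lambda 1 = 0.
  apply: (mulfI an0); rewrite mulr0.
  apply: (@cvg_unique _ (@Rhausdorff R) _ _ _ _ (@solflux_cvg_end lambda a)).
  apply: cvg_trans du1; apply: near_eq_cvg; apply: filterS in01 => x x01.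
  by rewrite derive1E; have [[_ ->] _] := uv x x01; have [_ ->] := aE x x01.
have [n ln] := eigval_complete s1.
have sn0 : Num.sqrt (nphi alpha n) != 0 by rewrite sqrtr_eq0 -ltNge nphi_gt0.
exists n, (a * Num.sqrt (nphi alpha n)); split => //; first by rewrite mulf_neq0.
move=> x; rewrite in_itv/= => /andP[x0]; rewrite eigfunE// mulrA mulfK// /phi -ln.
rewrite le_eqVlt => /predU1P[->|x1]; last by have [|-> _] := aE x; rewrite ?x0.
apply: (@cvg_unique _ (@Rhausdorff R) _ _ _ _ u1).
have : a * sol lambda t @[t --> 1^'-] --> a * sol lambda 1.
  apply: cvg_at_left_filter; apply: cvgM; first exact: cvg_cst.
  exact: (is_derive_continuous (is_derive_sol_flux alpha_ge1 alpha_lt2 lambda ltr01)).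
apply: cvg_trans; apply: near_eq_cvg; apply: filterS in01 => t t01.
by have [-> _] := aE t t01.
Unshelve. all: by end_near. Qed.

(** On (0,1) the function and its flux are multiples of the regular solution
    and its flux; they are Lipschitz, away from 0 and on [0, 1] respectively,
    by the mean value theorem. *)
Lemma eigfun_eigen_solution n rho u : rho != 0 ->
  (forall x, x \in `]0, 1] -> u x = rho * eigfun alpha n x) ->
  eigen_solution alpha (ev n) u.
Proof.
move=> rho0 uE; pose s := (Num.sqrt (nphi alpha n))^-1; pose r := rho * s.
have s0 : s != 0 by rewrite invr_eq0 sqrtr_eq0 -ltNge nphi_gt0.
have r0 : r != 0 by rewrite mulf_neq0.
pose p := sol (ev n); pose z := solflux (ev n).
have uP x : 0 < x <= 1 -> u x = r * p x.
  by move=> /[dup] x01 /andP[x0 _]; rewrite uE ?in_itv// eigfunE// mulrA.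
have uP' x : 0 < x < 1 -> u x = r * p x.
  by move=> /andP[x0 x1]; rewrite uP// x0 ltW.
have cp : C01 p by exact: C01_sol.
have cq : C01 (solq (ev n)) by exact: C01_solq.
have cz : C01 z by exact: C01_solflux.
have dp x : 0 < x -> is_derive x 1 p (x `^ (- alpha) * z x) by exact: is_derive_sol_flux.
have dz x : 0 < x -> is_derive x 1 z (- ev n * p x) by exact: is_derive_solflux.
have du x : 0 < x < 1 -> derive1 u x = x `^ (- alpha) * (r * z x).
  move=> /andP[x0 x1]; rewrite derive1E (@near_eq_derive _ _ _ u (fun x => r * p x)).
    by have dpx := dp x x0; apply: derive_val; apply: is_derive_eq; rewrite /GRing.scale/=; ring.
  by apply: filterS (near_in_itv x0 x1) => y; exact: uP'.
have fluxE x : 0 < x < 1 -> flux alpha u x = r * z x.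
  move=> /[dup] x01 /andP[x0 _].
  by rewrite /flux du// mulrA [X in X * _]mulrC powRNM// mul1r.
have drz x : 0 < x < 1 -> is_derive x 1 (fun x => r * z x) (- ev n * u x).
  move=> /[dup] x01 /andP[x0 _]; have dzx := dz x x0.
  by apply: is_derive_eq; rewrite uP'// /GRing.scale/=; ring.
have Lp (a : R) : L2 (fun x => a * p x) by apply: L2Z; exact: C01_L2.
split.
- split; last first.
    have [d /andP[d0 d1] pd] := sol_pos_near0 (ev n).
    have d2 : 0 < d / 2 by rewrite divr_gt0.
    exists (d / 2); first by rewrite in_itv/= d2/=; lra.
    rewrite uP' ?d2/=; last by lra.
    by rewrite mulf_neq0// gt_eqF// pd// d2/=; lra.
  split; first split.
  + by apply: eq_L2 (Lp r) => x x01; rewrite uP'.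
  + move=> a b a0 ab b1; have [M M0 zM] := C01_bounded cz.
    have a1 : 0 < a `^ (- alpha) by exact: powR_gt0.
    have K0 : 0 < `|r| * (a `^ (- alpha) * M) by rewrite !mulr_gt0// normr_gt0.
    apply: (lipschitz_abs_continuous K0) => x y ax xy yb.
    have x0 := lt_le_trans a0 ax.
    rewrite !uP; last 2 first.
    * by rewrite x0 (le_trans (ltW xy))// (le_trans yb).
    * by rewrite (lt_trans x0 xy) (le_trans yb).
    have [|t /andP[xt ty] E] := @mvt R p (fun x => x `^ (- alpha) * z x) x y xy.
      by move=> t /andP[xt _]; apply: dp; exact: lt_le_trans xt.
    have t0 := lt_trans x0 xt.
    rewrite -mulrBr E (normrM r) (normrM _ (y - x)) (normrM (t `^ _)) [`|y - x|]gtr0_norm ?subr_gt0// mulrA.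
    rewrite ler_wpM2r ?subr_ge0 ?(ltW xy)// ler_wpM2l// ler_pM//.
      rewrite ger0_norm ?powR_ge0// !powRN lef_pV2 ?posrE ?powR_gt0//.
      apply: ge0_ler_powR; [exact: le_trans alpha_ge1|by rewrite nnegrE ltW|by rewrite nnegrE ltW|].
      exact: le_trans ax (ltW xt).
    by apply: zM; rewrite (ltW t0) (le_trans (ltW ty)) ?(le_trans yb).
  + apply: eq_L2 (L2Z r (C01_L2 cq)) => x /[dup] x01 /andP[x0 x1].
    rewrite du// -solfluxE// mulrCA (mulrA (x `^ (alpha / 2))); congr (_ * (_ * _)).
    rewrite -powRD; last by apply/implyP => _; rewrite gt_eqF.
    by congr (_ `^ _); field.
  + exists (fun x => r * z x); split.
    * have [M M0 pM] := C01_bounded cp.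
      have K0 : 0 < `|r| * ((1 + `|ev n|) * M) by rewrite !mulr_gt0 ?normr_gt0 ?ltr_wpDr.
      apply: (lipschitz_abs_continuous K0) => x y x0 xy y1.
      have [||t /andP[xt ty] E] := @MVT R z (fun x => - ev n * p x) x y xy.
      + by move=> t; rewrite in_itv/= => /andP[xt _]; apply: dz; exact: le_lt_trans xt.
      + by apply: continuous_subspaceW cz; apply: subset_itv; rewrite bnd_simp.
      have t01 : 0 <= t <= 1 by rewrite (le_trans x0 (ltW xt)) (le_trans (ltW ty)).
      rewrite -mulrBr E (normrM r) (normrM _ (y - x)) (normrM (- ev n)) [`|y - x|]gtr0_norm ?subr_gt0// mulrA.
      rewrite ler_wpM2r ?subr_ge0 ?(ltW xy)// ler_wpM2l// normrN ler_pM//.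
        by rewrite lerDr.
      exact: pM.
    * by apply: aeW => x; rewrite in_itv/=; exact: fluxE.
    * apply: eq_L2 (Lp (- ev n * r)) => x x01; rewrite derive1E.
      have [_ dv] := drz x x01; apply: etrans (esym dv).
      by rewrite uP'//; exact: (esym (mulrA _ _ _)).
- apply: aeW => x; rewrite in_itv/= => /[dup] x01 /andP[x0 x1].
  rewrite derive1E (@near_eq_derive _ _ _ (flux alpha u) (fun x => r * z x)).
    by have [_ ->] := drz x x01; rewrite mulNr opprK.
  by apply: filterS (near_in_itv x0 x1) => y; exact: fluxE.
- have /(continuous_within_itvP _ ltr01)[_ z0 _] := cz.
  have : r * z x @[x --> 0^'+] --> r * z 0 by apply: cvgM => //; exact: cvg_cst.
  rewrite {2}/z solflux0 mulr0; apply: cvg_trans; apply: near_eq_cvg; near=> x.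
  apply/esym/fluxE/andP; split; near: x; [exact: nbhs_right_gt|exact: nbhs_right_lt].
- have := @solflux_cvg_end (ev n) r; rewrite solflux_end// mulr0.
  apply: cvg_trans; apply: near_eq_cvg; near=> x.
  apply/esym/du/andP; split; near: x; [exact: nbhs_left_gt|exact: nbhs_left_lt].
Unshelve. all: by end_near. Qed.

Lemma sqrt_gapE n : sqrt_gap alpha n = k * (bessel_zero c n.+1 - bessel_zero c n).
Proof. by rewrite /sqrt_gap !sqrt_eigval// mulrBr. Qed.

Lemma sqrt_gap_decr (m n : nat) : (1 <= m)%N -> (m < n)%N -> sqrt_gap alpha n < sqrt_gap alpha m.
Proof.
move=> m1; elim: n => // n ih; rewrite ltnS leq_eqVlt => mn.
have gap : sqrt_gap alpha n.+1 < sqrt_gap alpha n.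
  have n0 : (0 < n)%N by case/orP: mn => [/eqP<-|/ltnW/(leq_trans m1)].
  by case: n n0 {ih mn} => // n _; rewrite !sqrt_gapE ltr_pM2l// bessel_gap_decr.
by case/predU1P: mn => [->//|/ih]; exact: lt_trans.
Qed.

Lemma sqrt_gap_cvg : sqrt_gap alpha n @[n --> \oo] --> (2 - alpha) / 2 * pi.
Proof.
under eq_fun do rewrite sqrt_gapE.
by apply: cvgM; [exact: cvg_cst|exact: bessel_gap_cvg].
Qed.

End EigenProblem.

Theorem proposition3p2 (R : realType) (alpha : R)
    (alpha_ge1 : 1 <= alpha) (alpha_lt2 : alpha < 2) :
  [/\ (forall (lambda : R) (Phi : R -> R),
         eigen_solution alpha lambda Phi <->
         exists (n : nat) (rho : R),
           [/\ rho != 0, lambda = eigval alpha n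
             & forall x : R, x \in `]0, 1] -> Phi x = rho * eigfun alpha n x]),
      orthonormal_basis (eigfun alpha),
      (forall m n : nat, (1 <= m)%N -> (m < n)%N ->
         sqrt_gap alpha n < sqrt_gap alpha m)
    & sqrt_gap alpha n @[n --> \oo] --> (2 - alpha) / 2 * pi].
Proof.
split; [|exact: eigfun_basis|exact: sqrt_gap_decr|exact: sqrt_gap_cvg].
move=> lambda Phi; split; first exact: eigen_solution_eigfun.
by move=> [n [rho [rho0 -> PhiE]]]; exact: eigfun_eigen_solution rho0 PhiE.
Qed.
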